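(* For any meander $M$, the probability $\mathbb{P}[S_0=M]$ belongs to $\mathbb{Q}[\tfrac1\pi]$, where $S_0$ is the shape of the component of $0$ in the infinite noodle.
   Context: Infinite noodle: for each $i\in\mathbb{Z}$ choose two directions in $\{\mathrm{Left},\mathrm{Right}\}$, one drawn as an arrow at $i$ above the line and one as an arrow at $i$ below the line; all directions are independent and uniform. Independently above and below the line, the arrows pointing to the right are connected with arrows pointing to the left in the unique non-crossing way (i.e. as in parenthesis matching, where Right is an opening and Left a closing parenthesis); almost surely every arrow gets matched. This gives an upper and a lower non-crossing perfect matching of $\mathbb{Z}$. The component of $0$ is the connected component containing $0$ in the (multi)graph on $\mathbb{Z}$ whose edges are the pairs of the two matchings. Meander: a meander of size $k\ge1$ is a simple closed curve in the plane intersecting the real line exactly at the points $0,\dots,2k-1$, with simple crossings, up to continuous deformation fixing the horizontal axis. Equivalently, it is a pair of non-crossing perfect matchings of $\{0,\dots,2k-1\}$ (one drawn above and one below the line) whose union forms a single loop. Shape: if the component of $0$ is finite, with intersection points $p_0<p_1<\dots<p_{2k-1}$ with the real line, its shape $S_0$ is the meander of size $k$ obtained by relabeling $p_j$ as $j$, i.e. keeping only the relative order of the points. (If the component of $0$ is infinite, the event $S_0=M$ does not hold.) *)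

(* Defs.v *)
From HB Require Import structures.
From mathcomp Require Import all_boot all_order all_algebra.
From mathcomp Require Import all_classical all_reals all_analysis.

Set Implicit Arguments.
Unset Strict Implicit.
Unset Printing Implicit Defensive.

Import Order.TTheory GRing.Theory Num.Theory.

Local Open Scope classical_set_scope.
Local Open Scope ring_scope.

(* A matching is given by its partner map [m]; the arcs are the {i, m i}. *)
Definition noncrossing_perfect_matching {disp : Order.disp_t}
    {V : orderType disp} (m : V -> V) : Prop :=
  [/\ involutive m,
      forall i, m i != i &
      forall i j, ~~ [&& (i < j)%O, (j < m i)%O & (m i < m j)%O]].

Definition joined {V : eqType} (mu ml : V -> V) : rel V :=
  fun x y => (y == mu x) || (y == ml x).

Definition component {V : eqType} (mu ml : V -> V) (x : V) : set V :=
  [set y | exists2 s : seq V, path (joined mu ml) x s & last x s = y].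

(* Every vertex has degree 2 in the multigraph formed by two perfect matchings,
   whose components are therefore loops when the vertex set is finite: there is
   a single loop iff the multigraph is connected. *)
Record meander (k : nat) := Meander {
  upper : {ffun 'I_k.*2 -> 'I_k.*2};
  lower : {ffun 'I_k.*2 -> 'I_k.*2};
  upper_matching : noncrossing_perfect_matching upper;
  lower_matching : noncrossing_perfect_matching lower;
  single_loop : forall i, component upper lower i = [set: 'I_k.*2]
}.

(* [true] encodes Right, [false] encodes Left.  The arrow at [i] is the opening
   end of its arc iff it points to the right; as [m] is an involution, every arc
   then joins a Right arrow to a Left arrow on its right.  For a given [dir]
   there is at most one such [m], and almost surely there is one. *)
Definition arrow_matching (dir : int -> bool) (m : int -> int) : Prop :=
  noncrossing_perfect_matching m /\ forall i, dir i = (i < m i).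

(* [p] enumerates increasingly the intersection points p_0 < ... < p_{2k-1}. *)
Definition component0_has_shape (k : nat) (mu ml : int -> int)
    (M : meander k) : Prop :=
  exists p : 'I_k.*2 -> int,
    [/\ forall i j : 'I_k.*2, (i < j)%N -> p i < p j,
        range p = component mu ml 0,
        forall i, mu (p i) = p (upper M i) &
        forall i, ml (p i) = p (lower M i)].

(* [S_0 = M] for the noodle with directions [up] and [dn]; it fails when some
   arrow is unmatched or the component of 0 is infinite. *)
Definition S0_is (k : nat) (up dn : int -> bool) (M : meander k) : Prop :=
  exists mu ml : int -> int,
    [/\ arrow_matching up mu, arrow_matching dn ml &
        component0_has_shape mu ml M].

Definition mutually_independent {d d' : measure_display}
    {T : measurableType d} {U : measurableType d'} {R : realType}
    (P : probability T R) {I : eqType} (X : I -> {RV P >-> U}) : Prop :=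
  forall (s : seq I) (A : I -> set U), uniq s ->
    (forall i, measurable (A i)) ->
    P (\bigcap_(i in [set` s]) (X i @^-1` A i)) =
    (\prod_(i <- s) P (X i @^-1` A i))%E.

Definition infinite_noodle {d : measure_display} {T : measurableType d}
    {R : realType} (P : probability T R)
    (up dn : int -> {RV P >-> bool}) : Prop :=
  let X (a : int + int) : {RV P >-> bool} :=
    match a with inl i => up i | inr i => dn i end in
  mutually_independent X /\
  forall a b, P (X a @^-1` [set b]) = (2^-1)%:E.

(* Main.v *)
Require Import Defs.
From HB Require Import structures.
From mathcomp Require Import all_boot all_order all_algebra.
From mathcomp Require Import all_classical all_reals all_analysis.
From mathcomp Require Import measurable_realfun.
From mathcomp Require Import ring lra zify.

Set Implicit Arguments.
Unset Strict Implicit.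
Unset Printing Implicit Defensive.

Import Order.TTheory GRing.Theory Num.Theory.
Import numFieldNormedType.Exports.

Local Open Scope classical_set_scope.
Local Open Scope ring_scope.

(* Condition on the index [z] of the point 0 in the meander [M] and on the gaps
   between consecutive points.  The component of 0 then has shape [M] iff every
   point carries the arrow prescribed by [M] and, for each face of [M] under an
   upper or a lower arc, the arrows in the gaps of that face form a balanced word.
   Faces use disjoint sets of arrows, so the probability is [4 ^- (2 * k)] times
   the product over the faces of Cat(m) / 4^m, where 2m is the total length of
   the gaps of the face.

   Each gap lies in at most one upper and one lower face, and since [M] is a
   single loop the resulting graph on the faces is a forest: if a set of gaps met
   every face an even number of times, the parity of the number of these gaps to
   the left of a point would be constant along the loop, so the set is empty.
   Hence the sum over the gaps can be computed by removing leaves.  As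
   Cat(m) / 4^m = 2/pi * int sech^3 tanh^(2m), removing a leaf of weight [f]
   multiplies the weight [g] of its neighbour by
   a |-> 2/pi * int sech^3 f / (1 - tanh^2 tanh(a)^2) dx.
   The even nonnegative functions that belong to Q[1/pi][x/pi, tanh, sech] up to
   a power of tanh are stable under this operation.  Their final integrals
   1/pi * int sech f lie in Q[1/pi]: integration by parts lowers the order of
   the pole at 0, and the remaining moments of sech, sech^2 and x/sinh satisfy
   recurrences deduced from explicit convolutions such as
   (sech * sech)(a) = 2a / sinh a. *)

(** * Integrals of rapidly decaying functions on the line *)

Section RealLine.
Variable R : realType.
Implicit Types (f g F : R -> R) (a x y : R).
Local Notation mu := (@lebesgue_measure R).

(** In the variable t = tanh x the measure 2/pi sech^3 x dx becomes 2/pi sqrt(1 - t^2) dt, the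
    semicircle law, whose even moments are Cat(m) / 4^m; this is the origin of the integrals. A
    label shared by two faces then gives a geometric series in the product of their variables. The
    hyperbolic variable is chosen because 1 - tanh x tanh a = ch (x - a) sech x sech a: up to
    factors the kernel is a translate of sech, and moments of translates are polynomials in a. Two
    obstacles shape the analysis. The reduction to translates divides by tanh a, so bounded
    functions acquire apparent poles at 0, and parity and order of vanishing have to be carried
    along. Positive powers of pi must also disappear: the n-th moment of sech is a rational multiple
    of pi^(n+1), which dividing the variable and the integral by pi compensates exactly. On the
    combinatorial side the words under nested arcs overlap; deleting balanced subwords leaves the
    independent conditions on faces. These involve finitely many arrows each, and the existence of
    the two infinite matchings enters only as an almost sure event. *)

Definition Iint f : R := Rintegral mu setT f.

(** The explicit bound gives integrability by comparison and, unlike integrability, also the limit 0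
    at both infinities that integration by parts requires. *)
Definition qdecay f := measurable_fun setT f /\
  exists C, forall x, `|f x| <= C / (1 + x ^+ 2).

Lemma integrable_oneDsqrV C : mu.-integrable setT (fun x => (C / oneDsqr x)%:E).
Proof.
have i1 : mu.-integrable setT (fun x : R => ((oneDsqr x)^-1)%:E).
  have c1 : continuous (fun x : R => (oneDsqr x)^-1).
    exact: continuous_oneDsqrV.
  apply/integrableP; split.
    apply/measurable_EFinP; exact: continuous_measurable_fun.
  have p0 : forall x : R, (0 <= (oneDsqr x)^-1)%R by move=> x; rewrite invr_ge0.
  under eq_integral do rewrite gee0_abs ?lee_fin//.
  rewrite ge0_symfun_integralT//; last by move=> x /=; rewrite /oneDsqr sqrrN.
  by rewrite -set_itvcy integral0y_oneDsqr -EFinM ltry.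
have := @integrableZl _ _ _ mu _ measurableT C _ i1.
by apply: eq_integrable => // x _ /=; rewrite EFinM.
Qed.

Lemma qdecay_integrable f : qdecay f -> mu.-integrable setT (EFin \o f).
Proof.
move=> [mf [C fC]].
apply: le_integrable (integrable_oneDsqrV C) => //.
  exact/measurable_EFinP.
move=> x _ /=; rewrite lee_fin (le_trans (fC x))// ler_norm//.
Qed.

Lemma qdecayD f g : qdecay f -> qdecay g -> qdecay (fun x => f x + g x).
Proof.
move=> [mf [C fC]] [mg [D gD]]; split; first exact: measurable_funD.
exists (C + D) => x; rewrite mulrDl.
by rewrite (le_trans (ler_normD _ _))// lerD.
Qed.

Lemma qdecayM f g (C : R) : qdecay f -> measurable_fun setT g ->
  (forall x, `|g x| <= C) -> qdecay (fun x => f x * g x).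
Proof.
move=> [mf [D fD]] mg gC; split; first exact: measurable_funM.
exists (D * C) => x; rewrite normrM mulrAC.
by rewrite ler_pM.
Qed.

Lemma qdecayZ f k : qdecay f -> qdecay (fun x => k * f x).
Proof.
move=> af; have := @qdecayM f (cst k) `|k| af (measurable_cst _) (fun=> lexx _).
by under eq_fun do rewrite mulrC.
Qed.

Lemma eq_qdecay f g : f =1 g -> qdecay f -> qdecay g.
Proof. by move=> /funext ->. Qed.

Lemma qdecay_le f g : measurable_fun setT f -> qdecay g ->
  (forall x, `|f x| <= `|g x|) -> qdecay f.
Proof.
by move=> mf [mg [C gC]] fg; split=> //; exists C => x; exact: le_trans (gC x).
Qed.

Lemma IintD f g : qdecay f -> qdecay g -> Iint (fun x => f x + g x) = Iint f + Iint g.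
Proof. by move=> af ag; rewrite /Iint -RintegralD//; exact: qdecay_integrable. Qed.

Lemma IintZ f k : qdecay f -> Iint (fun x => k * f x) = k * Iint f.
Proof. by move=> af; rewrite /Iint RintegralZl//; exact: qdecay_integrable. Qed.

Lemma IintB f g : qdecay f -> qdecay g -> Iint (fun x => f x - g x) = Iint f - Iint g.
Proof. by move=> af ag; rewrite /Iint -RintegralB//; exact: qdecay_integrable. Qed.

Lemma Iint0 : Iint (fun=> 0) = 0.
Proof. by rewrite /Iint /Rintegral integral0. Qed.

Lemma eq_Iint f g : f =1 g -> Iint f = Iint g.
Proof. by move=> /funext ->. Qed.

Lemma qdecay0 : qdecay (fun=> 0).
Proof. by split=> //; exists 0 => x; rewrite normr0 mul0r. Qed.

Lemma qdecay_sum I (r : seq I) (h : I -> R -> R) : (forall i, qdecay (h i)) ->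
  qdecay (fun x => \sum_(i <- r) h i x).
Proof.
move=> ah; elim: r => [|i r IH].
  by under eq_fun do rewrite big_nil; exact: qdecay0.
by under eq_fun do rewrite big_cons; exact: qdecayD.
Qed.

Lemma Iint_sum I (r : seq I) (h : I -> R -> R) : (forall i, qdecay (h i)) ->
  Iint (fun x => \sum_(i <- r) h i x) = \sum_(i <- r) Iint (h i).
Proof.
move=> ah; elim: r => [|i r IH].
  by rewrite big_nil; under eq_Iint do rewrite big_nil; exact: Iint0.
by rewrite big_cons -IH -IintD//; [apply: eq_Iint => x; rewrite big_cons|exact: qdecay_sum].
Qed.

Lemma ge0_EFin_Iint f : qdecay f -> (Iint f)%:E = (\int[mu]_x (f x)%:E)%E.
Proof.
move=> af; rewrite /Iint /Rintegral fineK//.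
by apply: integrable_fin_num => //; exact: qdecay_integrable.
Qed.

Lemma measurable_shift a : measurable_fun setT (fun x : R => x + a).
Proof. by apply: measurable_funD => //; exact: measurable_id. Qed.

Lemma lebesgue_measureD a (A : set R) : measurable A ->
  pushforward mu ((fun x => x + a) : _ -> measurableTypeR R) A = mu A.
Proof.
move=> mA.
have mphi : measurable_fun setT ((fun x => x + a) : R -> measurableTypeR R).
  exact: measurable_shift.
pose phi : {mfun R >-> measurableTypeR R} :=
  HB.pack (fun x : R => x + a) (isMeasurableFun.Build _ _ _ _ _ mphi).
apply/esym.
apply: (@lebesgue_measure_unique R (pushforward mu phi)) => // _ [[p q]] _ <-.
have E : (fun x => x + a) @^-1` `]p, q] = `](p - a), (q - a)]%classic.
  by apply/seteqP; split=> x /=; rewrite !in_itv/= ltrBlDr lerBrDr.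
transitivity (mu `](p - a), (q - a)]%classic); last by rewrite -E.
rewrite !lebesgue_measure_itv/= !lte_fin ltrD2r.
by rewrite -!EFinB opprB addrA subrK.
Qed.

Lemma Iint_invariant (phi : R -> R) f : measurable_fun setT phi ->
  (forall A, measurable A ->
     pushforward mu (phi : R -> measurableTypeR R) A = mu A) ->
  measurable_fun setT f -> qdecay (f \o phi) -> Iint (f \o phi) = Iint f.
Proof.
move=> mphi inv mf af; rewrite /Iint /Rintegral; congr fine.
have := @integral_pushforward _ _ (measurableTypeR R) (measurableTypeR R) R phi mphi mu setT
  (EFin \o f).
rewrite preimage_setT => /(_ _ _ measurableT)/= <-.
- by apply: eq_measure_integral => A mA _; exact: inv.
- exact/measurable_EFinP.
- exact: qdecay_integrable.
Qed.

Lemma qdecay_shift a f : qdecay f -> qdecay (fun x => f (x + a)).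
Proof.
move=> [mf [C fC]]; split.
  by apply: measurableT_comp => //; exact: measurable_shift.
exists (C * (2 + 2 * a ^+ 2)) => x; apply: le_trans (fC _) _.
have C0 : 0 <= C.
  have := fC 0; rewrite expr0n/= addr0 divr1; exact: le_trans.
rewrite -mulrA ler_wpM2l// ler_pdivlMr ?ltr_pwDl ?sqr_ge0// ler_pdivrMl ?ltr_pwDl ?sqr_ge0//.
have := sqr_ge0 (x + 2 * a); have := sqr_ge0 (a * (x + a)); have := sqr_ge0 x.
nra.
Qed.

Lemma Iint_shift a f : qdecay f -> Iint (fun x => f (x + a)) = Iint f.
Proof.
move=> af; apply: (@Iint_invariant (fun x => x + a)).
- exact: measurable_shift.
- exact: lebesgue_measureD.
- exact: af.1.
- exact: qdecay_shift.
Qed.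

Lemma qdecay_opp f : qdecay f -> qdecay (fun x => f (- x)).
Proof.
move=> [mf [C fC]]; split; first by apply: measurableT_comp => //; exact: oppr_measurable.
by exists C => x; rewrite -(sqrrN x).
Qed.

Lemma Iint_opp f : qdecay f -> Iint (fun x => f (- x)) = Iint f.
Proof.
move=> af; apply: (@Iint_invariant -%R).
- exact: oppr_measurable.
- exact: lebesgue_measureN.
- exact: af.1.
- exact: qdecay_opp.
Qed.

Lemma Iint_odd f : qdecay f -> (forall x, f (- x) = - f x) -> Iint f = 0.
Proof.
move=> af fo; have := Iint_opp af.
under eq_Iint do rewrite fo -mulN1r.
by rewrite IintZ//; lra.
Qed.

(** Division by zero gives 0, so quotients by [sh x] or by powers of [thn x] have a default value at
    the origin and identities between them hold only off 0. Changing a function at this point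
    preserves measurability and, in [eq0_Iint], the integral. *)
Lemma measurable_eq0 f g : (forall x, x != 0 -> f x = g x) ->
  measurable_fun setT f -> measurable_fun setT g.
Proof.
move=> fg mf.
have -> : g = fun x => f x + (g 0 - f 0) * \1_[set 0] x.
  apply/funext => x; rewrite indicE; have [->|x0] := eqVneq x 0.
    by rewrite mem_set// mulr1 addrC subrK.
  by rewrite memNset ?mulr0 ?addr0 ?fg//= => /eqP; rewrite (negbTE x0).
by apply: measurable_funD => //; apply: measurable_funM.
Qed.

Lemma eq0_Iint f g : measurable_fun setT f ->
  (forall x, x != 0 -> f x = g x) -> Iint f = Iint g.
Proof.
move=> mf fg; rewrite /Iint /Rintegral; congr fine.
have mg := measurable_eq0 fg mf.
have mD : measurable ([set: R] `\ 0) by apply: measurableD.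
rewrite -(@integral_setD1 _ (EFin \o f) 0)//; last first.
  exact/measurable_EFinP/measurable_funTS.
rewrite -[RHS](@integral_setD1 _ (EFin \o g) 0)//; last first.
  exact/measurable_EFinP/measurable_funTS.
apply: eq_integral => x; rewrite inE => -[_ /= x0]; congr EFin.
by apply: fg; apply/eqP.
Qed.

Lemma der1D f g x a b : is_derive x 1 f a -> is_derive x 1 g b ->
  is_derive x 1 (fun t => f t + g t) (a + b).
Proof. exact: is_deriveD. Qed.

Lemma der1N f x a : is_derive x 1 f a -> is_derive x 1 (fun t => - f t) (- a).
Proof. exact: is_deriveN. Qed.

Lemma der1B f g x a b : is_derive x 1 f a -> is_derive x 1 g b ->
  is_derive x 1 (fun t => f t - g t) (a - b).
Proof. exact: is_deriveB. Qed.

Lemma der1M f g x a b : is_derive x 1 f a -> is_derive x 1 g b ->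
  is_derive x 1 (fun t => f t * g t) (a * g x + f x * b).
Proof.
move=> df dg; have := @is_deriveM _ _ f g x 1 a b df dg.
by rewrite addrC /= [g x *: a]mulrC.
Qed.

Lemma der1V f x a : f x != 0 -> is_derive x 1 f a ->
  is_derive x 1 (fun t => (f t)^-1) (- a / f x ^+ 2).
Proof.
move=> fx0 df; have := is_deriveV fx0 df.
by rewrite scaleNr mulNr [_ *: _]mulrC.
Qed.

Lemma der1_cst c x : is_derive x 1 (fun=> c : R) 0.
Proof. exact: is_derive_cst. Qed.

Lemma der1_id x : is_derive x 1 (fun t : R => t) 1.
Proof. exact: is_derive_id. Qed.

Lemma der1_comp f g x a b : is_derive (g x) 1 f a -> is_derive x 1 g b ->
  is_derive x 1 (fun t => f (g t)) (a * b).
Proof. exact: is_derive1_comp. Qed.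

Lemma der1Z k f x a : is_derive x 1 f a -> is_derive x 1 (fun t => k * f t) (k * a).
Proof.
by move=> df; have := der1M (der1_cst k x) df; rewrite mul0r add0r.
Qed.

Lemma der1X n f x a : is_derive x 1 f a ->
  is_derive x 1 (fun t => f t ^+ n.+1) (n.+1%:R * f x ^+ n * a).
Proof.
move=> df; have := @is_deriveX _ _ f n.+1 x 1 a df.
rewrite /=; congr is_derive; apply/funext => t.
by rewrite fctE.
Qed.

Lemma der1_cont f x a : is_derive x 1 f a -> {for x, continuous f}.
Proof.
by move=> [df _]; apply/differentiable_continuous/derivable1_diffP.
Qed.

Lemma measurable_pos : measurable_fun setT (fun x : R => ((0 < x)%R%:R : R)).
Proof.
have -> : (fun x : R => ((0 < x)%R%:R : R)) = \1_(`]0, +oo[%classic).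
  by apply/funext => x; rewrite indicE; congr (nat_of_bool _)%:R;
     apply/idP/idP; rewrite inE/= in_itv/= andbT.
by apply: measurable_indic.
Qed.

Lemma qdecay_pos f : qdecay f -> qdecay (fun x => f x * (0 < x)%R%:R).
Proof.
move=> af; apply: (@qdecayM _ _ 1) => //; first exact: measurable_pos.
by move=> x; case: (0 < x); rewrite ?normr1// normr0.
Qed.

Lemma cvg_harmonic2 : (n.+2%:R^-1 : R) @[n --> \oo] --> (0 : R).
Proof. by have := @cvg_harmonic R; rewrite -(@cvg_shiftS _ (@harmonic R)). Qed.

Lemma cvgr_idn2 : (n.+2%:R : R) @[n --> \oo] --> +oo.
Proof.
apply/cvgryPge => x.
have /cvgryPge/(_ x) := @cvgr_idn R.
move=> [N _ NP]; exists N => // n /= Nn.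
by rewrite (le_trans (NP n Nn))// ler_nat -addn2 leq_addr.
Qed.

(** The primitives used later are quotients, differentiated off the origin and only continuous
    there. The fundamental theorem on compact intervals of the open half-line is combined with
    dominated convergence, [|f|] being the dominating function. *)
Lemma Iint_FTC_pos f F (l : R) : qdecay f -> {for 0, continuous F} ->
  (forall x, 0 < x -> is_derive x 1 F (f x)) ->
  (forall x, 0 < x -> {for x, continuous f}) ->
  F x @[x --> +oo] --> l ->
  Iint (fun x => f x * (0 < x)%R%:R) = l - F 0.
Proof.
move=> af F0 dF cf Fl.
(* The shift by 2 makes [a n < b n] strict already for [n = 0]. *)
pose a n : R := n.+2%:R^-1; pose b n : R := n.+2%:R.
have a0 n : 0 < a n by rewrite /a invr_gt0.
have ab n : a n < b n.
  by rewrite /a /b (@lt_trans _ _ 1)// ?ltr1n// invf_lt1 ?ltr1n ?ltr0n.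
pose f_ n x := (f \_ `[a n, b n]) x.
pose g x := f x * (0 < x)%R%:R.
have mf_ n : measurable_fun setT (f_ n).
  by apply/(measurable_restrictT f) => //; apply: measurable_funTS; exact: af.1.
have intf n : (\int[mu]_x (f_ n x)%:E = (F (b n) - F (a n))%:E)%E.
  have -> : (fun x => (f_ n x)%:E) = (EFin \o f) \_ `[a n, b n].
    by rewrite restrict_EFin.
  rewrite -integral_mkcond.
  rewrite (@continuous_FTC2 _ f F) ?EFinB//.
  - apply: continuous_in_subspaceT => x; rewrite inE/= in_itv/= => /andP[ax _].
    exact/cf/(lt_le_trans (a0 n) ax).
  - have cF x : 0 < x -> {for x, continuous F}.
      by move=> x0; apply/differentiable_continuous/derivable1_diffP; case: (dF x x0).
    split.
    + by move=> x; rewrite in_itv/= => /andP[ax _]; case: (dF x (lt_trans (a0 n) ax)).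
    + by apply: cvg_at_right_filter; exact: cF.
    + by apply: cvg_at_left_filter; apply: cF; exact: lt_trans (ab n).
  - move=> x; rewrite in_itv/= => /andP[ax _].
    by rewrite derive1E; case: (dF x (lt_trans (a0 n) ax)).
have mf_E n : measurable_fun setT (EFin \o f_ n) by exact/measurable_EFinP.
have mgE : measurable_fun setT (EFin \o g).
  by apply/measurable_EFinP; have [] := qdecay_pos af.
have := @dominated_convergence _ _ _ mu setT measurableT
  (fun n => EFin \o f_ n) (EFin \o g) (EFin \o (fun x => `|f x|)) mf_E mgE.
case.
- apply: aeW => x _ /=; apply: cvg_EFin; first by apply: nearW.
  have [x0|x0] := ltP 0 x; last first.
    rewrite (_ : g x = 0); last by rewrite /g ltNge x0 mulr0.
    rewrite (_ : _ \o _ = cst 0); first exact: cvg_cst.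
    apply/funext => n /=; rewrite /f_ patchE memNset//= in_itv/= => /andP[ax _].
    by have := lt_le_trans (a0 n) ax; rewrite ltNge x0.
  rewrite (_ : g x = f x); last by rewrite /g x0 mulr1.
  apply: cvg_near_cst; near=> n => /=.
  rewrite /f_ patchE mem_set//= in_itv/=; apply/andP; split.
    near: n; exact: (@cvgr_le R _ _ _ _ 0 cvg_harmonic2 x x0).
  by near: n; move/cvgryPge: cvgr_idn2; apply.
- exact: integrable_norm (qdecay_integrable af).
- apply: aeW => x n _ /=; rewrite lee_fin /f_ patchE; case: ifP => //.
  by rewrite normr0.
move=> _ _; rewrite [X in X @ _ --> _](_ : _ = (fun n => (F (b n) - F (a n))%:E)); last first.
  by apply/funext => n; exact: intf.
move=> h1; have h2 : (F (b n) - F (a n))%:E @[n --> \oo] --> (l - F 0)%:E.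
  apply: cvg_EFin; first exact: nearW.
  apply: cvgB.
    by apply: (@cvg_comp _ _ _ b F) Fl; exact: cvgr_idn2.
  by apply: (@cvg_comp _ _ _ a F) F0; exact: cvg_harmonic2.
have := @cvg_unique _ (@ereal_hausdorff R) _ _ _ _ h1 h2.
rewrite -(ge0_EFin_Iint (qdecay_pos af)).
by move=> E; apply: EFin_inj; exact: E.
Unshelve. all: end_near. Qed.

Lemma Iint_FTC f F (la lb : R) : qdecay f -> {for 0, continuous F} ->
  (forall x, x != 0 -> is_derive x 1 F (f x)) ->
  (forall x, x != 0 -> {for x, continuous f}) ->
  F x @[x --> -oo] --> la ->
  F x @[x --> +oo] --> lb ->
  Iint f = lb - la.
Proof.
move=> af F0 dF cf Fla Flb.
have h1 : Iint (fun x => f x * (0 < x)%R%:R) = lb - F 0.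
  by apply: Iint_FTC_pos => // x x0; [apply: dF|apply: cf]; rewrite gt_eqF.
have h2 : Iint (fun x => f (- x) * (0 < x)%R%:R) = - la - - F (- 0).
  apply: (@Iint_FTC_pos (fun x => f (- x)) (fun x => - F (- x))).
  - exact: qdecay_opp.
  - apply: continuousN; apply: (@continuous_comp _ _ _ -%R F).
      exact: oppr_continuous.
    by rewrite oppr0.
  - move=> x x0; have := dF (- x); rewrite oppr_eq0 gt_eqF// => /(_ isT) dFx.
    have := der1N (der1_comp dFx (@is_deriveNid _ _ x 1)).
    by rewrite mulrN1 opprK.
  - move=> x x0; apply: (@continuous_comp _ _ _ -%R f); first exact: oppr_continuous.
    by apply: cf; rewrite oppr_eq0 gt_eqF.
  - by apply: cvgN; exact: (cvgNy_compNP F (nbhs la)).1.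
have E : Iint f = Iint (fun x => f x * (0 < x)%R%:R + f x * (0 < - x)%R%:R).
  apply: eq0_Iint; first exact: af.1.
  move=> x x0; rewrite oppr_gt0; case: (ltgtP x 0) x0 => //= _ _.
    by rewrite mulr0 mulr1 add0r.
  by rewrite mulr0 mulr1 addr0.
have a2 : qdecay (fun x => f (- x) * (0 < x)%R%:R) by apply/qdecay_pos/qdecay_opp.
rewrite E IintD; [|exact: qdecay_pos|].
  rewrite h1.
  have := Iint_opp a2; under eq_Iint do rewrite opprK.
  by move=> ->; rewrite h2 oppr0; ring.
by apply: eq_qdecay (qdecay_opp a2) => x /=; rewrite opprK.
Unshelve. all: end_near. Qed.

Lemma addsqr_gt0 x : 0 < 1 + x ^+ 2.
Proof. by rewrite ltr_pwDl// sqr_ge0. Qed.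

Lemma cvg0_oneDsqr f C : (forall x, `|f x| <= C / (1 + x ^+ 2)) ->
  f x @[x --> +oo] --> 0 /\ f x @[x --> -oo] --> 0.
Proof.
move=> fC.
have C0 : 0 <= C.
  by have := fC 0; rewrite expr0n/= addr0 divr1; exact: le_trans.
have key e x : 0 < e -> C / e + 1 <= `|x| -> `|0 - f x| <= e.
  move=> e0 Cx; rewrite sub0r normrN (le_trans (fC x))//.
  rewrite ler_pdivrMr ?addsqr_gt0//.
  have x1 : 1 <= `|x| by rewrite (le_trans _ Cx)// lerDr divr_ge0// ltW.
  have : C / e <= `|x| by rewrite (le_trans _ Cx)// lerDl.
  rewrite ler_pdivrMr// mulrC => /le_trans; apply; rewrite ler_pM2l//.
  rewrite -[x ^+ 2]real_normK ?num_real//; nra.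
split; apply/cvgrPdist_le => e e0; near=> x; apply: key => //.
  apply: le_trans (ler_norm x); near: x; apply: nbhs_pinfty_ge.
  exact: num_real.
rewrite -normrN; apply: le_trans (ler_norm (- x)); rewrite lerNr; near: x.
by apply: nbhs_ninfty_le; exact: num_real.
Unshelve. all: end_near. Qed.

Lemma Iint_derive0 f F : qdecay f -> {for 0, continuous F} ->
  (forall x, x != 0 -> is_derive x 1 F (f x)) ->
  (forall x, x != 0 -> {for x, continuous f}) ->
  (exists C, forall x, `|F x| <= C / (1 + x ^+ 2)) -> Iint f = 0.
Proof.
move=> af cF dF cf [C /cvg0_oneDsqr[Fp Fn]].
by rewrite (Iint_FTC af cF dF cf Fn Fp) subrr.
Qed.

(** * Hyperbolic functions and their convolutions *)

Definition ch x : R := (expR x + expR (- x)) / 2.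
Definition sh x : R := (expR x - expR (- x)) / 2.
Definition sech x : R := (ch x)^-1.
Definition thn x : R := sh x / ch x.

Lemma ch_gt0 x : 0 < ch x.
Proof. by rewrite divr_gt0// addr_gt0// expR_gt0. Qed.

Lemma ch_neq0 x : ch x != 0. Proof. by rewrite gt_eqF// ch_gt0. Qed.

Lemma chN x : ch (- x) = ch x. Proof. by rewrite /ch opprK addrC. Qed.

Lemma shN x : sh (- x) = - sh x. Proof. by rewrite /sh opprK -mulNr opprB. Qed.

Lemma sh0 : sh 0 = 0. Proof. by rewrite /sh oppr0 expR0; lra. Qed.

Lemma chD x y : ch (x + y) = ch x * ch y + sh x * sh y.
Proof. by rewrite /ch /sh opprD !expRD; field. Qed.

Lemma shD x y : sh (x + y) = sh x * ch y + ch x * sh y.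
Proof. by rewrite /ch /sh opprD !expRD; field. Qed.

Lemma ch2sh2 x : ch x ^+ 2 = 1 + sh x ^+ 2.
Proof.
rewrite /ch /sh expRN; have := expR_gt0 x; set e := expR x => e0.
by field; rewrite gt_eqF.
Qed.

Lemma sh_gt0 x : 0 < x -> 0 < sh x.
Proof. by move=> x0; rewrite divr_gt0// subr_gt0 ltr_expR; lra. Qed.

Lemma sh_neq0 x : x != 0 -> sh x != 0.
Proof.
case: (ltgtP x 0) => // x0 _; last by rewrite gt_eqF// sh_gt0.
by rewrite -[x]opprK shN oppr_eq0 gt_eqF// sh_gt0// oppr_gt0.
Qed.

Lemma der1_ch x : is_derive x 1 ch (sh x).
Proof.
apply: is_derive_eq (der1M (der1D (is_derive_expR x)
  (der1_comp (is_derive_expR (- x)) (is_deriveNid x 1))) (der1_cst 2^-1 x)) _.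
by rewrite mulr0 addr0 mulrN1.
Qed.

Lemma der1_sh x : is_derive x 1 sh (ch x).
Proof.
apply: is_derive_eq (der1M (der1B (is_derive_expR x)
  (der1_comp (is_derive_expR (- x)) (is_deriveNid x 1))) (der1_cst 2^-1 x)) _.
by rewrite mulr0 addr0 mulrN1 opprK.
Qed.

Lemma der1_sech x : is_derive x 1 sech (- (thn x * sech x)).
Proof.
apply: is_derive_eq (der1V (ch_neq0 x) (der1_ch x)) _.
by rewrite /thn /sech; field; exact: ch_neq0.
Qed.

Lemma sech2E x : sech x ^+ 2 = 1 - thn x ^+ 2.
Proof.
apply/eqP; rewrite eq_sym subr_eq; apply/eqP; rewrite /thn /sech.
rewrite exprMn exprVn -[X in X + _]mul1r -mulrDl -ch2sh2 divff//.
by rewrite expf_neq0// ch_neq0.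
Qed.

Lemma der1_thn x : is_derive x 1 thn (sech x ^+ 2).
Proof.
apply: is_derive_eq (der1M (der1_sh x) (der1_sech x)) _.
by rewrite sech2E /thn /sech; field; exact: ch_neq0.
Qed.

Lemma continuous_ch : continuous ch. Proof. by move=> x; exact: der1_cont (der1_ch x). Qed.

Lemma continuous_sh : continuous sh. Proof. by move=> x; exact: der1_cont (der1_sh x). Qed.

Lemma continuous_sech : continuous sech. Proof. by move=> x; exact: der1_cont (der1_sech x). Qed.

Lemma continuous_thn : continuous thn. Proof. by move=> x; exact: der1_cont (der1_thn x). Qed.

Lemma sech_gt0 x : 0 < sech x. Proof. by rewrite invr_gt0 ch_gt0. Qed.

Lemma sechN x : sech (- x) = sech x. Proof. by rewrite /sech chN. Qed.

Lemma thnN x : thn (- x) = - thn x. Proof. by rewrite /thn chN shN mulNr. Qed.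

Lemma thn0 : thn 0 = 0. Proof. by rewrite /thn sh0 mul0r. Qed.

Lemma thn_lt1 x : `|thn x| < 1.
Proof.
rewrite -(@ltr_pXn2r _ 2) ?nnegrE// expr1n real_normK ?num_real//.
by rewrite -subr_gt0 -sech2E exprn_gt0// sech_gt0.
Qed.

Lemma thn_neq0 x : x != 0 -> thn x != 0.
Proof. by move=> x0; rewrite /thn mulf_neq0 ?invr_eq0 ?ch_neq0 ?sh_neq0. Qed.

Lemma sech_le1 x : sech x <= 1.
Proof.
rewrite /sech invf_le1 ?ch_gt0//.
by have := ch2sh2 x; have := ch_gt0 x; have := sqr_ge0 (sh x); nra.
Qed.

Lemma expr_le_ch n x : `|x| ^+ n <= (2 * n`!)%:R * ch x.
Proof.
have ex : expR `|x| <= 2 * ch x.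
  rewrite /ch mulrC divfK//.
  by case: (ger0P x) => _; rewrite ?opprK (lerDl, lerDr) expR_ge0.
rewrite natrM -mulrA mulrCA.
apply: le_trans (ler_wpM2l (ler0n _ _) ex).
case: n => [|n].
  by rewrite expr0 fact0 mul1r -[leLHS]expR0 ler_expR.
rewrite -ler_pdivrMl ?ltr0n ?fact_gt0//.
by apply: le_trans (expR_ge1Dxn n (normr_ge0 x)); rewrite mulrC lerDr.
Qed.

Lemma expr_sech_le n : exists C, forall x, `|x ^+ n * sech x| <= C / (1 + x ^+ 2).
Proof.
exists ((2 * n`!)%:R + (2 * n.+2`!)%:R) => x.
rewrite ler_pdivlMr ?addsqr_gt0// normrM normrX [`|sech x|]gtr0_norm ?sech_gt0//.
rewrite mulrAC ler_pdivrMr ?ch_gt0// mulrDr mulr1 mulrDl lerD ?expr_le_ch//.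
by rewrite -[x ^+ 2]real_normK ?num_real// -exprD addn2 expr_le_ch.
Qed.

(** * Moments of rapidly decaying functions *)

Definition rapid f := measurable_fun setT f /\
  forall n : nat, qdecay (fun x => x ^+ n * f x).

Definition moment n f : R := Iint (fun x => x ^+ n * f x).

Lemma measurable_X n : measurable_fun setT (fun x : R => x ^+ n).
Proof. exact: measurable_funX. Qed.

Lemma rapid_qdecay f : rapid f -> qdecay f.
Proof. by case=> _ /(_ 0%N); apply: eq_qdecay => x; rewrite expr0 mul1r. Qed.

Lemma rapidM f g (C : R) : rapid f -> measurable_fun setT g ->
  (forall x, `|g x| <= C) -> rapid (fun x => f x * g x).
Proof.
move=> [mf af] mg gC; split; first exact: measurable_funM.
by move=> n; apply: eq_qdecay (qdecayM (af n) mg gC) => x; rewrite mulrA.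
Qed.

Lemma rapidX n f : rapid f -> rapid (fun x => x ^+ n * f x).
Proof.
move=> [mf af]; split; first by apply: measurable_funM => //; exact: measurable_X.
by move=> m; apply: eq_qdecay (af (m + n)%N) => x; rewrite exprD mulrA.
Qed.

Lemma rapidD f g : rapid f -> rapid g -> rapid (fun x => f x + g x).
Proof.
move=> [mf af] [mg ag]; split; first exact: measurable_funD.
by move=> n; apply: eq_qdecay (qdecayD (af n) (ag n)) => x; rewrite mulrDr.
Qed.

Lemma rapidZ k f : rapid f -> rapid (fun x => k * f x).
Proof.
move=> [mf af]; split; first by apply: measurable_funM.
by move=> n; apply: eq_qdecay (qdecayZ k (af n)) => x; rewrite mulrCA.
Qed.

Lemma qdecay_bounded f : qdecay f -> exists C, forall x, `|f x| <= C.
Proof.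
move=> [_ [C fC]]; exists C => x; apply: le_trans (fC x) _.
have C0 : 0 <= C by have := fC 0; rewrite expr0n/= addr0 divr1; exact: le_trans.
by rewrite ler_pdivrMr ?addsqr_gt0// ler_peMr// lerDl sqr_ge0.
Qed.

Lemma rapid_sech : rapid sech.
Proof.
split; first exact: continuous_measurable_fun continuous_sech.
move=> n; split.
  apply: measurable_funM; first exact: measurable_X.
  exact: continuous_measurable_fun continuous_sech.
exact: expr_sech_le.
Qed.

Lemma exprB_sum x a n : (x - a) ^+ n =
  \sum_(i < n.+1) ('C(n, i)%:R * (- a) ^+ i) * x ^+ (n - i).
Proof.
rewrite exprDn; apply: eq_bigr => i _.
by rewrite -mulr_natl; ring.
Qed.

Lemma rapid_shift f a : rapid f -> rapid (fun x => f (x + a)).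
Proof.
move=> rf; split.
  by apply: (measurableT_comp rf.1); exact: measurable_shift.
move=> n; have h : qdecay (fun x => (x - a) ^+ n * f x).
  have : qdecay (fun x => \sum_(i < n.+1)
      ('C(n, i)%:R * (- a) ^+ i) * (x ^+ (n - i) * f x)).
    by apply: qdecay_sum => i; apply: qdecayZ; exact: rf.2.
  apply: eq_qdecay => x; rewrite exprB_sum mulr_suml.
  by apply: eq_bigr => i _; rewrite mulrA.
by apply: eq_qdecay (qdecay_shift a h) => x; rewrite addrK.
Qed.

Lemma moment_shift n f a : rapid f -> moment n (fun x => f (x + a)) =
  \sum_(i < n.+1) ('C(n, i)%:R * (- a) ^+ i) * moment (n - i) f.
Proof.
move=> rf; have -> : moment n (fun x => f (x + a)) =
    Iint (fun x => (x - a) ^+ n * f x).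
  rewrite -(@Iint_shift a).
    by apply: eq_Iint => x; rewrite addrK.
  by apply: eq_qdecay (qdecay_shift (- a) ((rapid_shift a rf).2 n)) => x; rewrite subrK.
under eq_Iint do rewrite exprB_sum mulr_suml.
rewrite Iint_sum.
  apply: eq_bigr => i _; rewrite -IintZ; last exact: rf.2.
  by apply: eq_Iint => x; rewrite mulrA.
move=> i; apply: eq_qdecay (qdecayZ ('C(n, i)%:R * (- a) ^+ i) (rf.2 (n - i)%N)) => x.
by rewrite mulrA.
Qed.

(** Tonelli for [y ^ n * f x * g (x + y)], nonnegative because [n] is even; integrating first in [y]
    gives moments of translates of [g], expanded by the binomial formula. The convolution is
    prescribed only for [a != 0] since its closed forms may divide by [sh a]. *)
Lemma conv_moment n f g h : ~~ odd n -> rapid f -> rapid g ->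
  (forall x, 0 <= f x) -> (forall x, 0 <= g x) -> rapid h ->
  (forall a, a != 0 -> Iint (fun x => f x * g (x + a)) = h a) ->
  moment n h = \sum_(i < n.+1) 'C(n, i)%:R * (-1) ^+ i * (moment i f * moment (n - i) g).
Proof.
move=> en rf rg f0 g0 rh fgh.
have xn x : 0 <= x ^+ n by rewrite exprn_even_ge0.
have [D gD] := qdecay_bounded (rapid_qdecay rg).
have afg a : qdecay (fun x => f x * g (x + a)).
  apply: (qdecayM (rapid_qdecay rf) (rapid_shift a rg).1 (fun x => gD (x + a))).
pose k (z : R * R) := (z.2 ^+ n * (f z.1 * g (z.1 + z.2)))%:E.
have k0 z : (0 <= k z)%E by rewrite lee_fin !mulr_ge0.
have mk : measurable_fun setT k.
  apply/measurable_EFinP; apply: measurable_funM.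
    by apply: (measurableT_comp (measurable_X n)); exact: measurable_snd.
  apply: measurable_funM; first by apply: (measurableT_comp rf.1); exact: measurable_fst.
  apply: (measurableT_comp rg.1); apply: measurable_funD.
    exact: measurable_fst.
  exact: measurable_snd.
have := @fubini_tonelli _ _ _ _ R mu mu k mk k0.
have E1 x : (\int[mu]_y k (x, y))%E = (f x * moment n (fun y => g (y + x)))%:E.
  rewrite -IintZ; last by exact: (rapid_shift x rg).2.
  rewrite ge0_EFin_Iint; last by apply: qdecayZ; exact: (rapid_shift x rg).2.
  by apply: eq_integral => y _; rewrite /k/= [x + y]addrC mulrCA.
have E2 y : (\int[mu]_x k (x, y))%E = (y ^+ n * Iint (fun x => f x * g (x + y)))%:E.
  rewrite -IintZ// ge0_EFin_Iint; last exact: qdecayZ.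
  by apply: eq_integral.
under eq_integral do rewrite E1.
under [in X in _ = X -> _]eq_integral do rewrite E2.
move=> E; have {E} : Iint (fun x => f x * moment n (fun y => g (y + x))) =
    Iint (fun y => y ^+ n * Iint (fun x => f x * g (x + y))).
  by rewrite /Iint /Rintegral E.
rewrite [RHS](_ : _ = moment n h); last first.
  apply/esym/eq0_Iint; first exact: (rh.2 n).1.
  by move=> y y0; rewrite fgh.
move=> <-.
have E3 x : f x * moment n (fun y => g (y + x)) =
    \sum_(i < n.+1) ('C(n, i)%:R * (-1) ^+ i * moment (n - i) g) * (x ^+ i * f x).
  rewrite moment_shift// mulr_sumr; apply: eq_bigr => i _.
  by rewrite [(- x) ^+ i]exprNn; ring.
under eq_Iint do rewrite E3.
rewrite Iint_sum; last by move=> i; apply: qdecayZ; exact: rf.2.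
apply: eq_bigr => i _; rewrite IintZ; last exact: rf.2.
by rewrite -/(moment _ _); ring.
Qed.

Lemma lebesgue_measure_double (A : set R) : measurable A ->
  (2%:E * pushforward mu ((fun x => (2 * x)%R) : _ -> measurableTypeR R) A)%E = mu A.
Proof.
move=> mA.
have mphi : measurable_fun setT ((fun x => 2 * x) : R -> measurableTypeR R).
  by apply: measurable_funM.
pose phi : {mfun R >-> measurableTypeR R} :=
  HB.pack (fun x : R => 2 * x) (isMeasurableFun.Build _ _ _ _ _ mphi).
apply/esym.
pose c2 : {nonneg R} := NngNum (ler0n R 2).
have Ipole := @lebesgue_measure_unique R (mscale c2 (pushforward mu phi)).
rewrite (Ipole mphi _ A mA)// => _ [[p q]] _ <-.
have E : (fun x => 2 * x) @^-1` `]p, q] = `](p / 2), (q / 2)]%classic.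
  by apply/seteqP; split=> x /=; rewrite !in_itv/= ltr_pdivrMr// ler_pdivlMr// mulrC.
transitivity (2%:E * mu (`](p / 2)%R, (q / 2)%R]%classic))%E; last by rewrite -E.
rewrite !lebesgue_measure_itv/= !lte_fin ltr_pM2r//.
case: ifP => _; last by rewrite mule0.
by rewrite -!EFinB -EFinM; congr EFin; field.
Qed.

Lemma Iint_double f : measurable_fun setT f -> (forall x, 0 <= f x) ->
  Iint (fun x => f (2 * x)) = Iint f / 2.
Proof.
move=> mf f0.
have mphi : measurable_fun setT ((fun x => 2 * x) : R -> measurableTypeR R).
  by apply: measurable_funM.
pose phi : {mfun R >-> measurableTypeR R} :=
  HB.pack (fun x : R => 2 * x) (isMeasurableFun.Build _ _ _ _ _ mphi).
have mfE : measurable_fun setT (EFin \o f) by exact/measurable_EFinP.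
pose c2 : {nonneg R} := NngNum (ler0n R 2).
have [nu nuE] : exists nu : {measure set (measurableTypeR R) -> \bar R},
    forall A, nu A = pushforward mu phi A.
  by unshelve eexists (pushforward mu phi : {measure set (measurableTypeR R) -> \bar R}).
have E : (\int[mu]_x (f x)%:E)%E = (2%:E * \int[mu]_x (f (2 * x)%R)%:E)%E.
  transitivity (\int[mscale c2 nu]_x (f x)%:E)%E.
    apply: eq_measure_integral => A mA _.
    apply: eq_trans (esym (lebesgue_measure_double mA)) _.
    exact: (congr1 (fun z => 2%:E * z)%E (esym (nuE A))).
  rewrite ge0_integral_mscale//; last by move=> x _; rewrite lee_fin.
  congr (_ * _)%E.
  transitivity (\int[pushforward mu phi]_x (f x)%:E)%E.
    exact: (eq_measure_integral (pushforward mu phi)).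
  rewrite ge0_integral_pushforward//.
  by move=> x _; rewrite lee_fin.
rewrite /Iint /Rintegral E.
case: (\int[mu]_x (f (2 * x)%R)%:E)%E => [r| |] /=; rewrite -?EFinM/=; first by field.
  by rewrite mulry gtr0_sg// mul1e/= mul0r.
by rewrite mulrNy gtr0_sg// mul1e/= mul0r.
Qed.

Lemma measurable_sech : measurable_fun setT sech.
Proof. exact: continuous_measurable_fun continuous_sech. Qed.

Lemma measurable_thn : measurable_fun setT thn.
Proof. exact: continuous_measurable_fun continuous_thn. Qed.

Lemma rapid_le f g : measurable_fun setT f -> rapid g ->
  (forall x, `|f x| <= `|g x|) -> rapid f.
Proof.
move=> mf [mg ag] fg; split=> // n; apply: qdecay_le (ag n) _.
  by apply: measurable_funM => //; exact: measurable_X.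
by move=> x; rewrite !normrM ler_wpM2l.
Qed.

Lemma rapid_sech1 : rapid (fun x => (1 + `|x|) * sech x).
Proof.
have m1 : measurable_fun setT (fun x : R => 1 + `|x|).
  by apply: measurable_funD => //; exact: measurableT_comp.
split; first exact: measurable_funM m1 measurable_sech.
move=> n.
have [_ [C1 h1]] := rapid_sech.2 n; have [_ [C2 h2]] := rapid_sech.2 n.+1.
split.
  apply: measurable_funM; first exact: measurable_X.
  exact: measurable_funM m1 measurable_sech.
exists (C1 + C2) => x; rewrite [leRHS]mulrDl.
apply: le_trans (lerD (h1 x) (h2 x)).
rewrite exprS !normrM [`|1 + `|x| |]ger0_norm ?addr_ge0//.
by rewrite le_eqVlt; apply/orP; left; apply/eqP; ring.
Qed.

(** For [x >= 0] this is [1 + 2 x <= exp (2 x)] after clearing denominators. It controls both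
    [x / sh x] and the inverse powers of [thn x]. *)
Lemma ler_norm_thn x : `|x| <= (1 + `|x|) * `|thn x|.
Proof.
wlog x0 : x / 0 <= x.
  move=> h; case: (leP 0 x) => [/h//|x0].
  by have := h (- x); rewrite normrN thnN normrN; apply; rewrite oppr_ge0 ltW.
have [->|xn0] := eqVneq x 0; first by rewrite normr0 mulr_ge0.
have s0 : 0 < sh x by rewrite sh_gt0// lt_neqAle eq_sym xn0.
rewrite (ger0_norm x0) gtr0_norm; last by rewrite /thn divr_gt0// ch_gt0.
rewrite /thn mulrA ler_pdivlMr ?ch_gt0// /ch /sh mulrA mulrA ler_pM2r ?invr_gt0//.
have := expR_ge1Dx (2 * x); rewrite mulrC mulrDr mulr1 expRD => h.
have e0 := expR_gt0 x; have := expRxMexpNx_1 x.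
have : 0 < expR (- x) by exact: expR_gt0.
set e := expR x in e0 h *; set e' := expR (- x) => e'0 ee'.
suff : (1 + (x + x)) * e' <= e by nra.
have -> : e = (e * e) * e' by rewrite -mulrA ee' mulr1.
by rewrite ler_pM2r.
Qed.

Definition xcsch x : R := x / sh x.

Lemma xcsch_le x : `|xcsch x| <= (1 + `|x|) * sech x.
Proof.
have [->|xn0] := eqVneq x 0.
  by rewrite /xcsch mul0r normr0 mulr_ge0// ltW ?sech_gt0// addr_gt0.
have -> : `|xcsch x| = `|x| / `|sh x| by rewrite /xcsch normf_div.
rewrite ler_pdivrMr ?normr_gt0 ?sh_neq0// /sech.
have := ler_norm_thn x; have -> : `|thn x| = `|sh x| / ch x.
  by rewrite /thn normf_div (gtr0_norm (ch_gt0 x)).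
by rewrite mulrA mulrAC.
Qed.

Lemma xcsch_ge0 x : 0 <= xcsch x.
Proof.
rewrite /xcsch; have [x0|x0|<-] := ltgtP 0 x.
- by rewrite divr_ge0// ltW// sh_gt0.
- by rewrite -[x]opprK shN invrN mulrNN divr_ge0// ltW// ?sh_gt0 ?oppr_gt0.
- by rewrite mul0r.
Qed.

Lemma continuous_xcsch x : x != 0 -> {for x, continuous xcsch}.
Proof.
move=> x0; apply: continuousM; first exact: cvg_id.
by apply: continuousV; [exact: sh_neq0|exact: continuous_sh].
Qed.

Lemma measurable_off0 f : (forall x, x != 0 -> {for x, continuous f}) ->
  measurable_fun setT f.
Proof.
move=> cf.
have mD : measurable ([set: R] `\ 0) by apply: measurableD.
have -> : [set: R] = ([set: R] `\ 0) `|` [set 0].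
  by apply/seteqP; split=> // x _; have [->|/eqP x0] := eqVneq x 0; [right|left].
apply/measurable_funU => //; split; last exact: measurable_fun_set1.
apply: open_continuous_measurable_fun.
  by rewrite setTD; apply: closed_openC; exact: (accessible_closed_set1 (hausdorff_accessible (@Rhausdorff R))).
by move=> x; rewrite inE => -[_ /= x0]; apply: cf; exact/eqP.
Qed.

Lemma measurable_xcsch : measurable_fun setT xcsch.
Proof. by apply: measurable_off0 => x; exact: continuous_xcsch. Qed.

Lemma rapid_xcsch : rapid xcsch.
Proof.
apply: rapid_le measurable_xcsch rapid_sech1 _ => x.
by rewrite [leRHS]ger0_norm ?xcsch_le// mulr_ge0 ?addr_ge0// ltW// sech_gt0.
Qed.

Lemma cvgy_thn : thn x @[x --> +oo] --> (1 : R).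
Proof.
have [C hC] := expr_sech_le 0.
have [s0 _] := @cvg0_oneDsqr sech C (fun x => ltac:(by have := hC x; rewrite expr0 mul1r)).
apply: (@squeeze_cvgr _ _ _ R (fun x => 1 - sech x) (fun=> 1)).
- near=> x; have x0 : 0 <= x by near: x; apply: nbhs_pinfty_ge; exact: num_real.
  rewrite (ltW (le_lt_trans (ler_norm _) (thn_lt1 x))) andbT.
  have := sech2E x; have := sech_gt0 x; have := sech_le1 x.
  have : 0 <= thn x.
    have [->|xn0] := eqVneq x 0; first by rewrite thn0.
    by rewrite /thn divr_ge0// ltW ?ch_gt0// sh_gt0// lt_neqAle eq_sym xn0.
  by nra.
- by rewrite -[X in _ --> X]subr0; apply: cvgB => //; exact: cvg_cst.
- exact: cvg_cst.
Unshelve. all: end_near. Qed.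

Lemma cvgNy_odd f l : (forall x, f (- x) = - f x) ->
  f x @[x --> +oo] --> l -> f x @[x --> -oo] --> (- l : R).
Proof.
move=> fo fl; apply/(cvgNy_compNP f (nbhs (- l))).
by rewrite (_ : f \o -%R = \- f); [exact: cvgN|apply/funext => x /=; exact: fo].
Qed.

Lemma cvgy_sh : sh x @[x --> +oo] --> +oo.
Proof.
apply/cvgryPge => A; near=> x.
have x0 : 0 <= x by near: x; apply: nbhs_pinfty_ge; exact: num_real.
have : 2 * A + 1 <= x by near: x; apply: nbhs_pinfty_ge; exact: num_real.
have := expR_ge1Dx x; rewrite /sh ler_pdivlMr//.
have : expR (- x) <= 1 by rewrite expR_le1 oppr_le0.
lra.
Unshelve. all: end_near. Qed.

Lemma moment0_sech : moment 0 sech = pi.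
Proof.
have e : (fun x => x ^+ 0 * sech x) =1 sech by move=> x; rewrite expr0 mul1r.
rewrite /moment (eq_Iint e).
have la : atan (sh x) @[x --> +oo] --> (pi / 2 : R).
  by apply: (@cvg_comp _ _ _ sh atan) cvgy_sh _; exact: cvgy_atan.
have lb : atan (sh x) @[x --> -oo] --> (- (pi / 2) : R).
  by apply: (@cvgNy_odd (fun x => atan (sh x))) la => x; rewrite shN atanN.
have dF x : is_derive x 1 (fun x => atan (sh x)) (sech x).
  apply: is_derive_eq (der1_comp (is_derive1_atan (sh x)) (der1_sh x)) _.
  by rewrite -ch2sh2 /sech; field; exact: ch_neq0.
rewrite (@Iint_FTC sech (fun x => atan (sh x)) (- (pi / 2)) (pi / 2)) //.
- by field.
- exact: rapid_qdecay rapid_sech.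
- exact: der1_cont (dF 0).
- by move=> x _; exact: continuous_sech.
Qed.

Definition sech2 x : R := sech x ^+ 2.

Lemma continuous_sech2 : continuous sech2.
Proof. by move=> x; exact: (der1_cont (der1X 1 (der1_sech x))). Qed.

Lemma rapid_sech2 : rapid sech2.
Proof.
have -> : sech2 = fun x => sech x * sech x by apply/funext => x; rewrite /sech2 expr2.
apply: (@rapidM _ _ 1) rapid_sech measurable_sech _ => x.
by rewrite gtr0_norm ?sech_gt0// sech_le1.
Qed.

Lemma moment0_sech2 : moment 0 sech2 = 2.
Proof.
have e : (fun x => x ^+ 0 * sech2 x) =1 sech2 by move=> x; rewrite expr0 mul1r.
rewrite /moment (eq_Iint e).
have -> : 2 = 1 - (-1) :> R by rewrite opprK.
apply: (@Iint_FTC sech2 thn).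
- exact: rapid_qdecay rapid_sech2.
- exact: continuous_thn.
- by move=> x _; exact: der1_thn.
- by move=> x _; exact: continuous_sech2.
- by apply: cvgNy_odd cvgy_thn; exact: thnN.
- exact: cvgy_thn.
Qed.

(** * Explicit convolutions with sech and the resulting recurrences for moments *)

Lemma qdecay_sech_shift f a : rapid f -> qdecay (fun x => sech x * f (x + a)).
Proof.
move=> rf; have [C fC] := qdecay_bounded (rapid_qdecay rf).
exact: (qdecayM (rapid_qdecay rapid_sech) (rapid_shift a rf).1 (fun x => fC (x + a))).
Qed.

(** A primitive is [ln (ch a + sh a * thn x) / sh a], because the argument of the logarithm equals
    [ch (x + a) / ch x]. *)
Lemma sech_conv_sech a : a != 0 ->
  Iint (fun x => sech x * sech (x + a)) = 2 * xcsch a.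
Proof.
move=> a0; have s0 := sh_neq0 a0.
have chE x : ch a + sh a * thn x = ch (x + a) * sech x.
  by rewrite chD /thn /sech; field; exact: ch_neq0.
have pos x : 0 < ch a + sh a * thn x by rewrite chE mulr_gt0 ?ch_gt0 ?sech_gt0.
have dF x : is_derive x 1 (fun x => ln (ch a + sh a * thn x) / sh a)
    (sech x * sech (x + a)).
  have d1 := der1D (der1_cst (ch a) x) (der1Z (sh a) (der1_thn x)).
  have d2 := @der1_comp (@ln R) (fun x => ch a + sh a * thn x) x _ _
    (is_derive1_ln (pos x)) d1.
  apply: is_derive_eq (der1M d2 (der1_cst (sh a)^-1 x)) _.
  rewrite mulr0 addr0 add0r chE /sech; field.
  by rewrite s0 !ch_neq0.
have expE b : ch b + sh b = expR b by rewrite /ch /sh; field.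
(* Both infinities at once: [e] is the limit 1 or -1 of [thn], and
   [ch a + sh a * e = exp (e * a)]. *)
have cl (F : set_system R) (FF : Filter F) (e : R) : e * e = 1 ->
    thn x @[x --> F] --> e ->
    ln (ch a + sh a * thn x) / sh a @[x --> F] --> e * a / sh a.
  move=> ee te; apply: cvgM; last exact: cvg_cst.
  have -> : e * a = ln (ch a + sh a * e).
    have /eqP := ee; rewrite -expr2 sqrf_eq1 => /orP[]/eqP ->.
      by rewrite mul1r mulr1 expE expRK.
    by rewrite mulN1r mulrN1 -chN -shN expE expRK.
  apply: (@continuous_cvg _ _ _ _ _ (fun x => ch a + sh a * thn x) (@ln R)); last first.
    apply: cvgD; first exact: cvg_cst.
    by apply: cvgM => //; exact: cvg_cst.
  apply: continuous_ln.
  have /eqP := ee; rewrite -expr2 sqrf_eq1 => /orP[]/eqP ->.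
    by rewrite mulr1 expE expR_gt0.
  by rewrite mulrN1 -chN -shN expE expR_gt0.
have -> : 2 * xcsch a = 1 * a / sh a - (-1) * a / sh a by rewrite /xcsch; field.
apply: (Iint_FTC _ _ (fun x _ => dF x) _ (cl _ _ (-1) _ _) (cl _ _ 1 _ _)).
- exact: qdecay_sech_shift rapid_sech.
- exact: der1_cont (dF 0).
- move=> x _; apply: continuousM; first exact: continuous_sech.
  apply: (@continuous_comp _ _ _ (fun x => x + a) sech); last exact: continuous_sech.
  by apply: cvgD; [exact: cvg_id|exact: cvg_cst].
- by rewrite mulrNN mulr1.
- by apply: cvgNy_odd cvgy_thn; exact: thnN.
- by rewrite mulr1.
- exact: cvgy_thn.
Qed.

Lemma moment_odd n f : rapid f -> (forall x, f (- x) = f x) -> odd n ->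
  moment n f = 0.
Proof.
move=> rf ef on; apply: Iint_odd => [|x]; first exact: rf.2.
by rewrite ef exprNn -signr_odd on expr1 mulN1r mulNr.
Qed.

Lemma sech2N x : sech2 (- x) = sech2 x. Proof. by rewrite /sech2 sechN. Qed.

Lemma thn_diff x a : thn x - thn (x + a) = - sh a * (sech x * sech (x + a)).
Proof.
have -> : sh a = sh (x + a) * ch x - ch (x + a) * sh x.
  rewrite shD chD; transitivity (sh a * (ch x ^+ 2 - sh x ^+ 2)); last by ring.
  by rewrite ch2sh2; ring.
by rewrite /thn /sech; field; rewrite !ch_neq0.
Qed.

Lemma rapid_thn_diff a : rapid (fun x => thn x - thn (x + a)).
Proof.
have h : rapid (fun x => - sh a * (sech x * sech (x + a))).
  apply: rapidZ; apply: (@rapidM _ _ 1) rapid_sech _ _.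
    exact: (rapid_shift a rapid_sech).1.
  by move=> x; rewrite gtr0_norm ?sech_gt0// sech_le1.
by under eq_fun do rewrite thn_diff.
Qed.

(** Integration by parts. Only the difference of the two tanh decays, so it is kept together; its
    derivative is a difference of translates of [sech2], with moments polynomial in [a]. *)
Lemma moment_thn_diff n a : n.+1%:R * moment n (fun x => thn x - thn (x + a)) =
  moment n.+1 (fun x => sech2 (x + a)) - moment n.+1 sech2.
Proof.
have r1 := rapid_thn_diff a; have r2 := rapid_shift a rapid_sech2.
have A1 := qdecayZ n.+1%:R (r1.2 n); have A2 := r2.2 n.+1; have A3 := rapid_sech2.2 n.+1.
have dF x : is_derive x 1 (fun x => x ^+ n.+1 * (thn x - thn (x + a)))
    (n.+1%:R * (x ^+ n * (thn x - thn (x + a))) +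
     (x ^+ n.+1 * sech2 x - x ^+ n.+1 * sech2 (x + a))).
  have ds := @der1_comp thn (fun x => x + a) x _ _ (der1_thn (x + a))
    (der1D (der1_id x) (der1_cst a x)).
  apply: is_derive_eq (der1M (der1X n (der1_id x)) (der1B (der1_thn x) ds)) _.
  by rewrite addr0 !mulr1 /sech2; ring.
have /eqP : Iint (fun x => n.+1%:R * (x ^+ n * (thn x - thn (x + a))) +
     (x ^+ n.+1 * sech2 x - x ^+ n.+1 * sech2 (x + a))) = 0.
  apply: (Iint_derive0 _ _ (fun x _ => dF x)).
  - by apply: qdecayD => //; apply: qdecayD => //; under eq_fun do rewrite -mulN1r; exact: qdecayZ.
  - exact: der1_cont (dF 0).
  - move=> x _; have cs : continuous (fun x : R => x + a).
      by move=> y; apply: cvgD; [exact: cvg_id|exact: cvg_cst].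
    have cX m : continuous (fun x : R => x ^+ m) by move=> y; exact: exprn_continuous.
    have ct : continuous (fun x => thn (x + a)).
      by move=> y; apply: (@continuous_comp _ _ _ (fun x : R => x + a) thn);
        [exact: cs|exact: continuous_thn].
    have cs2 : continuous (fun x => sech2 (x + a)).
      by move=> y; apply: (@continuous_comp _ _ _ (fun x : R => x + a) sech2);
        [exact: cs|exact: continuous_sech2].
    apply: cvgD.
      apply: cvgM; first exact: cvg_cst.
      apply: cvgM; first exact: cX.
      by apply: cvgB; [exact: continuous_thn|exact: ct].
    apply: cvgB.
      by apply: cvgM; [exact: cX|exact: continuous_sech2].
    by apply: cvgM; [exact: cX|exact: cs2].
  - exact: (r1.2 n.+1).2.
rewrite IintD//; last by apply: qdecayD => //; under eq_fun do rewrite -mulN1r; exact: qdecayZ.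
rewrite IintB// IintZ; last exact: r1.2.
by rewrite -!/(moment _ _) addr_eq0 opprB => /eqP.
Qed.

(** Partial fractions in [y = x + a]: the product combines [thn y * sech y], which is odd, with
    [sech y] and [sech (y - a)], both of integral pi. The result [pi * (ch a - 1) / sh a ^ 2]
    simplifies by [ch a ^ 2 - 1 = sh a ^ 2]. *)
Lemma sech_conv_sech2 a : a != 0 ->
  Iint (fun x => sech x * sech2 (x + a)) = pi / (1 + ch a).
Proof.
move=> a0; have s0 := sh_neq0 a0.
have E x : sech x * sech2 (x + a) = (sh a)^-1 *
    ((thn (x + a) * sech (x + a) + ch a / sh a * sech (x + a)) +
     - (sh a)^-1 * sech x).
  have -> : x = (x + a) - a by rewrite addrK.
  rewrite subrK; set y := x + a; have := ch_neq0 (y - a).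
  rewrite /sech2 /sech /thn chD shN chN => h.
  have := ch2sh2 y; have := ch2sh2 a; have := ch_neq0 y; move: h s0.
  set C := ch y; set S := sh y; set c := ch a; set s := sh a => h s0 C0 hc hC.
  have h2 : s ^+ 2 = (s * S + c * C) * (C * c + S * - s) - C ^+ 2.
    have -> : (s * S + c * C) * (C * c + S * - s) - C ^+ 2 =
      C ^+ 2 * c ^+ 2 - S ^+ 2 * s ^+ 2 - C ^+ 2 by ring.
    by rewrite hC hc; ring.
  apply/eqP; rewrite -subr_eq0; apply/eqP.
  transitivity ((s ^+ 2 - ((s * S + c * C) * (C * c + S * - s) - C ^+ 2)) /
    (s ^+ 2 * C ^+ 2 * (C * c + S * - s))).
    by field; rewrite s0 C0 h.
  by rewrite -h2 subrr mul0r.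
have rs := rapid_shift a rapid_sech.
have rt : rapid (fun x => thn x * sech x).
  under eq_fun do rewrite mulrC.
  by apply: (@rapidM _ _ 1) rapid_sech measurable_thn _ => x; exact: ltW (thn_lt1 x).
under eq_Iint do rewrite E.
have a1 : qdecay (fun x => ch a / sh a * sech (x + a)) by apply: qdecayZ; exact: rapid_qdecay.
have a2 : qdecay (fun x => thn (x + a) * sech (x + a)).
  exact: rapid_qdecay (rapid_shift a rt).
have a3 : qdecay (fun x => - (sh a)^-1 * sech x).
  by apply: qdecayZ; exact: rapid_qdecay rapid_sech.
rewrite IintZ; last by apply: qdecayD => //; exact: qdecayD.
rewrite IintD//; last exact: qdecayD.
rewrite IintD// IintZ; last exact: rapid_qdecay.
rewrite IintZ; last exact: rapid_qdecay rapid_sech.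
have e0 : Iint sech = pi.
  by rewrite -moment0_sech; apply: eq_Iint => x; rewrite expr0 mul1r.
rewrite (@Iint_shift a sech (rapid_qdecay rapid_sech)) e0.
rewrite (@Iint_shift a (fun x => thn x * sech x) (rapid_qdecay rt)).
rewrite (Iint_odd (rapid_qdecay rt)); last by move=> x; rewrite thnN sechN mulNr.
have := ch2sh2 a; have : 1 + ch a != 0 by rewrite gt_eqF// addr_gt0// ch_gt0.
move=> h1 h2; apply/eqP; rewrite -subr_eq0; apply/eqP.
transitivity (pi * (ch a ^+ 2 - 1 - sh a ^+ 2) / (sh a ^+ 2 * (1 + ch a))).
  by field; rewrite h1 s0.
by rewrite h2; field; rewrite h1 s0.
Qed.

(** With [y = x + a], the addition formula gives [ch a / (sh y * ch (y - a)) = coth y - tanh (y -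
    a)], and [coth y - tanh y = 2 / sinh (2 y)]. The first moment of the remaining difference
    [tanh y - tanh (y - a)] is [a ^ 2]. *)
Lemma sech_conv_xcsch a :
  Iint (fun x => sech x * xcsch (x + a)) = sech a * (moment 0 xcsch / 2 + a ^+ 2).
Proof.
have rx2 : qdecay (fun y => xcsch (2 * y)).
  split.
    by apply: (measurableT_comp measurable_xcsch); exact: measurable_funM.
  have [_ [C hC]] := rapid_qdecay rapid_xcsch; exists C => x.
  apply: le_trans (hC _) _.
  have C0 : 0 <= C by have := hC 0; rewrite expr0n/= addr0 divr1; exact: le_trans.
  by rewrite ler_wpM2l// lef_pV2 ?posrE ?addsqr_gt0// lerD2l exprMn ler_peMl ?sqr_ge0//; lra.
have rt := (rapid_thn_diff (- a)).2 1%N.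
have E x : sech x * xcsch (x + a) =
    sech a * (xcsch (2 * (x + a)) + (x + a) ^+ 1 * (thn (x + a) - thn (x + a - a))).
  rewrite thn_diff addrK; set y := x + a.
  have -> : sech x = sech (y - a) by rewrite addrK.
  have [->|y0] := eqVneq y 0; first by rewrite /xcsch expr1 !(mulr0, mul0r, addr0).
  have -> : 2 * y = y + y by ring.
  have := sh_neq0 y0; have := ch_neq0 y; have := ch_neq0 (y - a).
  have := ch_neq0 a; rewrite /xcsch /sech shD chD !shN !chN expr1.
  set C := ch y; set S := sh y; set c := ch a; set s := sh a => c0 h C0 S0.
  have -> : (y + y) / (S * C + C * S) = y / (S * C).
    rewrite [C * S]mulrC -!mulr2n -mulr_natl -[in X in _ / X]mulr_natl.
    by rewrite -mulf_div divff ?mul1r// pnatr_eq0.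
  by field; rewrite S0 C0 c0 h.
under eq_Iint do rewrite E.
rewrite IintZ; last by apply: (qdecay_shift a (qdecayD rx2 rt)).
rewrite (@Iint_shift a (fun y => xcsch (2 * y) + y ^+ 1 * (thn y - thn (y - a))));
  last exact: qdecayD.
rewrite IintD// Iint_double; [|exact: measurable_xcsch|exact: xcsch_ge0].
congr (_ * (_ + _)).
  by congr (_ / _); apply: eq_Iint => x; rewrite expr0 mul1r.
have := moment_thn_diff 1 (- a).
rewrite moment_shift; last exact: rapid_sech2.
rewrite !big_ord_recr big_ord0/= moment0_sech2 /bump/= !subn0.
rewrite (@moment_odd 1 sech2)//; [|exact: rapid_sech2|exact: sech2N].
rewrite -/(moment _ _) opprK bin0 bin1 binn; set X := moment _ _; set Y := moment _ _.
by move=> h; apply: (mulfI (_ : 2 != 0 :> R)) => //; rewrite h; ring.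
Qed.

(** Comparison of total masses in the convolution of [sech] with itself. *)
Lemma moment0_xcsch : moment 0 xcsch = pi ^+ 2 / 2.
Proof.
have := @conv_moment 0 sech sech (fun x => 2 * xcsch x) isT rapid_sech rapid_sech
  (fun x => ltW (sech_gt0 x)) (fun x => ltW (sech_gt0 x)) (rapidZ 2 rapid_xcsch)
  sech_conv_sech.
rewrite big_ord_recr big_ord0/= subnn moment0_sech.
have -> : moment 0 (fun x => 2 * xcsch x) = 2 * moment 0 xcsch.
  by rewrite -IintZ; [apply: eq_Iint => x; ring|exact: rapid_xcsch.2].
rewrite bin0 expr0 !mul1r add0r => h.
by apply: (mulfI (_ : 2 != 0 :> R)) => //; rewrite h; field.
Qed.

Lemma moment_xcsch_rec n : ~~ odd n -> 2 * moment n xcsch =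
  \sum_(i < n.+1) 'C(n, i)%:R * (-1) ^+ i * (moment i sech * moment (n - i) sech).
Proof.
move=> en; rewrite -(@conv_moment n sech sech (fun x => 2 * xcsch x))//.
- by rewrite -IintZ; [apply: eq_Iint => x; ring|exact: rapid_xcsch.2].
- exact: rapid_sech.
- exact: rapid_sech.
- by move=> x; exact: ltW (sech_gt0 x).
- by move=> x; exact: ltW (sech_gt0 x).
- exact: rapidZ rapid_xcsch.
- exact: sech_conv_sech.
Qed.

(** The convolution of [sech] with [xcsch] is [sech a * (pi ^ 2 / 4 + a ^ 2)]; the summand [a ^ 2]
    raises the order of the moment by 2. *)
Lemma moment_sech_rec n : ~~ odd n -> moment n.+2 sech =
  \sum_(i < n.+1) 'C(n, i)%:R * (-1) ^+ i * (moment i sech * moment (n - i) xcsch)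
  - pi ^+ 2 / 4 * moment n sech.
Proof.
move=> en; rewrite -(@conv_moment n sech xcsch
  (fun x => pi ^+ 2 / 4 * sech x + x ^+ 2 * sech x))//.
- have -> : moment n (fun x => pi ^+ 2 / 4 * sech x + x ^+ 2 * sech x) =
      pi ^+ 2 / 4 * moment n sech + moment n.+2 sech.
    rewrite -IintZ; last exact: rapid_sech.2.
    rewrite -IintD; [|by apply: qdecayZ; exact: rapid_sech.2|exact: rapid_sech.2].
    by apply: eq_Iint => x; rewrite -[n.+2]addn2 exprD; ring.
  by ring.
- exact: rapid_sech.
- exact: rapid_xcsch.
- by move=> x; exact: ltW (sech_gt0 x).
- exact: xcsch_ge0.
- by apply: rapidD; [apply: rapidZ|apply: rapidX]; exact: rapid_sech.
- by move=> a _; rewrite sech_conv_xcsch moment0_xcsch; field.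
Qed.

(** The convolution is [pi / (1 + ch a)], and [1 + ch (2 x) = 2 * ch x ^ 2]: rescaling the variable
    turns it into a multiple of [sech2], whence the factor [2 ^ n]. The term [i = 0] on the right is
    [pi * moment n sech2]; for [n > 0] its coefficient differs from the one on the left, so the
    moment can be solved for. *)
Lemma moment_sech2_rec n : ~~ odd n -> pi * 2 ^+ n * moment n sech2 =
  \sum_(i < n.+1) 'C(n, i)%:R * (-1) ^+ i * (moment i sech * moment (n - i) sech2).
Proof.
move=> en.
have ch1 x : 1 + ch x != 0 by rewrite gt_eqF// addr_gt0// ch_gt0.
have ch1_gt0 x : 0 < 1 + ch x by rewrite addr_gt0// ch_gt0.
have ccg : continuous (fun x => pi / (1 + ch x)).
  move=> x; apply: cvgM; first exact: cvg_cst.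
  by apply: cvgV => //; apply: cvgD; [exact: cvg_cst|exact: continuous_ch].
have rg : rapid (fun x => pi / (1 + ch x)).
  apply: rapid_le (rapidZ pi rapid_sech) _; first exact: continuous_measurable_fun.
  move=> x; rewrite !ger0_norm; last 2 first.
  - by rewrite mulr_ge0 ?pi_ge0// ltW// sech_gt0.
  - by rewrite mulr_ge0 ?pi_ge0// invr_ge0 ltW.
  by rewrite ler_wpM2l ?pi_ge0// lef_pV2 ?posrE ?ch_gt0// lerDr.
rewrite -(@conv_moment n sech sech2 (fun x => pi / (1 + ch x)))//.
- rewrite /moment.
  have := @Iint_double (fun x => x ^+ n * (pi / (1 + ch x))) (rg.2 n).1.
  have e : (fun x => (2 * x) ^+ n * (pi / (1 + ch (2 * x)))) =1
      (fun x => pi * 2 ^+ n / 2 * (x ^+ n * sech2 x)).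
    move=> x; have -> : 2 * x = x + x by ring.
    rewrite chD -!expr2.
    have -> : 1 + (ch x ^+ 2 + sh x ^+ 2) = 2 * ch x ^+ 2.
      by rewrite ch2sh2; ring.
    have -> : x + x = 2 * x by ring.
    by rewrite exprMn /sech2 /sech; field; exact: ch_neq0.
  rewrite (eq_Iint e) IintZ; last exact: rapid_sech2.2.
  move=> h; have {}h := h (fun x => mulr_ge0 (exprn_even_ge0 _ en)
    (divr_ge0 (pi_ge0 R) (ltW (ch1_gt0 x)))).
  apply: (mulIf (_ : 2^-1 != 0 :> R)) => //.
  by rewrite -h; ring.
- exact: rapid_sech.
- exact: rapid_sech2.
- by move=> x; exact: ltW (sech_gt0 x).
- by move=> x; exact: sqr_ge0.
- exact: sech_conv_sech2.
Qed.

(** * Rationality of the moments *)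

(** The power of pi is recorded exactly, so that division by [pi ^ k] leaves a rational number. *)
Definition QpiX (k : nat) (r : R) := exists q : rat, r = ratr q * pi ^+ k.

Lemma QpiXD k r1 r2 : QpiX k r1 -> QpiX k r2 -> QpiX k (r1 + r2).
Proof.
by move=> [p ->] [q ->]; exists (p + q); rewrite rmorphD/= mulrDl.
Qed.

Lemma QpiXM k l r1 r2 : QpiX k r1 -> QpiX l r2 -> QpiX (k + l) (r1 * r2).
Proof.
move=> [p ->] [q ->]; exists (p * q); rewrite rmorphM/= exprD; ring.
Qed.

Lemma QpiX_sum k I (r : seq I) (P : pred I) (h : I -> R) :
  (forall i, P i -> QpiX k (h i)) -> QpiX k (\sum_(i <- r | P i) h i).
Proof.
move=> hk; elim/big_ind: _ => //; last by move=> ? ?; exact: QpiXD.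
by exists 0; rewrite rmorph0 mul0r.
Qed.

Lemma QpiX_rat q : QpiX 0 (ratr q).
Proof. by exists q; rewrite expr0 mulr1. Qed.

Lemma QpiXZ k q r : QpiX k r -> QpiX k (ratr q * r).
Proof. by move=> /(QpiXM (QpiX_rat q)). Qed.

(** The two claims form one induction: the moment of [sech] uses moments of both functions of lower
    order, that of [xcsch] uses moments of [sech] up to the same order. Terms with odd [i] vanish by
    symmetry. *)
Lemma moments_even n : ~~ odd n ->
  QpiX n.+1 (moment n sech) /\ QpiX n.+2 (moment n xcsch).
Proof.
have sgn (m i : nat) : 'C(m, i)%:R * (-1) ^+ i = ratr ('C(m, i)%:R * (-1) ^+ i) :> R.
  by rewrite rmorphM rmorph_nat rmorphXn rmorphN1.
elim/ltn_ind: n => n IH en.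
have odd0 f m : rapid f -> (forall x, f (- x) = f x) -> odd m -> moment m f = 0.
  exact: moment_odd.
have hs : QpiX n.+1 (moment n sech).
  case: n IH en => [|[//|n]] IH en.
    by rewrite moment0_sech; exists 1; rewrite rmorph1 mul1r expr1.
  rewrite moment_sech_rec; last by move: en; rewrite /= negbK.
  have en' : ~~ odd n by move: en; rewrite /= negbK.
  apply: QpiXD.
    apply: QpiX_sum => i _; rewrite sgn; apply: QpiXZ.
    have [oi|ei] := boolP (odd i).
      rewrite (@moment_odd i)//; [|exact: rapid_sech|exact: sechN].
      by rewrite mul0r; exists 0; rewrite rmorph0 mul0r.
    have li : (i <= n)%N by rewrite -ltnS.
    have -> : n.+3 = (i.+1 + (n - i).+2)%N by lia.
    apply: QpiXM; first by apply (IH i); [lia|].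
    by apply (IH (n - i)%N); [lia|rewrite oddB// (negbTE en') (negbTE ei)].
  have [p ->] := (IH n (ltac:(lia)) en').1.
  by exists (- (p / 4)); rewrite rmorphN rmorphM fmorphV rmorph_nat /= !exprS; field.
split=> //.
have -> : moment n xcsch = ratr (1 / 2) * (2 * moment n xcsch).
  by rewrite rmorphM fmorphV rmorph_nat rmorph1; field.
rewrite moment_xcsch_rec//; apply/QpiXZ/QpiX_sum => i _; rewrite sgn; apply: QpiXZ.
have [oi|ei] := boolP (odd i).
  rewrite (@moment_odd i)//; [|exact: rapid_sech|exact: sechN].
  by rewrite mul0r; exists 0; rewrite rmorph0 mul0r.
have li : (i <= n)%N by rewrite -ltnS.
have -> : n.+2 = (i.+1 + (n - i).+1)%N by lia.
apply: QpiXM.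
  (* For [i = n], and below for [i = 0], the moment of order [n] just obtained replaces the
     induction hypothesis. *)
  have [->//|ni] := eqVneq (i : nat) n.
  by apply (IH i) => //; lia.
have [/eqP->|i0] := boolP ((i : nat) == 0%N); first by rewrite subn0.
by apply (IH (n - i)%N); [lia|rewrite oddB// (negbTE en) (negbTE ei)].
Qed.

Lemma moment_sech_QpiX n : QpiX n.+1 (moment n sech).
Proof.
have [on|/moments_even[]//] := boolP (odd n).
rewrite (@moment_odd n)//; [|exact: rapid_sech|exact: sechN].
by exists 0; rewrite rmorph0 mul0r.
Qed.

Lemma moment_sech2_QpiX n : QpiX n (moment n sech2).
Proof.
elim/ltn_ind: n => n IH.
have [on|en] := boolP (odd n).
  rewrite (@moment_odd n)//; [|exact: rapid_sech2|exact: sech2N].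
  by exists 0; rewrite rmorph0 mul0r.
case: n IH en => [|n] IH en.
  by rewrite moment0_sech2; exists 2; rewrite rmorph_nat expr0 mulr1.
have := moment_sech2_rec en.
rewrite big_ord_recl/= bin0 expr0 !mul1r subn0 moment0_sech.
set S := \sum_(i < _) _ => h.
have pi0 : pi != 0 :> R by rewrite gt_eqF// pi_gt0.
(* Up to the factor pi, the coefficient of the unknown moment once the term [i = 0] of the
   recurrence is moved to the left. *)
have q0 : (2 ^+ n.+1 - 1 : rat) != 0.
  by rewrite subr_eq0 -natrX -[X in _ == X]/(1%:R) eqr_nat -(expn0 2) eqn_exp2l.
have [p hp] : QpiX n.+2 S.
  apply: QpiX_sum => i _; rewrite /bump/= add1n.
  have -> : 'C(n.+1, i.+1)%:R * (-1) ^+ i.+1 =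
      ratr ('C(n.+1, i.+1)%:R * (-1) ^+ i.+1) :> R.
    by rewrite rmorphM rmorph_nat rmorphXn rmorphN1.
  apply: QpiXZ; have li : (i <= n)%N by rewrite -ltnS.
  have -> : n.+2 = (i.+2 + (n.+1 - i.+1))%N by lia.
  by apply: QpiXM; [exact: moment_sech_QpiX|apply: IH; lia].
exists (p / (2 ^+ n.+1 - 1)).
have r0 : ratr (2 ^+ n.+1 - 1) != 0 :> R by rewrite fmorph_eq0.
rewrite rmorphM fmorphV/=; apply: (mulfI r0); apply: (mulfI pi0).
transitivity S; last first.
  rewrite hp [pi ^+ n.+2]exprS; move: r0.
  by move: (ratr (_ - _)) (pi ^+ n.+1) (ratr p) => X Y Z X0; field.
have -> : ratr (2 ^+ n.+1 - 1) = 2 ^+ n.+1 - 1 :> R.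
  by rewrite rmorphB rmorphXn rmorph_nat rmorph1.
have -> : S = pi * 2 ^+ n.+1 * moment n.+1 sech2 - pi * moment n.+1 sech2.
  by rewrite h; ring.
by ring.
Qed.

(** * The ring Q[1/pi] and the hyperbolic algebra over it *)

Definition Qpi (r : R) := exists q : {poly rat}, r = (map_poly ratr q).[pi^-1].

Lemma Qpi_rat (q : rat) : Qpi (ratr q).
Proof. by exists q%:P; rewrite map_polyC hornerC. Qed.

Lemma Qpi_piV : Qpi pi^-1.
Proof. by exists 'X; rewrite map_polyX hornerX. Qed.

Lemma QpiD r1 r2 : Qpi r1 -> Qpi r2 -> Qpi (r1 + r2).
Proof. by move=> [p ->] [q ->]; exists (p + q); rewrite rmorphD hornerD. Qed.

Lemma QpiM r1 r2 : Qpi r1 -> Qpi r2 -> Qpi (r1 * r2).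
Proof. by move=> [p ->] [q ->]; exists (p * q); rewrite rmorphM hornerM. Qed.

Lemma Qpi_nat n : Qpi n%:R.
Proof. by rewrite -(rmorph_nat (@ratr R)); exact: Qpi_rat. Qed.

Lemma Qpi_natV n : Qpi n%:R^-1.
Proof. by rewrite -(rmorph_nat (@ratr R)) -fmorphV; exact: Qpi_rat. Qed.

Lemma QpiN r : Qpi r -> Qpi (- r).
Proof.
rewrite -mulN1r; apply: QpiM.
by rewrite -(rmorph1 (@ratr R)) -rmorphN; exact: Qpi_rat.
Qed.

Lemma QpiB r1 r2 : Qpi r1 -> Qpi r2 -> Qpi (r1 - r2).
Proof. by move=> h1 h2; apply/QpiD/QpiN. Qed.

Lemma Qpi_exp r n : Qpi r -> Qpi (r ^+ n).
Proof.
move=> qr; elim: n => [|n IH]; first exact: (Qpi_nat 1).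
by rewrite exprS; exact: QpiM.
Qed.

Lemma pi_neq0 : pi != 0 :> R. Proof. by rewrite gt_eqF// pi_gt0. Qed.

Lemma Qpi_QpiX k r : QpiX k r -> Qpi (r / pi ^+ k).
Proof.
move=> [q ->]; rewrite mulfK ?expf_neq0 ?pi_neq0//; exact: Qpi_rat.
Qed.

Definition mono b c d x : R := (x / pi) ^+ b * thn x ^+ c * sech x ^+ d.

(* The algebra S[x / pi, tanh x, sech x]: dividing [x] by [pi] makes all the
   moments of its elements against [sech] lie in Q[1/pi]. *)
Inductive hypalg (S : R -> Prop) : (R -> R) -> Prop :=
| hypalg0 : hypalg S (fun=> 0)
| hypalg_cons (q : R) (b c d : nat) (f : R -> R) : S q -> hypalg S f ->
    hypalg S (fun x => q * mono b c d x + f x).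

(** There are two instances: [Qpi] follows the arithmetic of the coefficients, and the set of all
    reals serves for analytic estimates. The inverse of pi is included because differentiating
    [x / pi] produces it. *)
Record subring_pred (S : R -> Prop) : Prop := SubringPred {
  subring_nat : forall n : nat, S n%:R;
  subring_opp : forall r, S r -> S (- r);
  subring_mul : forall r1 r2, S r1 -> S r2 -> S (r1 * r2);
  subring_piV : S pi^-1 }.

Lemma Qpi_subring : subring_pred Qpi.
Proof.
split; [exact: Qpi_nat|exact: QpiN|exact: QpiM|exact: Qpi_piV].
Qed.

Lemma real_subring : subring_pred (fun=> True).
Proof. by split. Qed.

Section hypalg_theory.
Variables (S : R -> Prop) (SS : subring_pred S).

Lemma eq_hypalg f g : f =1 g -> hypalg S f -> hypalg S g.
Proof. by move=> /funext ->. Qed.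

Lemma hypalg_mono q b c d : S q -> hypalg S (fun x => q * mono b c d x).
Proof.
by move=> Sq; apply: eq_hypalg (hypalg_cons b c d Sq (hypalg0 S)) => x; rewrite addr0.
Qed.

Lemma hypalgD f g : hypalg S f -> hypalg S g -> hypalg S (fun x => f x + g x).
Proof.
move=> fA gA; elim: fA => [|q b c d {}f Sq fA IH].
  by apply: eq_hypalg gA => x; rewrite add0r.
by apply: eq_hypalg (hypalg_cons b c d Sq IH) => x; rewrite addrA.
Qed.

Lemma hypalg_mulmono q b c d f : S q -> hypalg S f ->
  hypalg S (fun x => q * mono b c d x * f x).
Proof.
move=> Sq; elim=> [|q' b' c' d' {}f Sq' fA IH].
  by apply: eq_hypalg (hypalg0 S) => x; rewrite mulr0.
apply: eq_hypalg (hypalg_cons (b + b') (c + c') (d + d') (subring_mul SS Sq Sq') IH) => x.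
by rewrite /mono !exprD; ring.
Qed.

Lemma hypalgM f g : hypalg S f -> hypalg S g -> hypalg S (fun x => f x * g x).
Proof.
move=> fA gA; elim: fA => [|q b c d {}f Sq fA IH].
  by apply: eq_hypalg (hypalg0 S) => x; rewrite mul0r.
by apply: eq_hypalg (hypalgD (hypalg_mulmono b c d Sq gA) IH) => x; rewrite mulrDl.
Qed.

Lemma hypalg_cst q : S q -> hypalg S (fun=> q).
Proof.
by move=> Sq; apply: eq_hypalg (hypalg_mono 0 0 0 Sq) => x; rewrite /mono !expr0 !mulr1.
Qed.

Let S1 : S 1. Proof. exact: (subring_nat SS 1). Qed.

Lemma hypalg_thn : hypalg S thn.
Proof.
by apply: eq_hypalg (hypalg_mono 0 1 0 S1) => x; rewrite /mono !expr0 expr1; ring.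
Qed.

Lemma hypalg_sech : hypalg S sech.
Proof.
by apply: eq_hypalg (hypalg_mono 0 0 1 S1) => x; rewrite /mono !expr0 expr1; ring.
Qed.

Lemma hypalg_lin : hypalg S (fun x => x / pi).
Proof.
by apply: eq_hypalg (hypalg_mono 1 0 0 S1) => x; rewrite /mono !expr0 expr1; ring.
Qed.

Lemma hypalg_exp f n : hypalg S f -> hypalg S (fun x => f x ^+ n).
Proof.
move=> fA; elim: n => [|n IH].
  by apply: eq_hypalg (hypalg_cst S1) => x; rewrite expr0.
by apply: eq_hypalg (hypalgM fA IH) => x; rewrite exprS.
Qed.

Lemma hypalgZ q f : S q -> hypalg S f -> hypalg S (fun x => q * f x).
Proof. by move=> Sq; apply: hypalgM; exact: hypalg_cst. Qed.

Lemma hypalg_sum I (r : seq I) (h : I -> R -> R) : (forall i, hypalg S (h i)) ->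
  hypalg S (fun x => \sum_(i <- r) h i x).
Proof.
move=> hA; elim: r => [|i r IH].
  by apply: eq_hypalg (hypalg0 S) => x; rewrite big_nil.
by apply: eq_hypalg (hypalgD (hA i) IH) => x; rewrite big_cons.
Qed.

Lemma monoN b c d x : mono b c d (- x) = (-1) ^+ (b + c) * mono b c d x.
Proof.
rewrite /mono thnN sechN mulNr [(- (x / pi)) ^+ b]exprNn [(- thn x) ^+ c]exprNn exprD.
by ring.
Qed.

Lemma hypalg_opp f : hypalg S f -> hypalg S (fun x => f (- x)).
Proof.
elim=> [|q b c d {}f Sq fA IH]; first exact: hypalg0.
have Ss : S (q * (-1) ^+ (b + c)).
  apply: (subring_mul SS Sq); rewrite -signr_odd; case: (odd _).
    by rewrite expr1; apply: (subring_opp SS).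
  by rewrite expr0.
by apply: eq_hypalg (hypalg_cons b c d Ss IH) => x; rewrite monoN; ring.
Qed.

(** The truncated predecessors at [b = 0] and [c = 0] are harmless, as their coefficient is then
    0. *)
Definition dmono b c d x := b%:R / pi * mono b.-1 c d x +
  (c%:R * mono b c.-1 d.+2 x - d%:R * mono b c.+1 d x).

Lemma der1_mono b c d x : is_derive x 1 (mono b c d) (dmono b c d x).
Proof.
have hX n f a : is_derive x 1 f a ->
    is_derive x 1 (fun t => f t ^+ n) (n%:R * f x ^+ n.-1 * a).
  case: n => [|n]; last exact: der1X.
  move=> _; rewrite !mul0r; under eq_fun do rewrite expr0.
  exact: der1_cst.
have h1 : is_derive x 1 (fun t : R => t / pi) (1 / pi).
  apply: is_derive_eq (der1M (der1_id x) (der1_cst pi^-1 x)) _.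
  by rewrite mulr0 addr0.
have h := der1M (der1M (hX b _ _ h1) (hX c _ _ (der1_thn x))) (hX d _ _ (der1_sech x)).
apply: is_derive_eq h _.
rewrite /dmono /mono -[d.+2]addn2 exprD [thn x ^+ c.+1]exprS.
have -> : d%:R * sech x ^+ d.-1 * - (thn x * sech x) = - d%:R * thn x * sech x ^+ d.
  case: d => [|d]; first by rewrite oppr0 !mul0r.
  by rewrite [sech x ^+ d.+1]exprS /=; ring.
by ring.
Qed.

Lemma hypalg_der f : hypalg S f ->
  exists2 g, hypalg S g & forall x, is_derive x 1 f (g x).
Proof.
elim=> [|q b c d {}f Sq fA [g gA fg]].
  by exists (fun=> 0); [exact: hypalg0|move=> x; exact: der1_cst].
exists (fun x => q * dmono b c d x + g x).
  apply: hypalgD gA; apply: hypalgZ => //; rewrite /dmono.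
  apply: hypalgD.
    apply: hypalg_mono; apply: (subring_mul SS (subring_nat SS b)).
    exact: (subring_piV SS).
  apply: hypalgD; first exact/hypalg_mono/(subring_nat SS).
  apply: eq_hypalg (hypalg_mono b c.+1 d (subring_opp SS (subring_nat SS d))) => x.
  by rewrite mulNr.
by move=> x; apply: der1D => //; apply: der1Z; exact: der1_mono.
Qed.

Lemma hypalg_cont f : hypalg S f -> continuous f.
Proof. by move=> /hypalg_der[g _ fg] x; exact: der1_cont (fg x). Qed.

Lemma rapid_mono b c d : rapid (mono b c d.+1).
Proof.
have h : rapid (fun x => x ^+ b * sech x * (thn x ^+ c * sech x ^+ d * (pi ^- b))).
  apply: (@rapidM _ _ (pi ^- b)).
  - exact: rapidX rapid_sech.
  - apply: measurable_funM => //; apply: measurable_funM; apply: measurable_funX.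
      exact: measurable_thn.
    exact: measurable_sech.
  - move=> x; rewrite normrM [`|pi ^- b|]ger0_norm ?invr_ge0 ?exprn_ge0 ?pi_ge0//.
    rewrite ler_piMl ?invr_ge0 ?exprn_ge0 ?pi_ge0// normrM !normrX mulr_ile1//.
      by rewrite exprn_ile1// ltW// thn_lt1.
    by rewrite exprn_ile1// ger0_norm ?sech_le1// ltW// sech_gt0.
have -> : mono b c d.+1 = (fun x => x ^+ b * sech x * (thn x ^+ c * sech x ^+ d * (pi ^- b))).
  by apply/funext => x; rewrite /mono exprMn exprVn exprS; ring.
exact: h.
Qed.

Lemma hypalg_rapid f : hypalg S f -> rapid (fun x => sech x * f x).
Proof.
elim=> [|q b c d {}f Sq fA IH].
  by have := rapidZ 0 rapid_sech; congr rapid; apply/funext => x; rewrite mulr0 mul0r.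
have := rapidD (rapidZ q (rapid_mono b c d)) IH; congr rapid; apply/funext => x.
by rewrite /mono exprS; ring.
Qed.

End hypalg_theory.

(** * Integrals of the monomials *)

Definition Imono b c e := Iint (mono b c e) / pi.

Lemma Imono_parts b c e :
  b%:R / pi * Imono b.-1 c e.+1 + c%:R * Imono b c.-1 e.+3 - e.+1%:R * Imono b c.+1 e.+1 = 0.
Proof.
have a b' c' e' := rapid_qdecay (rapid_mono b' c' e').
have -> : b%:R / pi * Imono b.-1 c e.+1 + c%:R * Imono b c.-1 e.+3 - e.+1%:R * Imono b c.+1 e.+1 =
    Iint (dmono b c e.+1) / pi.
  rewrite /dmono IintD; [|exact: qdecayZ|].
    rewrite IintB ?IintZ//; [|exact: qdecayZ|exact: qdecayZ].
    by rewrite /Imono; ring.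
  apply: qdecayD; first exact: qdecayZ.
  under eq_fun do rewrite -mulNr; exact: qdecayZ.
suff -> : Iint (dmono b c e.+1) = 0 by rewrite mul0r.
apply: (@Iint_derive0 _ (mono b c e.+1)).
- apply: qdecayD; first exact: qdecayZ.
  apply: qdecayD; first exact: qdecayZ.
  by under eq_fun do rewrite -mulNr; exact: qdecayZ.
- exact: der1_cont (der1_mono b c e.+1 0).
- by move=> x _; exact: der1_mono.
- move=> x _; have cm b' c' e' : {for x, continuous (mono b' c' e')}.
    exact: der1_cont (der1_mono b' c' e' x).
  apply: cvgD; first by apply: cvgM; [exact: cvg_cst|exact: cm].
  by apply: cvgB; (apply: cvgM; [exact: cvg_cst|exact: cm]).
- exact: (a b c e).2.
Qed.

Lemma Imono_thn2 b c e : Imono b c.+2 e.+1 = Imono b c e.+1 - Imono b c e.+3.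
Proof.
have a b' c' e' := rapid_qdecay (rapid_mono b' c' e').
rewrite /Imono -mulrBl -IintB//; congr (_ / _); apply: eq_Iint => x.
rewrite /mono -[e.+3]addn2 -[c.+2]addn2 2!exprD sech2E; ring.
Qed.

(** The exponent of tanh drops by 2 through [thn ^ 2 = 1 - sech ^ 2], and from 1 to 0 by parts.
    Integration by parts with one factor tanh lowers the exponent of sech by 2. There remain the
    moments of [sech] and [sech2]. *)
Lemma Imono_Qpi b c e : Qpi (Imono b c e.+1).
Proof.
have W01 b' : Qpi (Imono b' 0 1).
  rewrite /Imono; have -> : Iint (mono b' 0 1) = pi ^- b' * moment b' sech.
    rewrite -IintZ; last exact: rapid_sech.2.
    by apply: eq_Iint => x; rewrite /mono expr0 expr1 exprMn exprVn; ring.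
  have := Qpi_QpiX (moment_sech_QpiX b'); rewrite exprS.
  by congr Qpi; rewrite invfM; ring.
have W02 b' : Qpi (Imono b' 0 2).
  rewrite /Imono; have -> : Iint (mono b' 0 2) = pi ^- b' * moment b' sech2.
    rewrite -IintZ; last exact: rapid_sech2.2.
    by apply: eq_Iint => x; rewrite /mono expr0 exprMn exprVn /sech2; ring.
  apply: QpiM Qpi_piV.
  by rewrite mulrC; exact: Qpi_QpiX (moment_sech2_QpiX b').
have W1 b' e' : (forall b'', Qpi (Imono b'' 0 e'.+1)) -> Qpi (Imono b' 1 e'.+1).
  move=> h; have /eqP := Imono_parts b' 0 e'.
  rewrite mul0r addr0 subr_eq0 => /eqP E.
  have -> : Imono b' 1 e'.+1 = e'.+1%:R^-1 * (b'%:R / pi * Imono b'.-1 0 e'.+1).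
    by rewrite E mulKf// pnatr_eq0.
  by do !apply: QpiM => //; [exact: Qpi_natV|exact: Qpi_nat|exact: Qpi_piV].
have W0 e' : (forall b', Qpi (Imono b' 0 e'.+1)) /\ (forall b', Qpi (Imono b' 0 e'.+2)).
  elim: e' => [|e' [IH1 IH2]]; first by split.
  split=> // b'.
  have E := Imono_parts b' 1 e'; rewrite mul1r /= Imono_thn2 in E.
  have -> : Imono b' 0 e'.+3 = e'.+2%:R^-1 * (e'.+1%:R * Imono b' 0 e'.+1 - b'%:R / pi * Imono b'.-1 1 e'.+1).
    apply: (mulfI (_ : e'.+2%:R != 0 :> R)); first by rewrite pnatr_eq0.
    rewrite mulVKf ?pnatr_eq0//.
    have -> : e'.+2%:R = e'.+1%:R + 1 :> R by rewrite natr1.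
    by apply/eqP; rewrite -subr_eq0 -E; apply/eqP; ring.
  apply: QpiM; first exact: Qpi_natV.
  apply: QpiB; first by apply: QpiM => //; exact: Qpi_nat.
  apply: QpiM; last exact: W1.
  by apply: QpiM; [exact: Qpi_nat|exact: Qpi_piV].
suff : Qpi (Imono b c e.+1) /\ Qpi (Imono b c.+1 e.+1) by case.
elim: c e => [|c IH] e.
  by split; [exact: (W0 e).1|exact/W1/(W0 e).1].
split; first exact: (IH e).2.
by rewrite Imono_thn2; apply: QpiB; [exact: (IH e).1|exact: (IH e.+2).1].
Qed.

(** * Integrals against the kernel 1 / (1 - tanh x tanh a) *)

Lemma kern_gt0 x a : 0 < 1 - thn x * thn a.
Proof.
rewrite subr_gt0 (le_lt_trans (ler_norm _))// normrM.
by rewrite -[ltRHS]mulr1 ltr_pM// thn_lt1.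
Qed.

Lemma kern_le x a : `|(1 - thn x * thn a)^-1| <= (1 - `|thn a|)^-1.
Proof.
have k0 := kern_gt0 x a; rewrite gtr0_norm ?invr_gt0//.
rewrite lef_pV2 ?posrE// ?subr_gt0 ?thn_lt1//.
rewrite lerD2l lerN2 (le_trans (ler_norm _))// normrM.
by rewrite ler_piMl// ltW// thn_lt1.
Qed.

Lemma measurable_kern a : measurable_fun setT (fun x => (1 - thn x * thn a)^-1).
Proof.
apply: continuous_measurable_fun => x; apply: cvgV.
  by rewrite gt_eqF// kern_gt0.
apply: cvgB; first exact: cvg_cst.
by apply: cvgM; [exact: continuous_thn|exact: cvg_cst].
Qed.

Lemma qdecay_kern f a : qdecay f -> qdecay (fun x => f x / (1 - thn x * thn a)).
Proof. by move=> af; apply: (qdecayM af (measurable_kern a)) => x; exact: kern_le. Qed.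

(** The even kernel [1 / (1 - tanh(x)^2 tanh(a)^2)] is half the sum of this one at [a] and at [- a].
    This one reduces to a translate, as [1 - tanh x tanh a = ch (x - a) * sech x * sech a]. *)
Definition Kint f a := Iint (fun x => f x / (1 - thn x * thn a)) / pi.

(* [g] lies in the algebra up to a pole at 0, where its value is irrelevant. *)
Definition tame g := exists N h, hypalg Qpi h /\ forall a, thn a ^+ N * g a = h a.

(** From [u / (1 - u) = 1 / (1 - u) - 1] with [u = tanh x tanh a]. Solving for the integral on the
    left divides by [thn a], one of the sources of the poles at 0. *)
Lemma Kint_thn b c e a : thn a * Kint (mono b c.+1 e.+1) a =
  Kint (mono b c e.+1) a - Imono b c e.+1.
Proof.
have am c' := rapid_qdecay (rapid_mono b c' e).
rewrite /Kint /Imono mulrA -mulrBl -IintZ; last exact: qdecay_kern.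
rewrite -IintB//; last exact: qdecay_kern.
congr (_ / _); apply: eq_Iint => x; have := gt_eqF (kern_gt0 x a).
rewrite /mono [thn x ^+ c.+1]exprS => k0; field.
by rewrite k0.
Qed.

(** From [tanh(a)^2 sech(x)^2 = - sech(a)^2 + (1 - u) (1 + u)] with [u = tanh x tanh a]. *)
Lemma Kint_sech b e a : thn a ^+ 2 * Kint (mono b 0 e.+3) a =
  - sech a ^+ 2 * Kint (mono b 0 e.+1) a + (Imono b 0 e.+1 + thn a * Imono b 1 e.+1).
Proof.
have am c' e' := rapid_qdecay (rapid_mono b c' e').
have ak := fun c' e' => qdecay_kern a (am c' e').
rewrite /Kint /Imono !mulrA -!mulrDl -!IintZ//.
rewrite -IintD//; last exact: qdecayZ.
rewrite -IintD; [|exact: qdecayZ|by apply: qdecayD => //; exact: qdecayZ].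
congr (_ / _); apply: eq_Iint => x; have := gt_eqF (kern_gt0 x a).
rewrite /mono -[e.+3]addn2 exprD !sech2E expr0 expr1 => k0; field.
by rewrite k0.
Qed.

(** The kernel times [sech x * sech a] is [sech (x - a)], whose moments are polynomials in [a]; the
    scaling of [a] by pi absorbs the powers of pi. *)
Lemma Kint_sech1 b : hypalg Qpi (fun a => sech a * Kint (mono b 0 1) a).
Proof.
have E a : sech a * Kint (mono b 0 1) a =
    \sum_(i < b.+1) 'C(b, i)%:R * (a / pi) ^+ i * (moment (b - i) sech / pi ^+ (b - i).+1).
  rewrite /Kint mulrA -IintZ; last by apply: qdecay_kern; exact: rapid_qdecay (rapid_mono _ _ _).
  have -> : Iint (fun x => sech a * (mono b 0 1 x / (1 - thn x * thn a))) =
      pi ^- b * moment b (fun x => sech (x + - a)).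
    rewrite -IintZ; last exact: (rapid_shift (- a) rapid_sech).2.
    apply: eq_Iint => x; rewrite /mono exprMn exprVn expr0 expr1 mulr1.
    have h : 1 - thn x * thn a = ch (x - a) * sech x * sech a.
      by rewrite /thn /sech chD chN shN; field; rewrite !ch_neq0.
    rewrite h /sech; field; rewrite ?ch_neq0//=.
    by rewrite ?invr_eq0 ?ch_neq0 ?expf_neq0 ?pi_neq0.
  rewrite moment_shift; last exact: rapid_sech.
  rewrite mulr_sumr mulr_suml; apply: eq_bigr => i _.
  have ib : (i <= b)%N by rewrite -ltnS.
  rewrite opprK exprMn exprVn -[X in pi ^- X](subnK ib) exprD exprS.
  by rewrite !invfM; ring.
apply: eq_hypalg (fun a => esym (E a)) _.
apply: hypalg_sum => i.
have h := Qpi_QpiX (moment_sech_QpiX (b - i)).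
have := hypalgM Qpi_subring (hypalg_cst (QpiM (Qpi_nat 'C(b, i)) h))
  (hypalg_exp Qpi_subring i (hypalg_lin Qpi_subring)).
by apply: eq_hypalg => a; ring.
Qed.

(** The kernel times [thn a * sech x ^ 2] is [thn x - thn (x - a)]. *)
Lemma Kint_sech2 b : hypalg Qpi (fun a => thn a * Kint (mono b 0 2) a).
Proof.
have E a : thn a * Kint (mono b 0 2) a = b.+1%:R^-1 *
    (\sum_(i < b.+2) 'C(b.+1, i)%:R * (a / pi) ^+ i *
       (moment (b.+1 - i) sech2 / pi ^+ (b.+1 - i)) - moment b.+1 sech2 / pi ^+ b.+1).
  rewrite /Kint mulrA -IintZ; last by apply: qdecay_kern; exact: rapid_qdecay (rapid_mono _ _ _).
  have -> : Iint (fun x => thn a * (mono b 0 2 x / (1 - thn x * thn a))) =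
      pi ^- b * moment b (fun x => thn x - thn (x + - a)).
    rewrite -IintZ; last exact: (rapid_thn_diff (- a)).2.
    apply: eq_Iint => x; rewrite /mono exprMn exprVn expr0 mulr1 thn_diff.
    have h : 1 - thn x * thn a = ch (x - a) * sech x * sech a.
      by rewrite /thn /sech chD chN shN; field; rewrite !ch_neq0.
    rewrite h /sech shN /thn; field; rewrite ?ch_neq0//=.
    by rewrite ?invr_eq0 ?ch_neq0 ?expf_neq0 ?pi_neq0.
  have /(canRL (mulKf (_ : b.+1%:R != 0))) -> := moment_thn_diff b (- a); last by rewrite pnatr_eq0.
  rewrite moment_shift; last exact: rapid_sech2.
  have e : pi ^- b / pi = pi ^- b.+1 :> R by rewrite exprSr invfM mulrC.
  rewrite [LHS](_ : _ = b.+1%:R^-1 * ((\sum_(i < b.+2)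
    'C(b.+1, i)%:R * (- - a) ^+ i * moment (b.+1 - i) sech2 - moment b.+1 sech2) * (pi ^- b / pi))); last by ring.
  rewrite e; congr (_ * _); rewrite mulrBl; congr (_ - _).
  rewrite mulr_suml; apply: eq_bigr => i _.
  have ib : (i <= b.+1)%N by rewrite -ltnS.
  rewrite opprK exprMn exprVn -[X in pi ^- X](subnK ib) exprD invfM; ring.
apply: eq_hypalg (fun a => esym (E a)) _.
apply: (hypalgZ Qpi_subring); first exact: Qpi_natV.
apply: hypalgD.
  apply: hypalg_sum => i.
  have h := Qpi_QpiX (moment_sech2_QpiX (b.+1 - i)).
  have := hypalgM Qpi_subring (hypalg_cst (QpiM (Qpi_nat 'C(b.+1, i)) h))
    (hypalg_exp Qpi_subring i (hypalg_lin Qpi_subring)).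
  by apply: eq_hypalg => a; ring.
apply: hypalg_cst; apply: QpiN.
exact: Qpi_QpiX (moment_sech2_QpiX b.+1).
Qed.

(** The exponent of sech starts at 2: for exponent 1, [Kint_sech1] leaves [ch a] times a polynomial,
    which is not a polynomial in sech. At exponent 3 the factor [sech a ^ 2] in [Kint_sech] absorbs
    this [ch a]; larger exponents follow by steps of 2. *)
Lemma tame_Kint_mono b c e : tame (Kint (mono b c e.+2)).
Proof.
have IW c' e' : hypalg Qpi (fun=> Imono b c' e'.+1).
  by apply: hypalg_cst; exact: Imono_Qpi.
have It := hypalg_thn Qpi_subring.
have Is2 := hypalg_exp Qpi_subring 2 (hypalg_sech Qpi_subring).
have Ins2 : hypalg Qpi (fun a => - sech a ^+ 2).
  have h := hypalgZ Qpi_subring (QpiN (Qpi_nat 1)) Is2.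
  by apply: eq_hypalg h => a; rewrite mulN1r.
have h0 e' : tame (Kint (mono b 0 e'.+2)) /\ tame (Kint (mono b 0 e'.+3)).
  elim: e' => [|e' [IH1 IH2]].
    split.
      by exists 1%N, (fun a => thn a * Kint (mono b 0 2) a); split=> //; exact: Kint_sech2.
    exists 2%N, (fun a => - sech a * (sech a * Kint (mono b 0 1) a) +
      (Imono b 0 1 + thn a * Imono b 1 1)); split=> [|a]; last by rewrite Kint_sech; ring.
    apply: hypalgD.
      have h := hypalgZ Qpi_subring (QpiN (Qpi_nat 1))
        (hypalgM Qpi_subring (hypalg_sech Qpi_subring) (Kint_sech1 b)).
      by apply: eq_hypalg h => a; ring.
    by apply: hypalgD => //; exact: (hypalgM Qpi_subring).
  split=> //; have [N [h [hA hE]]] := IH1.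
  exists (N + 2)%N, (fun a => - sech a ^+ 2 * h a + thn a ^+ N * (Imono b 0 e'.+2 + thn a * Imono b 1 e'.+2)).
  split=> [|a]; last by rewrite exprD -mulrA Kint_sech -hE; ring.
  apply: hypalgD; first exact: (hypalgM Qpi_subring).
  apply: (hypalgM Qpi_subring); first exact: (hypalg_exp Qpi_subring).
  by apply: hypalgD => //; exact: (hypalgM Qpi_subring).
elim: c => [|c [N [h [hA hE]]]]; first by have [] := h0 e.
exists N.+1, (fun a => h a - thn a ^+ N * Imono b c e.+2); split.
  apply: hypalgD => //.
  have k := hypalgZ Qpi_subring (QpiN (Qpi_nat 1))
    (hypalgM Qpi_subring (hypalg_exp Qpi_subring N It) (IW c e.+1)).
  by apply: eq_hypalg k => a; ring.
by move=> a; rewrite exprSr -mulrA Kint_thn -hE; ring.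
Qed.

Lemma tameD f g : tame f -> tame g -> tame (fun x => f x + g x).
Proof.
move=> [N [h [hA hE]]] [M [k [kA kE]]].
exists (N + M)%N, (fun x => thn x ^+ M * h x + thn x ^+ N * k x); split.
  have It n := hypalg_exp Qpi_subring n (hypalg_thn Qpi_subring).
  by apply: hypalgD; exact: (hypalgM Qpi_subring).
by move=> x; rewrite -hE -kE exprD; ring.
Qed.

Lemma tameZ q f : Qpi q -> tame f -> tame (fun x => q * f x).
Proof.
move=> qQ [N [h [hA hE]]]; exists N, (fun x => q * h x); split.
  exact: (hypalgZ Qpi_subring).
by move=> x; rewrite mulrCA hE.
Qed.

Lemma tameM f g : tame f -> tame g -> tame (fun x => f x * g x).
Proof.
move=> [N [h [hA hE]]] [M [k [kA kE]]].
exists (N + M)%N, (fun x => h x * k x); split; first exact: (hypalgM Qpi_subring).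
by move=> x; rewrite -hE -kE exprD; ring.
Qed.

Lemma tame_hypalg f : hypalg Qpi f -> tame f.
Proof. by move=> fA; exists 0%N, f; split=> // x; rewrite expr0 mul1r. Qed.

Lemma eq_tame f g : f =1 g -> tame f -> tame g.
Proof. by move=> /funext ->. Qed.

Lemma tame_opp f : tame f -> tame (fun x => f (- x)).
Proof.
move=> [N [h [hA hE]]]; exists N, (fun x => (-1) ^+ N * h (- x)); split.
  apply: (hypalgZ Qpi_subring); last exact: (hypalg_opp Qpi_subring).
  by apply: Qpi_exp; exact: (QpiN (Qpi_nat 1)).
by move=> x; rewrite -hE thnN [(- thn x) ^+ N]exprNn mulrA mulrA -exprMn mulrNN mulr1 expr1n mul1r.
Qed.

Lemma tame_Kint f : hypalg Qpi f -> tame (Kint (fun x => sech x ^+ 3 * f x)).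
Proof.
elim=> [|q b c d {}f Sq fA IH].
  apply: eq_tame (tame_hypalg (hypalg0 Qpi)) => a; rewrite /Kint.
  under [in RHS]eq_Iint do rewrite mulr0 mul0r.
  by rewrite Iint0 mul0r.
apply: eq_tame (tameD (tameZ Sq (tame_Kint_mono b c d.+1)) IH) => a.
have a1 := qdecay_kern a (rapid_qdecay (rapid_mono b c d.+2)).
have a2 : qdecay (fun x => sech x ^+ 3 * f x).
  have := rapidM (hypalg_rapid fA) (measurable_funX 2 measurable_sech) (C := 1).
  move=> h; have {}h := h (fun x => ltac:(by rewrite normrX exprn_ile1// ger0_norm ?sech_le1// ltW// sech_gt0)).
  by apply: eq_qdecay (rapid_qdecay h) => x /=; ring.
rewrite /Kint mulrA -mulrDl -IintZ// -IintD; [|exact: qdecayZ|exact: qdecay_kern].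
congr (_ / _); apply: eq_Iint => x; rewrite /mono -[d.+3]addn3 exprD; ring.
Qed.
Local Notation AR := (hypalg (fun _ : R => True)).

Lemma hypalg_real S f : hypalg S f -> AR f.
Proof. by elim=> [|q b c d {}f _ _ IH]; [exact: hypalg0|exact: hypalg_cons]. Qed.

(** * Poles at the origin *)

Definition vanish (c : nat) f := exists C, forall x, `|x| <= 1 -> `|f x| <= C * `|x| ^+ c.

(** The derivatives of order below [c] vanish at 0. On the algebra this is equivalent to [vanish c]:
    [flat] passes to derivatives, [vanish] to products. *)
Fixpoint flat (c : nat) f : Prop :=
  if c is c'.+1 then f 0 = 0 /\ exists g,
    [/\ AR g, forall x, is_derive x 1 f (g x) & flat c' g] else True.

Lemma div_pi_le1 x : `|x| <= 1 -> `|x / pi| <= `|x|.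
Proof.
move=> x1; rewrite normrM [`|pi^-1|]ger0_norm ?invr_ge0 ?pi_ge0//.
by rewrite ler_piMr// invf_le1 ?pi_gt0// (le_trans _ (pi_ge2 R))// ler1n.
Qed.

Lemma hypalg_vanish0 f : AR f -> vanish 0 f.
Proof.
elim=> [|q b c d {}f _ _ [C IH]].
  by exists 0 => x _; rewrite normr0 mul0r.
exists (`|q| + C) => x x1; rewrite expr0 mulr1.
have := IH x x1; rewrite expr0 mulr1 => h.
rewrite (le_trans (ler_normD _ _))// lerD// normrM ler_piMr//.
rewrite /mono !normrM !normrX !mulr_ile1 ?mulr_ge0 ?exprn_ge0//.
- by rewrite exprn_ile1// (le_trans (div_pi_le1 x1)).
- by rewrite exprn_ile1// ltW// thn_lt1.
- by rewrite exprn_ile1// gtr0_norm ?sech_gt0// sech_le1.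
Qed.

Lemma vanish_ge0 c f : vanish c f ->
  exists2 C, 0 <= C & forall x, `|x| <= 1 -> `|f x| <= C * `|x| ^+ c.
Proof.
move=> [C h]; exists `|C| => // x x1; apply: le_trans (h x x1) _.
by rewrite ler_wpM2r ?exprn_ge0// ler_norm.
Qed.

Lemma vanishW c f : vanish c.+1 f -> vanish c f.
Proof.
move=> /vanish_ge0[C C0 h]; exists C => x x1; apply: le_trans (h x x1) _.
by rewrite exprS ler_wpM2l// ler_piMl// exprn_ge0.
Qed.

Lemma vanishD c f g : vanish c f -> vanish c g -> vanish c (fun x => f x + g x).
Proof.
move=> [C hC] [D hD]; exists (C + D) => x x1.
by rewrite mulrDl (le_trans (ler_normD _ _))// lerD ?hC ?hD.
Qed.

Lemma vanishM c d f g : vanish c f -> vanish d g ->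
  vanish (c + d) (fun x => f x * g x).
Proof.
move=> /vanish_ge0[C C0 hC] /vanish_ge0[D D0 hD]; exists (C * D) => x x1.
by rewrite normrM exprD mulrACA ler_pM ?hC ?hD.
Qed.

Lemma vanish_thn : vanish 1 thn.
Proof.
have /vanish_ge0[C C0 h] := hypalg_vanish0 (hypalg_exp real_subring 2 (hypalg_sech real_subring)).
exists C => x x1; rewrite expr1.
have [x0|x0|->] := ltgtP x 0; last by rewrite thn0 normr0 mulr0.
- have [z] := @MVT _ thn (fun x => sech x ^+ 2) x 0 x0 (fun x _ => der1_thn x)
    (continuous_subspaceT continuous_thn).
  rewrite in_itv/= => /andP[xz z0]; rewrite thn0 !sub0r => E.
  rewrite -normrN E normrM normrN ler_wpM2r//.
  have := h z; rewrite expr0 mulr1; apply.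
  by rewrite (le_trans _ x1)// !ltr0_norm// lerN2 ltW.
- have [z] := @MVT _ thn (fun x => sech x ^+ 2) 0 x x0 (fun x _ => der1_thn x)
    (continuous_subspaceT continuous_thn).
  rewrite in_itv/= => /andP[z0 zx]; rewrite thn0 !subr0 => ->.
  rewrite normrM ler_wpM2r//.
  have := h z; rewrite expr0 mulr1; apply.
  by rewrite (le_trans _ x1)// !gtr0_norm// ltW.
Qed.

Lemma flat_vanish c f : AR f -> flat c f -> vanish c f.
Proof.
elim: c f => [|c IH] f fA; first by move=> _; exact: hypalg_vanish0.
move=> [f0 [g [gA fg gf]]].
have /vanish_ge0[C C0 h] := IH g gA gf.
have cf : continuous f := hypalg_cont real_subring fA.
have mono_le (z x : R) : `|z| <= `|x| -> `|x| <= 1 -> `|g z| <= C * `|x| ^+ c.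
  move=> zx x1; apply: le_trans (h z (le_trans zx x1)) _.
  by rewrite ler_wpM2l// lerXn2r ?nnegrE.
exists C => x x1; rewrite exprSr mulrA.
have [x0|x0|->] := ltgtP x 0; last by rewrite f0 normr0 mulr0.
- have [z] := @MVT _ f g x 0 x0 (fun x _ => fg x) (continuous_subspaceT cf).
  rewrite in_itv/= => /andP[xz z0]; rewrite f0 !sub0r => E.
  rewrite -normrN E normrM normrN ler_wpM2r// mono_le//.
  by rewrite !ltr0_norm// lerN2 ltW.
- have [z] := @MVT _ f g 0 x x0 (fun x _ => fg x) (continuous_subspaceT cf).
  rewrite in_itv/= => /andP[z0 zx]; rewrite f0 !subr0 => ->.
  rewrite normrM ler_wpM2r// mono_le//.
  by rewrite !gtr0_norm// ltW.
Qed.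

Lemma AR_X k n : AR (fun x => k * x ^+ n).
Proof.
have := @hypalg_mono (fun=> True) (k * pi ^+ n) n 0 0 I; apply: eq_hypalg => x.
by rewrite /mono !expr0 exprMn exprVn; field; rewrite expf_neq0// pi_neq0.
Qed.

Lemma AR_subX f k n : AR f -> AR (fun x => f x - k * x ^+ n).
Proof.
move=> fA; have := hypalgD fA (AR_X (- k) n); apply: eq_hypalg => x.
by rewrite mulNr.
Qed.

(** [k * x ^ c] is the Taylor term of order [c] at 0, obtained by integrating that of the
    derivative. *)
Lemma flat_subX c f : AR f -> flat c f -> exists k, flat c.+1 (fun x => f x - k * x ^+ c).
Proof.
elim: c f => [|c IH] f fA.
  move=> _; exists (f 0); split; first by rewrite expr0 mulr1 subrr.
  have [g gA dg] := hypalg_der real_subring (AR_subX (f 0) 0 fA).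
  by exists g.
move=> [f0 [g [gA fg gf]]]; have [k hk] := IH g gA gf.
exists (k / c.+1%:R); split; first by rewrite f0 exprS mul0r mulr0 subr0.
exists (fun x => g x - k * x ^+ c); split; [exact: AR_subX| |exact: hk].
move=> x; apply: is_derive_eq (der1B (fg x) (der1Z (k / c.+1%:R) (der1X c (der1_id x)))) _.
by rewrite mulr1 mulrA divfK// pnatr_eq0.
Qed.

(** By induction only the Taylor coefficient [k] of order [c] is in question. If it were nonzero,
    [k * x ^ c] would be bounded by a multiple of [x ^ (c + 1)] near 0. *)
Lemma vanish_flat c f : AR f -> vanish c f -> flat c f.
Proof.
move=> fA; elim: c => [//|c IH] vf.
have [k hk] := flat_subX fA (IH (vanishW vf)).
have [C C0 hC] := vanish_ge0 (flat_vanish (AR_subX k c fA) hk).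
have [D D0 hD] := vanish_ge0 vf.
suff k0 : k = 0.
  by move: hk; rewrite k0; congr flat; apply/funext => x; rewrite mul0r subr0.
have key x : 0 < x -> x <= 1 -> `|k| <= (C + D) * x.
  move=> x0 x1; have x1' : `|x| <= 1 by rewrite gtr0_norm.
  have := hC x x1'; have := hD x x1'; rewrite (gtr0_norm x0) => h1 h2.
  have h3 : `|k * x ^+ c| <= `|f x| + `|f x - k * x ^+ c|.
    have {1}-> : k * x ^+ c = f x - (f x - k * x ^+ c) by ring.
    exact: ler_normB.
  rewrite -(ler_pM2r (exprn_gt0 c x0)) -[X in _ * X <= _](gtr0_norm (exprn_gt0 c x0)).
  rewrite -normrM (le_trans h3)// (le_trans (lerD h1 h2))//.
  by rewrite exprS -mulrDl addrC mulrA.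
apply/eqP; rewrite -normr_eq0 eq_le normr_ge0 andbT leNgt; apply/negP => k0.
have E0 : 0 < 1 + `|k| + (C + D) by rewrite ltr_wpDr ?addr_ge0// addr_gt0.
(* This point [x] is at most 1 and satisfies [(C + D) * x < |k|], against [key]. *)
have := key (`|k| / (1 + `|k| + (C + D))).
rewrite divr_gt0// => /(_ isT); rewrite ler_pdivrMr// mul1r.
have -> : `|k| <= 1 + `|k| + (C + D) by rewrite -addrA ler_wpDl// lerDl addr_ge0.
move=> /(_ isT); rewrite mulrA ler_pdivlMr//.
have := addr_ge0 C0 D0; nra.
Qed.

Lemma vanish_der c f g : AR f -> vanish c.+1 f ->
  (forall x, is_derive x 1 f (g x)) -> vanish c g.
Proof.
move=> fA vf fg; have [_ [h [hA fh hf]]] := vanish_flat fA vf.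
have -> : g = h.
  by apply/funext => x; rewrite -[LHS](@derive_val _ _ _ _ _ _ _ (fg x)) (@derive_val _ _ _ _ _ _ _ (fh x)).
exact: flat_vanish.
Qed.

Lemma norm_thn_ge x : x != 0 -> `|x| <= 1 -> `|x| <= 2 * `|thn x|.
Proof.
move=> x0 x1; apply: le_trans (ler_norm_thn x) _; rewrite ler_wpM2r//.
by rewrite -[2]/(1 + 1) lerD2l.
Qed.

Lemma norm_thn_ge1 x : 1 <= `|x| -> 1 <= 2 * `|thn x|.
Proof.
move=> x1; have := ler_norm_thn x; have := normr_ge0 (thn x).
rewrite -(@ler_pM2l _ `|x|) ?(lt_le_trans ltr01)// mulr1 => h1 h2.
apply: le_trans h2 _; rewrite mulrCA mulrA ler_wpM2r// mulr_natl.
by rewrite mulr2n lerD2r.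
Qed.

(** For [|x| <= 1] the order of vanishing compensates the pole, as [|x| <= 2 |tanh x|]; elsewhere
    [1 <= 2 |tanh x|]. *)
Lemma pole_bound c f : vanish c f -> exists2 C, 0 <= C & forall x, x != 0 ->
  `|f x / thn x ^+ c| <= C + 2 ^+ c * `|f x|.
Proof.
move=> /vanish_ge0[C C0 h]; exists (C * 2 ^+ c); first by rewrite mulr_ge0 ?exprn_ge0.
move=> x x0; have t0 : 0 < `|thn x| ^+ c by rewrite exprn_gt0// normr_gt0 thn_neq0.
rewrite normrM normfV normrX ler_pdivrMr//.
have [x1|/ltW x1] := leP `|x| 1.
  apply: le_trans (h x x1) _; rewrite mulrDl ler_wpDr ?mulr_ge0 ?exprn_ge0//.
  rewrite -mulrA ler_wpM2l// -exprMn lerXn2r ?nnegrE ?mulr_ge0//.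
  exact: norm_thn_ge.
rewrite mulrDl ler_wpDl ?mulr_ge0 ?exprn_ge0// mulrAC.
rewrite -[X in X <= _]mul1r ler_wpM2r// -exprMn.
by rewrite exprn_ege1// norm_thn_ge1.
Qed.

Lemma pole_measurable c f : AR f -> measurable_fun setT (fun x => f x / thn x ^+ c).
Proof.
move=> fA; apply: measurable_off0 => x x0.
apply: cvgM; first exact: (hypalg_cont real_subring fA).
apply: cvgV; first by rewrite expf_neq0// thn_neq0.
have := @hypalg_cont _ real_subring _ (hypalg_exp real_subring c (hypalg_thn real_subring)) x.
exact.
Qed.

Lemma pole_rapid c f : AR f -> vanish c f ->
  rapid (fun x => sech x * (f x / thn x ^+ c)).
Proof.
move=> fA vf; have [C C0 h] := pole_bound vf.
have rn : rapid (fun x => `|sech x * f x|).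
  split; first exact: measurableT_comp (hypalg_rapid fA).1.
  move=> n; apply: qdecay_le ((hypalg_rapid fA).2 n) _.
    apply: measurable_funM; first exact: measurable_X.
    exact: measurableT_comp (hypalg_rapid fA).1.
  by move=> x; rewrite !normrM !normr_id.
(* The constant includes the value of the quotient at 0, which [pole_bound] leaves out. *)
apply: rapid_le (rapidD (rapidZ (C + `|f 0 / thn 0 ^+ c|) rapid_sech) (rapidZ (2 ^+ c) rn)) _.
  by apply: measurable_funM; [exact: measurable_sech|exact: pole_measurable].
move=> x; have s0 := sech_gt0 x.
rewrite [leRHS]ger0_norm; last first.
  by rewrite addr_ge0 ?mulr_ge0 ?addr_ge0 ?exprn_ge0 ?normr_ge0// ltW.
rewrite [`|sech x * (f x / _)|]normrM [`|sech x * f x|]normrM (gtr0_norm s0).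
rewrite [2 ^+ c * _]mulrCA [_ * sech x]mulrC -mulrDr.
rewrite ler_pM2l//; have [->|x0] := eqVneq x 0.
  by rewrite addrAC lerDr addr_ge0// mulr_ge0 ?exprn_ge0.
apply: le_trans (h x x0) _; rewrite lerD2r lerDl//.
Qed.

Lemma hypalg_Qpi f : hypalg Qpi f -> Qpi (Iint (fun x => sech x * f x) / pi).
Proof.
elim=> [|q b c d {}f Sq fA IH].
  under eq_Iint do rewrite mulr0.
  by rewrite Iint0 mul0r; exact: (Qpi_nat 0).
have -> : (fun x => sech x * (q * mono b c d x + f x)) =
    (fun x => q * mono b c d.+1 x + sech x * f x).
  by apply/funext => x; rewrite /mono exprS; ring.
have am := rapid_qdecay (rapid_mono b c d).
rewrite IintD; [|exact: qdecayZ|exact: rapid_qdecay (hypalg_rapid fA)].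
rewrite IintZ// mulrDl -mulrA; apply: QpiD => //.
by apply: QpiM => //; exact: Imono_Qpi.
Qed.

Definition Ipole b e := Iint (fun x => (x / pi) ^+ b * sech x ^+ e / thn x) / pi.

(** As [b] is odd, a factor [x] cancels the pole. Exponent 1 of sech gives a moment of [xcsch]; so
    does exponent 2 after doubling the variable, since [sech^2 / tanh = 2 / sinh (2 x)]; higher
    exponents follow from [sech^2 = 1 - tanh^2]. *)
Lemma Ipole_Qpi b e : odd b -> Qpi (Ipole b e.+1).
Proof.
case: b => // b /= eb.
have H1 : Qpi (Ipole b.+1 1).
  rewrite /Ipole; have -> : Iint (fun x => (x / pi) ^+ b.+1 * sech x ^+ 1 / thn x) =
      pi ^- b.+1 * moment b xcsch.
    rewrite -IintZ; last exact: rapid_xcsch.2.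
    apply: eq_Iint => x; rewrite exprMn exprVn expr1 /xcsch /thn /sech exprS.
    have [->|x0] := eqVneq x 0; first by rewrite !(mul0r, mulr0).
    field; by rewrite ?ch_neq0 ?sh_neq0//= ?expf_neq0 ?pi_neq0.
  have := Qpi_QpiX (moments_even eb).2; congr Qpi; rewrite exprS invfM; ring.
have am b' c' e' := rapid_qdecay (rapid_mono b' c' e').
have H2 : Qpi (Ipole b.+1 2).
  rewrite /Ipole; have -> : Iint (fun x => (x / pi) ^+ b.+1 * sech x ^+ 2 / thn x) =
      pi ^- b.+1 * (2 ^- b * (moment b xcsch / 2)).
    rewrite -(@Iint_double (fun x => x ^+ b * xcsch x)); last 2 first.
    - exact: (rapidX b rapid_xcsch).1.
    - by move=> x; rewrite mulr_ge0 ?exprn_even_ge0 ?xcsch_ge0.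
    have a2 : qdecay (fun x => (2 * x) ^+ b * xcsch (2 * x)).
      have [C hC] := (rapid_xcsch.2 b).2.
      split; first by apply: (measurableT_comp (rapidX b rapid_xcsch).1); exact: measurable_funM.
      exists C => x; apply: le_trans (hC _) _.
      have C0 : 0 <= C by have := hC 0; rewrite [X in _ + X]expr0n/= addr0 divr1; exact: le_trans.
      rewrite ler_wpM2l// lef_pV2 ?posrE ?addsqr_gt0// lerD2l exprMn ler_peMl ?sqr_ge0//.
      by rewrite -natrX ler1n.
    rewrite -!IintZ//; last exact: qdecayZ.
    apply: eq_Iint => x; rewrite !exprMn !exprVn /xcsch /thn /sech exprS.
    have [->|x0] := eqVneq x 0; first by rewrite !(mul0r, mulr0).
    have -> : sh (2 * x) = 2 * sh x * ch x.
      by have -> : 2 * x = x + x; [ring|rewrite shD; ring].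
    field; by rewrite ?ch_neq0 ?sh_neq0//= ?expf_neq0 ?pi_neq0.
  have := QpiM (QpiM (Qpi_natV 2) (Qpi_exp b (Qpi_natV 2))) (Qpi_QpiX (moments_even eb).2).
  by congr Qpi; rewrite exprVn exprS !invfM; ring.
have aH e' : qdecay (fun x => (x / pi) ^+ b.+1 * sech x ^+ e'.+1 / thn x).
  have fA : AR (mono b.+1 0 e').
    by apply: eq_hypalg (@hypalg_mono (fun=> True) 1 b.+1 0 e' I) => x; rewrite mul1r.
  have vf : vanish 1 (mono b.+1 0 e').
    exists 1 => x x1; rewrite mul1r expr1 /mono expr0 mulr1 normrM !normrX.
    apply: (@le_trans _ _ (`|x| * 1)); last by rewrite mulr1.
    apply: ler_pM => //; rewrite ?exprn_ge0//.
      by rewrite exprS (le_trans _ (div_pi_le1 x1))// ler_piMr// exprn_ile1// (le_trans (div_pi_le1 x1)).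
    by rewrite exprn_ile1// gtr0_norm ?sech_gt0// sech_le1.
  have := rapid_qdecay (pole_rapid fA vf); apply: eq_qdecay => x.
  by rewrite /mono expr0 expr1 [sech x ^+ e'.+1]exprS; ring.
suff : Qpi (Ipole b.+1 e.+1) /\ Qpi (Ipole b.+1 e.+2) by case.
elim: e => [//|e [IH1 IH2]]; split=> //.
have -> : Ipole b.+1 e.+3 = Ipole b.+1 e.+1 - Imono b.+1 1 e.+1.
  rewrite /Ipole /Imono -mulrBl -IintB//; congr (_ / _); apply: eq0_Iint; first exact: (aH e.+2).1.
  move=> x x0; rewrite /mono -[e.+3]addn2 exprD sech2E expr1.
  by field; exact: thn_neq0.
by apply: QpiB => //; exact: Imono_Qpi.
Qed.

Lemma AR_mono b c d : AR (mono b c d).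
Proof. by apply: eq_hypalg (@hypalg_mono (fun=> True) 1 b c d I) => x; rewrite mul1r. Qed.

Lemma vanish_lin : vanish 1 (fun x => x / pi).
Proof. by exists 1 => x x1; rewrite mul1r expr1 div_pi_le1. Qed.

Lemma vanish1_mono b c d : odd (b + c) -> vanish 1 (mono b c d).
Proof.
case: b => [|b].
  case: c => // c _.
  have -> : mono 0 c.+1 d = fun x => thn x * mono 0 c d x.
    by apply/funext => x; rewrite /mono [thn x ^+ c.+1]exprS; ring.
  exact: vanishM vanish_thn (hypalg_vanish0 (AR_mono 0 c d)).
move=> _; have -> : mono b.+1 c d = fun x => x / pi * mono b c d x.
  by apply/funext => x; rewrite /mono [(x / pi) ^+ b.+1]exprS; ring.
exact: vanishM vanish_lin (hypalg_vanish0 (AR_mono b c d)).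
Qed.

Lemma pole1_mono b c d : odd (b + c) ->
  Qpi (Iint (fun x => sech x * (mono b c d x / thn x ^+ 1)) / pi).
Proof.
move=> obc; have am := rapid_qdecay (pole_rapid (AR_mono b c d) (vanish1_mono d obc)).
case: c obc am => [|c] obc am.
  have -> : (fun x => sech x * (mono b 0 d x / thn x ^+ 1)) =
      (fun x => (x / pi) ^+ b * sech x ^+ d.+1 / thn x).
    by apply/funext => x; rewrite /mono expr0 expr1 [sech x ^+ d.+1]exprS; ring.
  by apply: Ipole_Qpi; rewrite addn0 in obc.
rewrite (@eq0_Iint _ (mono b c d.+1)); [exact: Imono_Qpi|exact: am.1|].
move=> x x0; rewrite /mono expr1 [thn x ^+ c.+1]exprS [sech x ^+ d.+1]exprS.
by field; exact: thn_neq0.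
Qed.

(** The chosen expression of an odd [f] may contain even monomials that do not vanish at 0 and
    cannot be integrated separately against the pole. Writing [f x] as half of [f x - f (- x)]
    removes them one by one. *)
Lemma pole1_Qpi f : hypalg Qpi f -> (forall x, f (- x) = - f x) ->
  Qpi (Iint (fun x => sech x * (f x / thn x ^+ 1)) / pi).
Proof.
move=> fA fo.
pose g h x := sech x * ((h x - h (- x)) / thn x ^+ 1).
have aux h : hypalg Qpi h -> qdecay (g h) /\ Qpi (Iint (g h) / pi).
  elim=> [|q b c d {}h Sq hA [ah Qh]].
    have -> : g (fun=> 0) = fun=> 0 by apply/funext => x; rewrite /g subrr mul0r mulr0.
    by split; [exact: qdecay0|rewrite Iint0 mul0r; exact: (Qpi_nat 0)].
  have [oe|ee] := boolP (odd (b + c)); last first.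
    have -> : g (fun x => q * mono b c d x + h x) = g h.
      by apply/funext => x; rewrite /g monoN -signr_odd (negbTE ee) expr0; ring.
    by [].
  have -> : g (fun x => q * mono b c d x + h x) =
      fun x => (2 * q) * (sech x * (mono b c d x / thn x ^+ 1)) + g h x.
    by apply/funext => x; rewrite /g monoN -signr_odd oe expr1; ring.
  have am := rapid_qdecay (pole_rapid (AR_mono b c d) (vanish1_mono d oe)).
  split; first by apply: qdecayD => //; exact: qdecayZ.
  rewrite IintD//; last exact: qdecayZ.
  rewrite IintZ// mulrDl -mulrA; apply: QpiD => //; apply: QpiM; last exact: pole1_mono.
  by apply: QpiM => //; exact: Qpi_nat.
have [ag Qg] := aux f fA.
have -> : (fun x => sech x * (f x / thn x ^+ 1)) = fun x => 2^-1 * g f x.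
  by apply/funext => x; rewrite /g fo; move: (thn x ^+ 1)^-1 => t; field.
by rewrite IintZ// -mulrA; apply: QpiM => //; exact: (Qpi_natV 2).
Qed.

Lemma cvg_at0_le f C : f 0 = 0 -> 0 <= C ->
  (forall x, `|x| <= 1 -> `|f x| <= C * `|x|) -> {for 0, continuous f}.
Proof.
move=> f0 C0 h; apply/cvgrPdist_le => e e0; rewrite f0.
near=> x; rewrite sub0r normrN; have x1 : `|x| <= 1.
  have : `|0 - x| <= 1 by near: x; apply: cvgr_dist_le => //; exact: cvg_id.
  by rewrite sub0r normrN.
apply: le_trans (h x x1) _.
have : `|0 - x| <= e / (C + 1).
  near: x; apply: cvgr_dist_le; first exact: cvg_id.
  by rewrite divr_gt0// ltr_wpDl.
rewrite sub0r normrN ler_pdivlMr ?ltr_wpDl// => h1.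
by rewrite (le_trans _ h1)// mulrC ler_wpM2l// lerDl.
Unshelve. all: end_near. Qed.

(* Integration by parts trades a pole of order c at 0 for a pole of order c - 1,
   at the price of replacing f by f' - tanh f. *)
Lemma pole_parts c f g : AR f -> AR g -> (forall x, is_derive x 1 f (g x)) ->
  vanish c.+2 f ->
  c.+1%:R * Iint (fun x => sech x ^+ 3 * (f x / thn x ^+ c.+2)) =
  Iint (fun x => sech x * ((g x - thn x * f x) / thn x ^+ c.+1)).
Proof.
move=> fA gA fg vf.
have sb x : `|sech x ^+ 2| <= 1.
  by rewrite normrX exprn_ile1// gtr0_norm ?sech_gt0// sech_le1.
have v1 : vanish c.+1 (fun x => g x - thn x * f x).
  have [C hC] := vanishM (hypalg_vanish0 (hypalg_thn real_subring)) (vanishW vf).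
  apply: vanishD (vanish_der fA vf fg) _; exists C => x x1.
  by rewrite normrN; have := hC x x1; rewrite add0n.
have k1 : AR (fun x => g x - thn x * f x).
  have := hypalgD gA (@hypalgZ _ real_subring (-1) _ I (hypalgM real_subring (hypalg_thn real_subring) fA)).
  by apply: eq_hypalg => x; rewrite mulN1r.
have r1 := pole_rapid k1 v1.
have r2 : rapid (fun x => sech x ^+ 3 * (f x / thn x ^+ c.+2)).
  have := rapidM (pole_rapid fA vf) (measurable_funX 2 measurable_sech) sb.
  by congr rapid; apply/funext => x; rewrite /= ; ring.
pose F x := sech x * (f x / thn x ^+ c.+1).
have r3 : rapid F := pole_rapid fA (vanishW vf).
have dF x : x != 0 -> is_derive x 1 F
    (sech x * ((g x - thn x * f x) / thn x ^+ c.+1) -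
     c.+1%:R * (sech x ^+ 3 * (f x / thn x ^+ c.+2))).
  move=> x0; have t0 := thn_neq0 x0.
  have tc : thn x ^+ c.+1 != 0 by rewrite expf_neq0.
  have h := der1M (der1_sech x) (der1M (fg x) (@der1V (fun y => thn y ^+ c.+1) _ _ tc (der1X c (der1_thn x)))).
  apply: is_derive_eq h _; rewrite /=.
  have c0 : thn x ^+ c != 0 by rewrite expf_neq0.
  generalize (c.+1%:R : R) => k.
  rewrite ![thn x ^+ c.+2]exprS ![thn x ^+ c.+1]exprS.
  move: (sech x) (thn x) (thn x ^+ c) (f x) (g x) t0 c0 => s t u p q t0 u0.
  by field; rewrite t0 u0.
have /eqP : Iint (fun x => sech x * ((g x - thn x * f x) / thn x ^+ c.+1) -
     c.+1%:R * (sech x ^+ 3 * (f x / thn x ^+ c.+2))) = 0.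
  apply: (@Iint_derive0 _ F).
  - apply: qdecayD; first exact: rapid_qdecay r1.
    by under eq_fun do rewrite -mulNr; apply: qdecayZ; exact: rapid_qdecay r2.
  - have [C C0 hC] := vanish_ge0 vf.
    apply: (@cvg_at0_le _ (C * 2 ^+ c.+1)); last 2 first.
    + by rewrite mulr_ge0// exprn_ge0.
    + move=> x x1; rewrite /F normrM gtr0_norm ?sech_gt0//.
      have [->|x0] := eqVneq x 0.
        by rewrite thn0 exprS mul0r invr0 mulr0 normr0 !mulr0.
      apply: (@le_trans _ _ (1 * `|f x / thn x ^+ c.+1|)).
        by rewrite ler_wpM2r// sech_le1.
      rewrite mul1r normrM normfV normrX ler_pdivrMr; last first.
        by rewrite exprn_gt0// normr_gt0 thn_neq0.
      apply: le_trans (hC x x1) _; rewrite exprSr.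
      have -> : C * 2 ^+ c.+1 * `|x| * `|thn x| ^+ c.+1 =
          C * ((2 * `|thn x|) ^+ c.+1 * `|x|) by rewrite exprMn; ring.
      rewrite ler_wpM2l// ler_wpM2r// lerXn2r ?nnegrE ?mulr_ge0//.
      exact: norm_thn_ge.
    + by rewrite /F thn0 exprS mul0r invr0 !mulr0.
  - move=> x x0.
    have ct n : {for x, continuous (fun y => (thn y ^+ n)^-1)}.
      apply: cvgV; first by rewrite expf_neq0// thn_neq0.
      exact: (@hypalg_cont _ real_subring _ (hypalg_exp real_subring n (hypalg_thn real_subring)) x).
    apply: cvgB.
      apply: cvgM; first exact: continuous_sech.
      by apply: cvgM; [exact: (hypalg_cont real_subring k1)|exact: ct].
    apply: cvgM; first exact: cvg_cst.
    apply: cvgM.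
      exact: (@hypalg_cont _ real_subring _ (hypalg_exp real_subring 3 (hypalg_sech real_subring)) x).
    by apply: cvgM; [exact: (hypalg_cont real_subring fA)|exact: ct].
  - by have [_ h] := rapid_qdecay r3.
rewrite IintB; [|exact: rapid_qdecay r1|by apply: qdecayZ; exact: rapid_qdecay r2].
by rewrite IintZ ?subr_eq0; [move=> /eqP ->|exact: rapid_qdecay r2].
Qed.

(** By [1 = sech^2 + tanh^2] the integral splits into one with [sech^3], where integration by parts
    lowers the pole by 1, and one whose pole is lower by 2. Both keep the parity condition, which
    makes [f] odd in the base case [c = 1]. *)
Lemma pole_Qpi c f : hypalg Qpi f -> (forall x, f (- x) = (-1) ^+ c * f x) ->
  vanish c f -> Qpi (Iint (fun x => sech x * (f x / thn x ^+ c)) / pi).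
Proof.
elim/ltn_ind: c f => -[|[|c]] IH f fA fp vf.
- have -> : (fun x => sech x * (f x / thn x ^+ 0)) = (fun x => sech x * f x).
    by apply/funext => x; rewrite expr0 divr1.
  exact: hypalg_Qpi.
- by apply: pole1_Qpi => // x; rewrite fp expr1 mulN1r.
have [g gA fg] := hypalg_der Qpi_subring fA.
have It := hypalg_thn Qpi_subring.
have fR := hypalg_real fA; have gR := hypalg_real gA.
have vf1 := vanishW vf; have vf2 := vanishW vf1.
have sb x : `|sech x ^+ 2| <= 1.
  by rewrite normrX exprn_ile1// gtr0_norm ?sech_gt0// sech_le1.
have a0 := rapid_qdecay (pole_rapid fR vf).
have a2 := rapid_qdecay (pole_rapid fR vf2).
have a1 : qdecay (fun x => sech x ^+ 3 * (f x / thn x ^+ c.+2)).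
  have := rapid_qdecay (rapidM (pole_rapid fR vf) (measurable_funX 2 measurable_sech) sb).
  by apply: eq_qdecay => x; rewrite /= ; ring.
rewrite (@eq0_Iint _ (fun x => sech x ^+ 3 * (f x / thn x ^+ c.+2) +
    sech x * (f x / thn x ^+ c))); [|exact: a0.1|]; last first.
  move=> x x0; have t0 := thn_neq0 x0; have tc : thn x ^+ c != 0 by rewrite expf_neq0.
  rewrite -[c.+2]addn2 exprD [sech x ^+ 3]exprS sech2E.
  by field; rewrite t0 tc.
rewrite IintD// mulrDl; apply: QpiD; last first.
  by apply: IH => // x; rewrite fp -addn2 exprD sqrrN expr1n mulr1.
have -> : Iint (fun x => sech x ^+ 3 * (f x / thn x ^+ c.+2)) = c.+1%:R^-1 *
    Iint (fun x => sech x * ((g x - thn x * f x) / thn x ^+ c.+1)).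
  by rewrite -(pole_parts fR gR fg vf) mulKf// pnatr_eq0.
rewrite -mulrA; apply: QpiM; first exact: Qpi_natV.
apply: IH => //.
- apply: hypalgD => //.
  have := hypalgZ Qpi_subring (QpiN (Qpi_nat 1)) (hypalgM Qpi_subring It fA).
  by apply: eq_hypalg => x; rewrite mulN1r.
- move=> x; have dN := der1_comp (fg (- x)) (@is_deriveNid _ _ x 1).
  have E : (fun y => f (- y)) = (fun y => (-1) ^+ c.+2 * f y) by apply/funext.
  rewrite E in dN; have dM := der1Z ((-1) ^+ c.+2) (fg x).
  have : g (- x) * -1 = (-1) ^+ c.+2 * g x.
    by rewrite -[LHS](@derive_val _ _ _ _ _ _ _ dN) (@derive_val _ _ _ _ _ _ _ dM).
  rewrite mulrN1 => /(canRL opprK) ->; rewrite thnN fp ![(-1) ^+ c.+2]exprS; ring.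
- have [C hC] := vanishM (hypalg_vanish0 (hypalg_thn real_subring)) vf1.
  apply: vanishD (vanish_der fR vf fg) _; exists C => x x1.
  by rewrite normrN; have := hC x x1; rewrite add0n.
Qed.

Lemma Iint_nneseries (f : nat -> R -> R) g : (forall n, qdecay (f n)) ->
  (forall n x, 0 <= f n x) -> qdecay g ->
  (forall x, (\sum_(n <oo) (f n x)%:E)%E = (g x)%:E) ->
  (\sum_(n <oo) (Iint (f n))%:E)%E = (Iint g)%:E.
Proof.
move=> af f0 ag fg; rewrite ge0_EFin_Iint//.
under eq_integral do rewrite -fg.
rewrite integral_nneseries//.
- by apply: eq_eseriesr => n _; rewrite ge0_EFin_Iint.
- by move=> n; apply/measurable_EFinP; exact: (af n).1.
- by move=> n x _; rewrite lee_fin.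
Qed.

Lemma nneseries_geo_even (w : R) : `|w| < 1 ->
  (\sum_(n <oo) ((if odd n then 0 else w ^+ n)%R)%:E)%E = ((1 - w ^+ 2)^-1)%:E.
Proof.
move=> w1; have w2 : 1 - w ^+ 2 != 0.
  by rewrite subr_eq0 eq_sym lt_eqF// -real_normK ?num_real// exprn_ilt1.
apply: cvg_lim => //.
have E n : (\sum_(0 <= k < n) ((if odd k then 0 else w ^+ k)%R)%:E)%E =
    ((1 - w ^+ (n + odd n)) / (1 - w ^+ 2))%:E.
  rewrite sumEFin; congr EFin; elim: n => [|n IH].
    by rewrite big_geq// addn0 expr0 subrr mul0r.
  rewrite big_nat_recr//= IH; case: (odd n) => /=; first by rewrite addr0 addn1 addn0.
  by rewrite addn0 addn1 -[n.+2]addn2 exprD; field.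
under eq_fun do rewrite E.
apply: cvg_EFin; first exact: nearW.
rewrite -[X in _ --> X]mul1r; apply: cvgM; last exact: cvg_cst.
rewrite -[X in _ --> X]subr0; apply: cvgB; first exact: cvg_cst.
apply/cvgrPdist_le => e e0; near=> n; rewrite sub0r normrN normrX.
have h : `| `|w| ^+ n - 0| <= e.
  near: n; apply: cvgr_distC_le => //; apply: cvg_expr.
  by rewrite normr_id.
rewrite subr0 ger0_norm ?exprn_ge0// in h; apply: le_trans h.
by rewrite exprD ler_piMr// ?exprn_ge0// exprn_ile1// ltW.
Unshelve. all: end_near. Qed.

Lemma Iint_ge0 f : (forall x, 0 <= f x) -> 0 <= Iint f.
Proof. by move=> f0; apply: Rintegral_ge0 => x _. Qed.

Lemma le_Iint f g : qdecay f -> qdecay g -> (forall x, f x <= g x) -> Iint f <= Iint g.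
Proof.
move=> af ag fg; rewrite -subr_ge0 -IintB//; apply: Iint_ge0 => x.
by rewrite subr_ge0.
Qed.

Lemma rapid_eq0 f g : rapid f -> (forall x, x != 0 -> f x = g x) -> rapid g.
Proof.
move=> [mf af] fg; have mg := measurable_eq0 fg mf; split=> // n.
have [_ [C hC]] := af n.
split; first by apply: measurable_funM => //; exact: measurable_X.
exists (`|C| + `|0 ^+ n * g 0|) => x; have [->|x0] := eqVneq x 0.
  by rewrite [0 ^+ 2]expr0n/= addr0 divr1 lerDr.
rewrite -fg//; apply: le_trans (hC x) _.
rewrite ler_pM2r ?invr_gt0 ?addsqr_gt0//.
by rewrite (le_trans (ler_norm C))// lerDl.
Qed.

(** * Weights of a face *)

(** The invariant of leaf removal. Positivity allows series and integrals to be exchanged;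
    boundedness near 0 forces the numerator provided by [tame] to vanish to the order of the
    pole. *)
Definition weight f := [/\ forall x, f (- x) = f x, forall x, 0 <= f x,
  vanish 0 f & tame f].

(** Doubling the order of the pole makes the numerator even. *)
Lemma weightE f : weight f -> exists N h, [/\ hypalg Qpi h,
  forall x, thn x ^+ N.*2 * f x = h x, forall x, h (- x) = h x & vanish N.*2 h].
Proof.
move=> [ef _ bf [N [h [hA hE]]]].
have E x : thn x ^+ N.*2 * f x = thn x ^+ N * h x.
  by rewrite -hE -addnn exprD mulrA.
exists N, (fun x => thn x ^+ N * h x); split=> //.
- by apply: (hypalgM Qpi_subring) => //; exact: (hypalg_exp Qpi_subring _ (hypalg_thn Qpi_subring)).
- by move=> x; rewrite -!E ef thnN exprNn -signr_odd odd_double mul1r.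
- have vt n : vanish n (fun x => thn x ^+ n).
    elim: n => [|n IH]; first by exists 1 => x _; rewrite !expr0 normr1 mul1r.
    have := vanishM vanish_thn IH; rewrite add1n.
    by congr vanish; apply/funext => x; rewrite exprS.
  have := vanishM (vt N.*2) bf; rewrite addn0.
  by congr vanish; apply/funext => x; rewrite E.
Qed.

Lemma weight1 : weight (fun=> 1).
Proof.
split=> //; last exact: (tame_hypalg (hypalg_cst (Qpi_nat 1))).
by exists 1 => x _; rewrite normr1 expr0 mulr1.
Qed.

Lemma weightM f g : weight f -> weight g -> weight (fun x => f x * g x).
Proof.
move=> [ef pf bf tf] [eg pg bg tg]; split.
- by move=> x; rewrite ef eg.
- by move=> x; rewrite mulr_ge0.
- exact: vanishM bf bg.
- exact: tameM.
Qed.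

Lemma weight_rapid f : weight f -> rapid (fun x => sech x * f x).
Proof.
move=> /weightE[N [h [hA hE _ vh]]].
apply: rapid_eq0 (pole_rapid (hypalg_real hA) vh) _ => x x0.
by rewrite -hE mulrAC divff ?mul1r// expf_neq0// thn_neq0.
Qed.

Lemma weight_rapid3 f n : weight f -> rapid (fun x => sech x ^+ 3 * (thn x ^+ n * f x)).
Proof.
move=> gf; have m : measurable_fun setT (fun x => sech x ^+ 2 * thn x ^+ n).
  by apply: measurable_funM; apply: measurable_funX; [exact: measurable_sech|exact: measurable_thn].
have := rapidM (weight_rapid gf) m (C := 1).
have b x : `|sech x ^+ 2 * thn x ^+ n| <= 1.
  rewrite normrM !normrX mulr_ile1 ?exprn_ge0//.
    by rewrite exprn_ile1// gtr0_norm ?sech_gt0// sech_le1.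
  by rewrite exprn_ile1// ltW// thn_lt1.
by move=> /(_ b); congr rapid; apply/funext => x /=; ring.
Qed.

(* For [f = 1] and [n = 2 m] this is the Catalan number of [m] over [4 ^ m], the
   probability that a uniform word of length [n] is balanced. *)
Definition wcoef f n := if odd n then 0 else
  2 * (Iint (fun x => sech x ^+ 3 * (thn x ^+ n * f x)) / pi).

Lemma wcoef_ge0 f n : weight f -> 0 <= wcoef f n.
Proof.
move=> [_ f0 _ _]; rewrite /wcoef; case: ifPn => // en.
rewrite mulr_ge0// divr_ge0 ?pi_ge0//; apply: Iint_ge0 => x.
by rewrite mulr_ge0 ?exprn_ge0 ?mulr_ge0 ?exprn_even_ge0// ltW// sech_gt0.
Qed.

Lemma weight_pole f g : weight f -> hypalg Qpi g -> (forall x, g (- x) = g x) ->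
  Qpi (Iint (fun x => sech x * (g x * f x)) / pi).
Proof.
move=> gf gA ge; have [N [h [hA hE he vh]]] := weightE gf.
have vgh : vanish N.*2 (fun x => g x * h x).
  exact: vanishM (hypalg_vanish0 (hypalg_real gA)) vh.
have ghA := hypalgM Qpi_subring gA hA.
have r := pole_rapid (hypalg_real ghA) vgh.
have := pole_Qpi ghA _ vgh; rewrite (@eq0_Iint _ (fun x => sech x * (g x * f x))).
- by apply => x; rewrite ge he -signr_odd odd_double mul1r.
- exact: r.1.
- move=> x x0; rewrite -hE; congr (_ * _); rewrite -mulrA; congr (_ * _).
  by rewrite mulrAC divff ?mul1r// expf_neq0// thn_neq0.
Qed.

Lemma wcoef_Qpi f n : weight f -> Qpi (wcoef f n).
Proof.
move=> gf; rewrite /wcoef; case: ifPn => [_|en]; first exact: (Qpi_nat 0).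
apply: QpiM; first exact: (Qpi_nat 2).
have gA := hypalgM Qpi_subring (hypalg_exp Qpi_subring 2 (hypalg_sech Qpi_subring))
  (hypalg_exp Qpi_subring n (hypalg_thn Qpi_subring)).
have := weight_pole gf gA.
have -> : (fun x => sech x * (sech x ^+ 2 * thn x ^+ n * f x)) =
    (fun x => sech x ^+ 3 * (thn x ^+ n * f x)) by apply/funext => x; ring.
by apply => x; rewrite sechN thnN exprNn -signr_odd (negbTE en) mul1r.
Qed.

(** The generating function of [wcoef f] at argument 1, where [sech^3 / (1 - tanh^2) = sech]. *)
Definition wtotal f := 2 * (Iint (fun x => sech x * f x) / pi).

Lemma wtotal_Qpi f : weight f -> Qpi (wtotal f).
Proof.
move=> gf; apply: QpiM; first exact: (Qpi_nat 2).
have := weight_pole gf (hypalg_cst (Qpi_nat 1)).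
have -> : (fun x => sech x * (1 * f x)) = (fun x => sech x * f x).
  by apply/funext => x; rewrite mul1r.
exact.
Qed.

Lemma thn2_lt1 x : thn x ^+ 2 < 1.
Proof. by rewrite -subr_gt0 -sech2E exprn_gt0// sech_gt0. Qed.

(* [w] stands for the square of the tanh of a second variable. *)
Lemma weight_kern f w : weight f -> 0 <= w < 1 ->
  qdecay (fun x => sech x ^+ 3 * f x / (1 - thn x ^+ 2 * w)).
Proof.
move=> gf /andP[w0 w1].
have k0 x : 0 < 1 - thn x ^+ 2 * w.
  have := thn2_lt1 x; have := sqr_ge0 (thn x); nra.
have a : qdecay (fun x => sech x ^+ 3 * f x).
  apply: eq_qdecay (rapid_qdecay (weight_rapid3 0 gf)) => x.
  by rewrite expr0 mul1r.
apply: (qdecayM (C := (1 - w)^-1) a).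
  apply: continuous_measurable_fun => x; apply: cvgV; first by rewrite gt_eqF.
  apply: cvgB; first exact: cvg_cst.
  apply: cvgM; last exact: cvg_cst.
  exact: (@hypalg_cont _ real_subring _ (hypalg_exp real_subring 2 (hypalg_thn real_subring)) x).
move=> x; rewrite gtr0_norm ?invr_gt0// lef_pV2 ?posrE ?k0// ?subr_gt0//.
rewrite lerD2l lerN2 ler_piMl// ltW//; exact: thn2_lt1.
Qed.

Definition leafop f a := 2 * (Iint (fun x =>
  sech x ^+ 3 * f x / (1 - thn x ^+ 2 * thn a ^+ 2)) / pi).

Lemma wcoef_sum f (v : R) : weight f -> `|v| < 1 ->
  (\sum_(n <oo) (wcoef f n * v ^+ n)%:E)%E =
  (2 * (Iint (fun x => sech x ^+ 3 * f x / (1 - thn x ^+ 2 * v ^+ 2)) / pi))%:E.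
Proof.
move=> gf v1; have [_ f0 _ _] := gf.
have pi0 : 0 <= 2 / pi :> R by rewrite divr_ge0 ?pi_ge0.
pose g n x := 2 / pi * (sech x ^+ 3 * f x * (if odd n then 0 else (thn x * v) ^+ n)).
have e n x : g n x = (if odd n then 0 else 2 / pi * v ^+ n) * (sech x ^+ 3 * (thn x ^+ n * f x)).
  by rewrite /g; case: ifP => _; rewrite ?exprMn; ring.
have ag n : qdecay (g n).
  have := qdecayZ (if odd n then 0 else 2 / pi * v ^+ n) (rapid_qdecay (weight_rapid3 n gf)).
  by apply: eq_qdecay => x; rewrite e.
have w01 : 0 <= v ^+ 2 < 1.
  by rewrite sqr_ge0 -real_normK ?num_real// exprn_ilt1.
have := @Iint_nneseries g (fun x => 2 / pi * (sech x ^+ 3 * f x / (1 - thn x ^+ 2 * v ^+ 2))) ag.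
have g0 n x : 0 <= g n x.
  have s0 : 0 <= sech x ^+ 3 by rewrite exprn_ge0// ltW// sech_gt0.
  rewrite /g mulr_ge0// mulr_ge0//; first by rewrite mulr_ge0.
  by case: ifPn => // en; rewrite exprn_even_ge0.
move=> /(_ g0 (qdecayZ _ (weight_kern gf w01))).
rewrite IintZ; last exact: weight_kern.
have -> : 2 / pi * Iint (fun x => sech x ^+ 3 * f x / (1 - thn x ^+ 2 * v ^+ 2)) =
  2 * (Iint (fun x => sech x ^+ 3 * f x / (1 - thn x ^+ 2 * v ^+ 2)) / pi) by ring.
move=> <-.
  apply: eq_eseriesr => n _; congr EFin; rewrite (eq_Iint (e n)) IintZ; last first.
    exact: rapid_qdecay (weight_rapid3 n gf).
  by rewrite /wcoef; case: ifP => _; ring.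
move=> x; rewrite /g.
have tv1 : `|thn x * v| < 1 by rewrite normrM -[ltRHS]mulr1 ltr_pM ?thn_lt1.
rewrite -exprMn mulrA.
have c0 : 0 <= 2 / pi * (sech x ^+ 3 * f x).
  have s0 : 0 <= sech x ^+ 3 by rewrite exprn_ge0// ltW// sech_gt0.
  by rewrite mulr_ge0// mulr_ge0.
rewrite (@EFinM R) -nneseries_geo_even// -nneseriesZl//.
  by apply: eq_eseriesr => n _; rewrite -EFinM mulrA.
by move=> n _; rewrite lee_fin; case: ifPn => // en; rewrite exprn_even_ge0.
Qed.

Lemma leafop_sum f a : weight f ->
  (\sum_(n <oo) (wcoef f n * thn a ^+ n)%:E)%E = (leafop f a)%:E.
Proof. by move=> gf; rewrite wcoef_sum// thn_lt1. Qed.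

Lemma ch_sq_kern a : (1 - thn a ^+ 2)^-1 = ch a ^+ 2.
Proof. by rewrite -sech2E /sech exprVn invrK. Qed.

Lemma ch_le_expR1 a : `|a| <= 1 -> ch a <= expR 1.
Proof.
rewrite ler_norml => /andP[a1 a2].
have h1 : expR a <= expR 1 by rewrite ler_expR.
have h2 : expR (- a) <= expR 1 by rewrite ler_expR lerNl.
by rewrite /ch ler_pdivrMr//; lra.
Qed.

Lemma thn2_itv a : 0 <= thn a ^+ 2 < 1.
Proof. by rewrite sqr_ge0 thn2_lt1. Qed.

Lemma leafop_ge0 f a : weight f -> 0 <= leafop f a.
Proof.
move=> [_ f0 _ _]; rewrite mulr_ge0// divr_ge0 ?pi_ge0//; apply: Iint_ge0 => x.
have s0 := sech_gt0 x.
have k0 : 0 < 1 - thn x ^+ 2 * thn a ^+ 2.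
  have := thn2_lt1 x; have := thn2_lt1 a; have := sqr_ge0 (thn x).
  have := sqr_ge0 (thn a); nra.
by rewrite divr_ge0 ?(ltW k0)// mulr_ge0// exprn_ge0// ltW.
Qed.

Lemma leafop_vanish0 f : weight f -> vanish 0 (leafop f).
Proof.
move=> gf; have [_ f0 _ _] := gf.
have a3 : qdecay (fun x => sech x ^+ 3 * f x).
  by apply: eq_qdecay (rapid_qdecay (weight_rapid3 0 gf)) => x; rewrite expr0 mul1r.
pose D := 2 * (Iint (fun x => sech x ^+ 3 * f x) / pi).
have D0 : 0 <= D.
  rewrite mulr_ge0// divr_ge0 ?pi_ge0//; apply: Iint_ge0 => x.
  by rewrite mulr_ge0// exprn_ge0// ltW// sech_gt0.
exists (D * expR 1 ^+ 2) => a a1; rewrite expr0 mulr1 ger0_norm ?leafop_ge0//.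
apply: (@le_trans _ _ (D * ch a ^+ 2)); last first.
  rewrite ler_wpM2l// lerXn2r ?nnegrE ?expR_ge0 ?ch_le_expR1//.
  by rewrite ltW// ch_gt0.
rewrite /D /leafop -mulrA ler_wpM2l// mulrAC ler_wpM2r ?invr_ge0 ?pi_ge0//.
rewrite mulrC -IintZ//; apply: le_Iint.
- exact: weight_kern (thn2_itv a).
- exact: qdecayZ.
- move=> x; rewrite [_ / _]mulrC ler_wpM2r//.
    by rewrite mulr_ge0// exprn_ge0// ltW// sech_gt0.
  have k1 : 0 < 1 - thn a ^+ 2 by rewrite subr_gt0 thn2_lt1.
  have k2 : 1 - thn a ^+ 2 <= 1 - thn x ^+ 2 * thn a ^+ 2.
    by rewrite lerD2l lerN2 ler_piMl ?sqr_ge0// ltW// thn2_lt1.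
  by rewrite -ch_sq_kern lef_pV2 ?posrE// (lt_le_trans k1).
Qed.

Lemma geometric_split (w : R) N : w != 1 ->
  (1 - w)^-1 = \sum_(j < N) w ^+ j + w ^+ N / (1 - w).
Proof.
move=> w1; have w0 : 1 - w != 0 by rewrite subr_eq0 eq_sym.
elim: N => [|N IH]; first by rewrite big_ord0 expr0 add0r div1r.
by rewrite big_ord_recr /= [LHS]IH -addrA; congr (_ + _); rewrite exprS; field.
Qed.

Lemma leafopE f N h a : weight f -> hypalg Qpi h -> (forall x, thn x ^+ N.*2 * f x = h x) ->
  leafop f a = \sum_(j < N) wcoef f j.*2 * thn a ^+ j.*2 +
    thn a ^+ N.*2 * (Kint (fun x => sech x ^+ 3 * h x) a +
                     Kint (fun x => sech x ^+ 3 * h x) (- a)).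
Proof.
move=> gf hA hE.
have ah : qdecay (fun x => sech x ^+ 3 * h x).
  by apply: eq_qdecay (rapid_qdecay (weight_rapid3 N.*2 gf)) => x; rewrite hE.
have a1 := qdecay_kern a ah; have a2 := qdecay_kern (- a) ah.
have a3 j := rapid_qdecay (weight_rapid3 j gf).
have E x : sech x ^+ 3 * f x / (1 - thn x ^+ 2 * thn a ^+ 2) =
    \sum_(j < N) thn a ^+ j.*2 * (sech x ^+ 3 * (thn x ^+ j.*2 * f x)) +
    thn a ^+ N.*2 / 2 * (sech x ^+ 3 * h x / (1 - thn x * thn a) +
                         sech x ^+ 3 * h x / (1 - thn x * thn (- a))).
  have k1 := kern_gt0 x a; have k2 := kern_gt0 x (- a).
  rewrite thnN mulrN opprK in k2 *.
  have kE : 1 - thn x ^+ 2 * thn a ^+ 2 = (1 - thn x * thn a) * (1 + thn x * thn a) by ring.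
  have k3 : thn x ^+ 2 * thn a ^+ 2 != 1.
    by rewrite eq_sym -subr_eq0 kE mulf_neq0// gt_eqF.
  rewrite (geometric_split N k3) mulrDr; congr (_ + _).
    rewrite mulr_sumr; apply: eq_bigr => j _.
    by rewrite exprMn -!exprM !mul2n; ring.
  rewrite kE -hE exprMn -!exprM !mul2n; field.
  by rewrite !gt_eqF.
rewrite /leafop (eq_Iint E) IintD; last 2 first.
- by apply: qdecay_sum => j; apply: qdecayZ.
- by apply: qdecayZ; exact: qdecayD.
rewrite Iint_sum; last by move=> j; exact: qdecayZ.
rewrite IintZ; last exact: qdecayD.
rewrite IintD//; set S := \sum_(i <- _) _.
transitivity (2 * (S / pi) + thn a ^+ N.*2 *
  (Kint (fun x => sech x ^+ 3 * h x) a + Kint (fun x => sech x ^+ 3 * h x) (- a))).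
  rewrite /Kint; move: (Iint _) (Iint _) => A B.
  by move: S (pi^-1) => S p; field.
congr (_ + _); rewrite /S.
rewrite mulr_suml mulr_sumr; apply: eq_bigr => j _.
by rewrite /wcoef odd_double IintZ//; ring.
Qed.

Lemma weight_leafop f : weight f -> weight (leafop f).
Proof.
move=> gf; split.
- by move=> a; rewrite /leafop thnN sqrrN.
- by move=> a; exact: leafop_ge0.
- exact: leafop_vanish0.
have [N [h [hA hE _ _]]] := weightE gf.
apply: eq_tame (fun a => esym (leafopE a gf hA hE)) _.
have It n : hypalg Qpi (fun a => thn a ^+ n).
  exact: (hypalg_exp Qpi_subring n (hypalg_thn Qpi_subring)).
apply: tameD.
  apply/tame_hypalg/hypalg_sum => j; apply: (hypalgZ Qpi_subring) => //.
  exact: wcoef_Qpi.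
apply: tameM; first exact/tame_hypalg.
have tk := tame_Kint hA.
exact: tameD tk (tame_opp tk).
Qed.

(* Summing the label of the edge between a leaf and its neighbour [g] turns
   the generating function of the neighbour into [g * leafop f]. *)
Lemma wcoef_conv f g r : weight f -> weight g ->
  (\sum_(n <oo) (wcoef f n * wcoef g (n + r))%:E)%E = (wcoef (fun x => g x * leafop f x) r)%:E.
Proof.
move=> gf gg; have [_ g0 _ _] := gg.
have [or|er] := boolP (odd r).
  rewrite /wcoef or eseries0// => n _ _.
  by rewrite oddD or; case: (odd n); rewrite ?mul0r ?mulr0.
have gk := weightM gg (weight_leafop gf).
pose c : R := 2 / pi.
have c0 : 0 <= c by rewrite divr_ge0 ?pi_ge0.
pose h n x := c * (sech x ^+ 3 * (thn x ^+ r * g x)) * (wcoef f n * thn x ^+ n).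
have fo n : odd n -> wcoef f n = 0 by rewrite /wcoef => ->.
have eh n x : h n x = wcoef f n * c * (sech x ^+ 3 * (thn x ^+ (n + r) * g x)).
  by rewrite /h exprD; ring.
have ah n : qdecay (h n).
  apply: eq_qdecay (fun x => esym (eh n x)) _; apply: qdecayZ.
  exact: rapid_qdecay (weight_rapid3 (n + r) gg).
have s0 x : 0 <= c * (sech x ^+ 3 * (thn x ^+ r * g x)).
  rewrite mulr_ge0// mulr_ge0//; first by rewrite exprn_ge0// ltW// sech_gt0.
  by rewrite mulr_ge0// exprn_even_ge0.
have t0 n x : 0 <= wcoef f n * thn x ^+ n.
  have [on|en] := boolP (odd n); first by rewrite fo// mul0r.
  by rewrite mulr_ge0 ?wcoef_ge0// exprn_even_ge0.
have h0 n x : 0 <= h n x by rewrite /h mulr_ge0.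
have ak := rapid_qdecay (weight_rapid3 r gk).
have := @Iint_nneseries h _ ah h0 (qdecayZ c ak).
rewrite IintZ// => E.
have -> : wcoef (fun x => g x * leafop f x) r =
    c * Iint (fun x => sech x ^+ 3 * (thn x ^+ r * (g x * leafop f x))).
  by rewrite /wcoef (negbTE er) /c; ring.
rewrite -E.
  apply: eq_eseriesr => n _; congr EFin; rewrite (eq_Iint (eh n)) IintZ; last first.
    exact: rapid_qdecay (weight_rapid3 (n + r) gg).
  have [on|en] := boolP (odd n); first by rewrite fo// !mul0r.
  by rewrite [wcoef g _]/wcoef oddD (negbTE en) (negbTE er) /c /=; ring.
move=> x; rewrite /h.
have -> : c * (sech x ^+ 3 * (thn x ^+ r * (g x * leafop f x))) =
   c * (sech x ^+ 3 * (thn x ^+ r * g x)) * leafop f x by ring.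
rewrite (@EFinM R) -leafop_sum// -nneseriesZl//.
by move=> n _; rewrite lee_fin.
Qed.

Lemma wcoef_total f : weight f -> (\sum_(n <oo) (wcoef f n)%:E)%E = (wtotal f)%:E.
Proof.
move=> gf; have [_ f0 _ _] := gf.
pose c : R := 2 / pi.
have c0 : 0 <= c by rewrite divr_ge0 ?pi_ge0.
have s0 x : 0 <= c * (sech x ^+ 3 * f x).
  by rewrite mulr_ge0// mulr_ge0// exprn_ge0// ltW// sech_gt0.
pose h n x := c * (sech x ^+ 3 * f x) * (if odd n then 0 else thn x ^+ n).
have eh n x : h n x = (if odd n then 0 else c) * (sech x ^+ 3 * (thn x ^+ n * f x)).
  by rewrite /h; case: ifP => _; ring.
have a3 n := rapid_qdecay (weight_rapid3 n gf).
have ah n : qdecay (h n).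
  by apply: eq_qdecay (fun x => esym (eh n x)) _; exact: qdecayZ.
have p0 n x : 0 <= (if odd n then 0 else thn x ^+ n).
  by case: ifPn => // en; rewrite exprn_even_ge0.
have h0 n x : 0 <= h n x by rewrite /h mulr_ge0.
have a1 := rapid_qdecay (weight_rapid gf).
have := @Iint_nneseries h _ ah h0 (qdecayZ c a1).
rewrite IintZ// => E.
have -> : wtotal f = c * Iint (fun x => sech x * f x) by rewrite /wtotal /c; ring.
rewrite -E.
  apply: eq_eseriesr => n _; congr EFin; rewrite (eq_Iint (eh n)) IintZ//.
  by rewrite /wcoef; case: ifP => _; rewrite ?mul0r// /c; ring.
move=> x; rewrite /h.
have -> : c * (sech x * f x) = c * (sech x ^+ 3 * f x) * (1 - thn x ^+ 2)^-1.
  by rewrite ch_sq_kern /sech; field; exact: ch_neq0.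
rewrite (@EFinM R) -nneseries_geo_even ?thn_lt1// -nneseriesZl//.
by move=> n _; rewrite lee_fin.
Qed.

Lemma wcoef1_0 : wcoef (fun=> 1) 0 = 1.
Proof.
have E : Imono 0 0 3 = Imono 0 0 1 / 2.
  have := Imono_parts 0 1 0; have := Imono_thn2 0 0 0.
  by rewrite mul0r mul0r add0r !mul1r => ->; lra.
have E1 : Imono 0 0 1 = 1.
  rewrite /Imono; have -> : Iint (mono 0 0 1) = pi.
    rewrite -moment0_sech.
    by apply: eq_Iint => x; rewrite /mono !expr0 expr1 mul1r.
  exact: (divff pi_neq0).
rewrite /wcoef /=; have -> : Iint (fun x => sech x ^+ 3 * (thn x ^+ 0 * 1)) / pi = Imono 0 0 3.
  by rewrite /Imono; congr (_ / _); apply: eq_Iint => x; rewrite /mono !expr0; ring.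
by rewrite E E1; field.
Qed.

(** Integration by parts reproduces the recurrence of [Cat(m) / 4 ^ m], where [Cat(m + 1) = 2 (2 m +
    1) / (m + 2) * Cat(m)]. *)
Lemma wcoef1_rec m : (m.*2 + 4)%:R * wcoef (fun=> 1) m.*2.+2 =
  (m.*2 + 1)%:R * wcoef (fun=> 1) m.*2.
Proof.
have E n : wcoef (fun=> 1) n.*2 = 2 * Imono 0 n.*2 3.
  rewrite /wcoef odd_double /Imono; congr (_ * (_ / _)); apply: eq_Iint => x.
  by rewrite /mono expr0; ring.
rewrite -doubleS !E.
have := Imono_parts 0 m.*2.+1 2; have := Imono_thn2 0 m.*2 2.
rewrite mul0r mul0r add0r /= doubleS => -> h.
have -> : (m.*2 + 4)%:R = m.*2.+1%:R + 3 :> R by rewrite -natrD; congr _%:R; lia.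
rewrite addn1; apply/eqP; rewrite -subr_eq0; apply/eqP.
move: h; move: (Imono 0 m.*2 3) (Imono 0 m.*2 5) (m.*2.+1%:R : R) => p q k.
move/(congr1 (fun z => - 2 * z)); rewrite mulr0 => <-; ring.
Qed.

Lemma wtotal1 : wtotal (fun=> 1) = 2.
Proof.
rewrite /wtotal; have -> : Iint (fun x => sech x * 1) = pi.
  by rewrite -moment0_sech; apply: eq_Iint => x; rewrite expr0; ring.
by rewrite divff ?pi_neq0// mulr1.
Qed.

End RealLine.

(** * Summing over the labels of a forest *)

Section LeafElimination.
Variables (R : realType) (J V : finType) (inc : V -> J -> bool).
Implicit Types (s : seq J) (g : J -> nat).

Definition upd g e n : J -> nat := fun j => if j == e then n else g j.

(** The head of the list is the innermost sum, hence the first to be eliminated; labels outside the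
    list are 0. *)
Fixpoint isum s (Phi : (J -> nat) -> \bar R) : \bar R :=
  if s is e :: s' then isum s' (fun g => \sum_(n <oo) Phi (upd g e n))%E
  else Phi (fun=> 0%N).

(** When [e] is reached, [v] is a leaf: no edge still present meets it. *)
Fixpoint elim_order s : Prop :=
  if s is e :: s' then
    (exists2 v, inc v e & forall e', e' \in s' -> ~~ inc v e') /\ elim_order s'
  else True.

Definition load v g s := (\sum_(e <- s | inc v e) g e)%N.

Lemma eq_isum s Phi Psi : Phi =1 Psi -> isum s Phi = isum s Psi.
Proof. by move=> /funext ->. Qed.

Lemma load_upd v g e n s : e \notin s -> load v (upd g e n) s = load v g s.
Proof.
move=> es; rewrite /load big_seq_cond [RHS]big_seq_cond; apply: eq_bigr => j /andP[js _].
by rewrite /upd; case: eqVneq => // je; rewrite -je js in es.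
Qed.

Lemma load_cons v g e s : load v g (e :: s) =
  ((if inc v e then g e else 0) + load v g s)%N.
Proof. by rewrite /load big_cons; case: ifP. Qed.

Hypothesis inc_le2 : forall e, (#|[set v | inc v e]%SET| <= 2)%N.

(** [A] holds the faces not yet removed, [G] the weights accumulated on them and [r] the constants
    split off. Summing the head label removes the leaf [v0]: its contribution goes into [r] if the
    gap meets no other face, and into the weight of the other face otherwise. *)
Lemma isum_Qpi s (A : {set V}) (G : V -> R -> R) (r : R) : uniq s -> elim_order s ->
  (forall v, weight (G v)) ->
  (forall v e, v \notin A -> e \in s -> ~~ inc v e) -> Qpi r -> 0 <= r ->
  exists2 q, Qpi q &
    isum s (fun g => (r * \prod_(v in A) wcoef (G v) (load v g s))%:E) = q%:E.
Proof.
elim: s A G r => [|e s IH] A G r.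
  move=> _ _ gG _ Qr _; eexists; last by [].
  apply: QpiM => //; elim/big_ind: _ => [|p q|v _].
  - exact: (Qpi_nat _ 1).
  - exact: QpiM.
  - exact: wcoef_Qpi.
move=> /= /andP[es us] [[v0 v0e v0s] os] gG hA Qr r0.
have v0A : v0 \in A by apply: contraLR v0e => /hA -> //; rewrite mem_head.
have load0 g n : load v0 (upd g e n) (e :: s) = n.
  rewrite load_cons v0e /upd eqxx /load big_seq_cond big1 ?addn0// => j /andP[js].
  by rewrite (negbTE (v0s _ js)).
have prod0 (B : {set V}) (Ipole : V -> R -> R) (f : V -> nat) : (forall v, weight (Ipole v)) ->
    0 <= \prod_(v in B) wcoef (Ipole v) (f v).
  by move=> gH; apply: prodr_ge0 => v _; exact: wcoef_ge0.
have [v1 /andP[v10 v1e]|noV1] := pickP [pred v | (v != v0) && inc v e]; last first.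
  have [q Qq hq] := IH (A :\ v0) G (r * wtotal (G v0)) us os gG
    (fun v j vA js => ltac:(by move: vA; rewrite !inE negb_and negbK => /orP[/eqP ->|vA];
      [exact: v0s|apply: hA => //; rewrite inE js orbT])) (QpiM Qr (wtotal_Qpi (gG v0)))
    ltac:(by rewrite mulr_ge0// -lee_fin -wcoef_total//; apply: nneseries_ge0 => n _ _;
      rewrite lee_fin wcoef_ge0).
  exists q => //; rewrite -hq; apply: eq_isum => g.
  pose c := r * \prod_(v in A :\ v0) wcoef (G v) (load v g s).
  have c0 : 0 <= c by rewrite mulr_ge0 ?prod0.
  have -> : r * wtotal (G v0) * \prod_(v in A :\ v0) wcoef (G v) (load v g s) =
    c * wtotal (G v0) by rewrite /c; ring.
  rewrite (@EFinM R) -wcoef_total// -nneseriesZl//; last first.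
    by move=> n _; rewrite lee_fin wcoef_ge0.
  apply: eq_eseriesr => n _; rewrite -EFinM; congr EFin.
  rewrite (big_setD1 v0)//= load0 mulrA [r * _]mulrC -mulrA mulrC; congr (_ * _ * _).
  apply: eq_bigr => v; rewrite !inE => /andP[vv0 _]; rewrite load_cons load_upd//.
  by have := noV1 v; rewrite inE vv0 /= => ->.
have v1A : v1 \in A by apply: contraLR v1e => /hA -> //; rewrite mem_head.
pose G' v := if v == v1 then fun x => G v1 x * leafop (G v0) x else G v.
have gG' v : weight (G' v).
  rewrite /G'; case: ifP => _; [exact: weightM (gG v1) (weight_leafop (gG v0))|exact: gG].
have [q Qq hq] := IH (A :\ v0) G' r us os gG'
  (fun v j vA js => ltac:(by move: vA; rewrite !inE negb_and negbK => /orP[/eqP ->|vA];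
    [exact: v0s|apply: hA => //; rewrite inE js orbT])) Qr r0.
exists q => //; rewrite -hq; apply: eq_isum => g.
pose c := r * \prod_(v in A :\ v0 :\ v1) wcoef (G v) (load v g s).
have c0 : 0 <= c by rewrite mulr_ge0 ?prod0.
have v1A0 : v1 \in A :\ v0 by rewrite !inE v10.
rewrite (big_setD1 v1)//= {1}/G' eqxx.
have -> : \prod_(v in A :\ v0 :\ v1) wcoef (G' v) (load v g s) =
    \prod_(v in A :\ v0 :\ v1) wcoef (G v) (load v g s).
  by apply: eq_bigr => v; rewrite !inE /G' => /andP[/negbTE -> _].
rewrite mulrCA mulrC -/c (@EFinM R) -wcoef_conv// -nneseriesZl//; last first.
  by move=> n _; rewrite lee_fin mulr_ge0 ?wcoef_ge0.
apply: eq_eseriesr => n _; rewrite -EFinM; congr EFin.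
have PE : \prod_(v in A :\ v0 :\ v1) wcoef (G v) (load v (upd g e n) (e :: s)) =
    \prod_(v in A :\ v0 :\ v1) wcoef (G v) (load v g s).
  apply: eq_bigr => v; rewrite !inE => /and3P[vv1 vv0 _]; rewrite load_cons load_upd//.
  have -> : inc v e = false => //.
  (* A third face on the gap [e] would contradict [inc_le2]. *)
  apply/negbTE/negP => ve; have := inc_le2 e; rewrite leqNgt => /negP; apply.
  have u : uniq [:: v0; v1; v].
    by rewrite /= !inE negb_or eq_sym v10 eq_sym vv0 eq_sym vv1.
  have /= <- := card_uniqP u; apply/subset_leq_card/fintype.subsetP => w.
  by rewrite !inE => /or3P[] /eqP ->.
rewrite (big_setD1 v0)//= load0 (big_setD1 v1)//= PE load_cons v1e {1}/upd eqxx load_upd//.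
by rewrite /c; ring.
Qed.

Corollary isum_prod_Qpi s (r : R) : uniq s -> elim_order s -> Qpi r -> 0 <= r ->
  exists2 q : R, Qpi q &
  isum s (fun g => (r * \prod_v wcoef (fun=> 1) (load v g s))%:E) = q%:E.
Proof.
move=> us os Qr r0; have [q Qq hq] := @isum_Qpi s [set: V]%SET (fun=> fun=> 1) r us os
  (fun=> @weight1 R) (fun v e => ltac:(by rewrite inE)) Qr r0.
exists q => //; rewrite -hq; apply: eq_isum => g; congr (_ * _)%:E.
by apply: eq_bigl => v; rewrite inE.
Qed.

Hypothesis odd_inc : forall C : {set J}, (0 < #|C|)%N ->
  exists v, odd #|[set e in C | inc v e]%SET|.

(** The boundary of a set of edges over the field with two elements, additive for the symmetric
    difference [symd]; [odd_inc] says that its kernel is trivial. *)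
Let par (C : {set J}) : {set V} := [set v | odd #|[set e in C | inc v e]%SET|]%SET.

Let symd (C D : {set J}) : {set J} := [set e | (e \in C) (+) (e \in D)]%SET.

Let par_symd C D : par (symd C D) = [set v | (v \in par C) (+) (v \in par D)]%SET.
Proof.
apply/setP => v; rewrite !inE.
pose X (E : {set J}) := [set e in E | inc v e]%SET; rewrite -/(X C) -/(X D) -/(X (symd C D)).
have cX (E : {set J}) : #|X E| = (#|X E :&: X C|%SET + #|X E :\: X C|%SET)%N by rewrite cardsID.
rewrite (cX (symd C D)) (cX D).
have -> : (X (symd C D) :\: X C = X D :\: X C)%SET.
  apply/setP => e; rewrite !inE; case: (e \in C); case: (e \in D); case: (inc v e) => //.
have -> : #|X C| = (#|X (symd C D) :&: X C|%SET + #|X D :&: X C|%SET)%N.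
  rewrite -(cardsID (X D) (X C)) addnC finset.setIC; congr (_ + _)%N.
  by apply/eq_card => e; rewrite !inE; case: (e \in C); case: (e \in D); case: (inc v e).
by rewrite !oddD; case: (odd _); case: (odd _); case: (odd _).
Qed.

Let par_inj C D : par C = par D -> C = D.
Proof.
move=> CD; have : par (symd C D) = finset.set0.
  by rewrite par_symd CD; apply/setP => v; rewrite !inE addbb.
move=> p0; have [c0|] := posnP #|symd C D|; last first.
  by move=> /odd_inc[v]; have := finset.in_set0 v; rewrite -p0 inE => ->.
apply/setP => e; have : e \notin symd C D by rewrite (cards0_eq c0) inE.
by rewrite inE negb_add => /eqP.
Qed.

(** The boundary map is injective on subsets of [E], so [E] meets at least [#|E|] vertices. Without
    a leaf each of these has degree at least 2, while the degrees add up to at most [2 #|E|]; hence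
    all equal 2 and [E] has empty boundary, against [odd_inc]. *)
Lemma leaf_exists (E : {set J}) : (0 < #|E|)%N ->
  exists v, #|[set e in E | inc v e]%SET| == 1%N.
Proof.
move=> E0; apply/existsP; apply: contraT; rewrite negb_exists => /forallP noleaf.
pose cnt v := #|[set e in E | inc v e]%SET|.
(* This local [Imono] is the set of vertices met by [E], unrelated to the integral of the same
   name. *)
pose Imono := [set v | (0 < cnt v)%N]%SET.
have h1 : (#|E| <= #|Imono|)%N.
  rewrite -(@leq_exp2l 2)// -!card_powerset -(card_in_imset (in2W par_inj)).
  apply/subset_leq_card/fintype.subsetP => X /imsetP[C]; rewrite !powersetE => CE ->.
  apply/fintype.subsetP => v; rewrite !inE => ov.
  have : (0 < #|[set e in C | inc v e]%SET|)%N by case: #|_| ov.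
  move/leq_trans; apply; apply/subset_leq_card/fintype.subsetP => e; rewrite !inE.
  by move=> /andP[/(fintype.subsetP CE) -> ->].
have h2 : (\sum_v cnt v <= #|E|.*2)%N.
  have -> : (\sum_v cnt v = \sum_(e in E) #|[set v | inc v e]%SET|)%N.
    under eq_bigr do rewrite /cnt -sum1dep_card.
    under [RHS]eq_bigr do rewrite -sum1dep_card.
    rewrite (exchange_big_dep (mem E)) /=; last by move=> ? ? _ /andP[].
    by apply: eq_bigr => e eE; apply: eq_bigl => v; rewrite eE.
  by rewrite -muln2 -sum_nat_const; apply: leq_sum => e _.
have h3 : (\sum_v cnt v = \sum_(v in Imono) cnt v)%N.
  rewrite (bigID (mem Imono)) /= [X in (_ + X)%N]big1 ?addn0// => v.
  by rewrite inE -eqn0Ngt => /eqP.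
have c2 v : v \in Imono -> (2 <= cnt v)%N.
  by rewrite inE => v0; rewrite ltn_neqAle v0 eq_sym (noleaf v).
have h4 : (\sum_(v in Imono) 2 <= \sum_(v in Imono) cnt v)%N by exact: leq_sum.
rewrite sum_nat_const muln2 in h4.
have WE : #|Imono| = #|E|.
  by apply/eqP; rewrite eqn_leq h1 -leq_double (leq_trans h4)// -h3.
have all2 v : v \in Imono -> cnt v = 2.
  move=> vW; apply/eqP; rewrite eqn_leq c2// andbT.
  have := h2; rewrite h3 (big_setD1 v)//= -WE => h5.
  have h6 : ((#|Imono|.-1).*2 <= \sum_(w in Imono :\ v) cnt w)%N.
    rewrite -muln2 (_ : #|Imono|.-1 = #|Imono :\ v|)%SET; last by rewrite (cardsD1 v Imono) vW.
    by rewrite -sum_nat_const; apply: leq_sum => w; rewrite !inE => /andP[_ h]; apply: c2; rewrite inE.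
  have W0 : (0 < #|Imono|)%N by rewrite WE.
  by move: h5 h6 W0; move: (\sum_(w in _) _)%N => S; lia.
have [v] := odd_inc E0; rewrite -/(cnt v); have [vW|] := boolP (v \in Imono).
  by rewrite all2.
by rewrite inE -eqn0Ngt => /eqP ->.
Qed.

Lemma elim_order_exists : exists s, [/\ uniq s, s =i [set: J]%SET & elim_order s].
Proof.
suff h n (E : {set J}) : #|E| = n -> exists s, [/\ uniq s, s =i E & elim_order s].
  exact: (h _ _ erefl).
elim: n E => [|n IH] E En.
  by exists [::]; split=> // j; rewrite (cards0_eq En) !inE.
have [v /cards1P[e Ee]] : exists v, #|[set e in E | inc v e]%SET| == 1%N.
  by apply: leaf_exists; rewrite En.
have : e \in [set e in E | inc v e]%SET by rewrite Ee !inE.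
rewrite inE => /andP[eE ve].
have [s [us sE os]] : exists s, [/\ uniq s, s =i (E :\ e)%SET & elim_order s].
  by apply: IH; move: En; rewrite (cardsD1 e) eE add1n => -[].
exists (e :: s); split.
- by rewrite /= us sE !inE eqxx.
- by move=> j; rewrite inE sE !inE; case: eqVneq => // ->.
- split=> //; exists v => // e'; rewrite sE !inE => /andP[e'e e'E].
  apply/negP => ve'; have : e' \in [set e in E | inc v e]%SET by rewrite inE e'E.
  by rewrite Ee inE (negbTE e'e).
Qed.

End LeafElimination.

(** * Faces of a meander *)

Section Faces.
Variables (n : nat) (m : 'I_n -> 'I_n).
Hypothesis hm : noncrossing_perfect_matching m.

(* Gap [j] lies between the points [j] and [j + 1]; the face under the arc
   opened by [i] contains it iff this arc is the innermost one above the gap. *)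
Definition inface (i : 'I_n) (j : nat) : bool :=
  [&& (i <= j)%N, (j < m i)%N &
      [forall i' : 'I_n, ~~ [&& (i < i')%N, (i' <= j)%N & (j < m i')%N]]].

Lemma matchK i : m (m i) = i. Proof. by have [h _ _] := hm; exact: h. Qed.

Lemma match_neq i : (m i : nat) != i.
Proof. by have [_ h _] := hm; exact: h. Qed.

Lemma match_nocross (i j : 'I_n) : (i < j)%N -> (j < m i)%N -> (m j <= m i)%N.
Proof.
move=> ij jmi; have [_ _ h] := hm; have := h i j.
by rewrite !ltEord ij jmi /= -leqNgt.
Qed.

Lemma inface_uniq i1 i2 j : inface i1 j -> inface i2 j -> i1 = i2.
Proof.
wlog lt12 : i1 i2 / (i1 < i2)%N => [wl|].
  move=> h1 h2; have [lt|lt|/val_inj//] := ltngtP i1 i2; first exact: wl.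
  by apply/esym/wl.
move=> /and3P[_ _ /forallP/(_ i2)] + /and3P[h1 h2 _].
by rewrite lt12 h1 h2.
Qed.

Lemma inface_exists (i : 'I_n) (j : nat) : (i <= j)%N -> (j < m i)%N ->
  exists2 i' : 'I_n, (i <= i')%N & inface i' j.
Proof.
move=> ij jmi.
pose P := [pred i' : 'I_n | (i' <= j)%N && (j < m i')%N].
have Pi : P i by rewrite inE ij.
case: (@arg_maxnP _ i P (fun i' => i' : nat) Pi) => i' /andP[h1 h2] h3.
exists i'; first exact: h3.
rewrite /inface h1 h2; apply/forallP => k; apply/negP => /and3P[k1 k2 k3].
by have := h3 k; rewrite inE k2 k3 => /(_ isT); rewrite /geq /= leqNgt k1.
Qed.

Lemma inface_nested (i i' : 'I_n) (j : nat) : (i <= i')%N -> (i' < m i)%N ->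
  inface i' j -> (i <= j)%N && (j < m i)%N.
Proof.
move=> ii' i'm /and3P[h1 h2 _]; rewrite (leq_trans ii' h1) (leq_trans h2)//.
move: ii'; rewrite leq_eqVlt => /predU1P[/val_inj <-//|lt].
exact: match_nocross.
Qed.

Variable C : {set 'I_n.-1}.
Hypothesis Ceven : forall i, ~~ odd #|[set e in C | inface i e]%SET|.

(** The gaps under an arc are partitioned among the faces of that arc and of the arcs nested in it,
    each of which meets [C] evenly. *)
Lemma arc_parity (i : 'I_n) : odd #|[set e in C | (e < i)%N]%SET| =
  odd #|[set e in C | (e < m i)%N]%SET|.
Proof.
wlog im : i / (i < m i)%N => [wl|].
  have := match_neq i; rewrite neq_ltn => /orP[h|]; last exact: wl.
  by apply/esym; rewrite -{2}(matchK i); apply: wl; rewrite matchK.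
pose X := [set e in C | (i <= e)%N && (e < m i)%N]%SET.
have -> : #|[set e in C | (e < m i)%N]%SET| =
    (#|[set e in C | (e < i)%N]%SET| + #|X|)%N.
  rewrite -(cardsID [set e : 'I_n.-1 | (e < i)%N]%SET [set e in C | (e < m i)%N]%SET).
  congr (_ + _)%N; apply: eq_card => e; rewrite !inE.
    by case: (e \in C) => //=; case: (ltnP e i) => h; rewrite ?andbF// (ltn_trans h).
  by rewrite -leqNgt; case: (e \in C); rewrite ?andbF//=; rewrite andbT andbC.
suff : ~~ odd #|X| by rewrite oddD => /negbTE ->; rewrite addbF.
(* Indices [i'] that close an arc have an empty face and contribute 0. *)
have -> : #|X| = (\sum_(i' : 'I_n | (i <= i' < m i)%N) #|[set e in C | inface i' e]%SET|)%N.
  under [RHS]eq_bigr do rewrite -sum1dep_card.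
  rewrite -sum1_card (exchange_big_dep (mem X)) /=; last first.
    move=> i' e /andP[h1 h2] /andP[eC fe]; rewrite !inE eC.
    exact: (inface_nested h1 h2 fe).
  apply: eq_bigr => e; rewrite inE => /and3P[eC ie em].
  have [i' ii' fe] := inface_exists ie em.
  rewrite (big_pred1 i')// => k /=; rewrite eC /=; apply/andP/eqP.
    by move=> [_ fk]; exact: inface_uniq fk fe.
  move=> ->; split=> //; rewrite ii'/=.
  by move/and3P: fe => [h _ _]; exact: leq_ltn_trans em.
by elim/big_ind: _ => // p q; rewrite oddD => /negbTE -> /negbTE ->.
Qed.

End Faces.

Section MeanderForest.
Variables (k : nat) (M : meander k).

Definition gap_inc (v : 'I_k.*2 + 'I_k.*2) (j : 'I_k.*2.-1) : bool :=
  match v with inl i => inface (upper M) i j | inr i => inface (lower M) i j end.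

Lemma gap_inc_le2 j : (#|[set v | gap_inc v j]%SET| <= 2)%N.
Proof.
rewrite -sum1dep_card big_sumType /= (_ : 2 = 1 + 1)%N// leq_add//.
  rewrite sum1dep_card; apply/card_le1_eqP => i1 i2; rewrite !inE => h1 h2.
  exact: inface_uniq h2 h1.
rewrite sum1dep_card; apply/card_le1_eqP => i1 i2; rewrite !inE => h1 h2.
exact: inface_uniq h2 h1.
Qed.

Lemma gap_odd_inc (C : {set 'I_k.*2.-1}) : (0 < #|C|)%N ->
  exists v, odd #|[set e in C | gap_inc v e]%SET|.
Proof.
move=> /card_gt0P[e0 e0C]; apply/existsP; apply: contraT.
rewrite negb_exists => /forallP ev.
pose c (p : 'I_k.*2) := odd #|[set e in C | (e < p)%N]%SET|.
have cu p : c p = c (upper M p).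
  by apply: arc_parity => [|i]; [exact: upper_matching|exact: (ev (inl i))].
have cl p : c p = c (lower M p).
  by apply: arc_parity => [|i]; [exact: lower_matching|exact: (ev (inr i))].
have cc p q : c p = c q.
  have : component (upper M) (lower M) p q by rewrite single_loop.
  move=> [s]; elim: s p => [|x s IH] p /=; first by move=> _ ->.
  move=> /andP[px xs] sq; rewrite -(IH x xs sq).
  by case/orP: px => /eqP ->.
(* The points on both sides of the gap [e0]: as [e0] lies in [C], their counts differ by one. *)
have e2 : (e0.+1 < k.*2)%N by rewrite -ltn_predRL.
have e1 : (e0 < k.*2)%N := ltnW e2.
have := cc (Ordinal e1) (Ordinal e2); rewrite /c /=.
have -> : [set e in C | (e < e0.+1)%N]%SET = (e0 |: [set e in C | (e < e0)%N])%SET.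
  apply/setP => e; rewrite !inE ltnS leq_eqVlt andb_orr; congr (_ || _).
  by apply/andP/eqP => [[_ /eqP/val_inj]|->].
rewrite cardsU1 !inE ltnn andbF /=.
by case: (odd _).
Qed.

Lemma meander_sum_Qpi (R : realType) (r : R) : Qpi r -> 0 <= r ->
  exists s : seq 'I_k.*2.-1, [/\ uniq s, forall j, j \in s & exists2 q : R, Qpi q &
    isum s (fun g => (r * \prod_v wcoef (fun=> 1) (load gap_inc v g s))%:E) = q%:E].
Proof.
move=> Qr r0; have [s [us sE os]] := elim_order_exists gap_inc_le2 gap_odd_inc.
exists s; split=> //; first by move=> j; rewrite sE inE.
exact: (isum_prod_Qpi gap_inc_le2 us os Qr r0).
Qed.

End MeanderForest.

(** * Balanced words and arrow matchings *)

(* Dyck words starting at height [h] and ending at height 0. *)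
Fixpoint bal (h : nat) (w : seq bool) : bool :=
  if w is b :: w' then
    if b then bal h.+1 w' else if h is h'.+1 then bal h' w' else false
  else h == 0%N.

Lemma bal_cat h k d w : bal k d -> bal (h + k) (d ++ w) = bal h w.
Proof.
elim: d k => [|[] d IH] k /=; first by move/eqP->; rewrite addn0.
  by move/IH; rewrite addnS.
by case: k => // k /IH; rewrite addnS.
Qed.

Lemma bal0_cat h d w : bal 0 d -> bal h (d ++ w) = bal h w.
Proof. by move/(bal_cat h w); rewrite addn0. Qed.

Lemma bal_block h d w : bal 0 d -> bal h (true :: d ++ false :: w) = bal h w.
Proof. by move=> bd /=; rewrite bal0_cat. Qed.

Lemma bal_prefix w u v : (forall h, bal h u = bal h v) ->
  forall h, bal h (w ++ u) = bal h (w ++ v).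
Proof. by move=> uv; elim: w => [|[] w IH] [|h] //=; rewrite ?IH. Qed.

Local Notation ups w := (count id w).
Local Notation downs w := (count negb w).

Lemma bal_count h w : bal h w -> (h + ups w = downs w)%N.
Proof.
elim: w h => [|[] w IH] h /=; first by move/eqP->.
  by move/IH <-; lia.
by case: h => // h /IH <-; lia.
Qed.

Lemma bal_count_prefix h u v : bal h (u ++ v) -> (downs u <= h + ups u)%N.
Proof.
elim: u h => [|[] u IH] h //=; first by move/IH; lia.
by case: h => // h /IH; lia.
Qed.

Lemma bal_count_suffix u v : bal 0 (u ++ v) -> (ups v <= downs v)%N.
Proof.
move=> b; have := bal_count b; have := bal_count_prefix b.
by rewrite !count_cat; lia.
Qed.

Section IntegerMatching.
Variable dir : int -> bool.
Implicit Types (x y : int) (n : nat).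

Definition wd x n : seq bool := [seq dir (x + (j : nat)%:Z) | j <- iota 0 n].

Lemma size_wd x n : size (wd x n) = n. Proof. by rewrite size_map size_iota. Qed.

Lemma wdS x n : wd x n.+1 = dir x :: wd (x + 1) n.
Proof.
rewrite /wd /= addr0; congr (_ :: _); rewrite -[1%N]addn0 iotaDl -map_comp.
by apply: eq_map => j /=; rewrite PoszD addrA.
Qed.

Lemma wdD x n1 n2 : wd x (n1 + n2) = wd x n1 ++ wd (x + n1%:Z) n2.
Proof.
elim: n1 x => [|n IH] x; first by rewrite addr0.
by rewrite addSn !wdS IH /= -addrA -PoszD add1n.
Qed.

(** The arc from [x] to [x + 1 + n], read off from [n + 2] arrows; a whole matching is not a
    condition on finitely many bits. *)
Definition Mtn x n := [&& dir x, bal 0 (wd (x + 1) n) & ~~ dir (x + 1 + n%:Z)].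

Lemma Mtn_uniq_r x n1 n2 : Mtn x n1 -> Mtn x n2 -> n1 = n2.
Proof.
wlog lt : n1 n2 / (n1 < n2)%N => [wl|].
  by move=> h1 h2; case: (ltngtP n1 n2) => // h; [exact: wl|exact/esym/wl].
move=> /and3P[_ b1 d1] /and3P[_ + _].
have -> : n2 = (n1 + (n2 - n1.+1).+1)%N by lia.
by rewrite wdD bal0_cat// wdS (negbTE d1).
Qed.

(** The shorter word preceded by its opening arrow would be a suffix of the longer one with more up
    steps than down steps, which a Dyck word does not have. *)
Lemma Mtn_uniq_l x1 x2 n1 n2 : Mtn x1 n1 -> Mtn x2 n2 ->
  x1 + 1 + n1%:Z = x2 + 1 + n2%:Z -> n1 = n2.
Proof.
wlog lt : x1 x2 n1 n2 / (n1 < n2)%N => [wl|].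
  move=> h1 h2 e; case: (ltngtP n1 n2) => // h; first exact: wl h1 h2 e.
  exact/esym/(wl _ _ _ _ h h2 h1 (esym e)).
move=> /and3P[d1 b1 _] /and3P[_ + _] e.
have En : n2 = ((n2 - n1.+1) + n1.+1)%N by lia.
rewrite [in wd _ _]En wdD wdS.
have -> : x2 + 1 + (n2 - n1.+1)%N%:Z = x1 by lia.
rewrite d1 => b; have := bal_count_suffix b.
by rewrite /=; have := bal_count b1; lia.
Qed.

(* Two arcs cannot cross: the overlap would be both a suffix of a Dyck word
   following an up step and a prefix of a Dyck word. *)
Lemma Mtn_nocross x y n1 n2 : Mtn x n1 -> Mtn y n2 -> x < y -> y < x + 1 + n1%:Z ->
  x + 1 + n1%:Z < y + 1 + n2%:Z -> False.
Proof.
move=> /and3P[d1 b1 _] /and3P[d2 b2 _] xy yx xyn.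
pose a := (absz (y - x - 1)%R).
pose c := (absz (x + n1%:Z - y)%R).
have En1 : n1 = (a + c.+1)%N by rewrite /a /c; lia.
have En2 : n2 = (c + (n2 - c))%N by rewrite /c; lia.
move: b1 b2; rewrite En1 wdD wdS.
have -> : x + 1 + a%:Z = y by rewrite /a; lia.
rewrite d2 => b1; rewrite En2 wdD => b2.
have := bal_count_suffix b1; have := bal_count_prefix b2 => /=.
lia.
Qed.

Definition matched x := exists n, Mtn x n \/ Mtn (x - 1 - n%:Z) n.

(** An interval stable under [m] carries a balanced word, by strong induction on its length: the
    partner of its first point separates two shorter stable intervals. Non-crossing makes the inside
    of an arc stable. *)
Lemma arrow_matching_Mtn (m : int -> int) x : arrow_matching dir m -> x < m x ->
  Mtn x (absz (m x - x - 1)%R).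
Proof.
move=> [[mK mneq mcross] mdir].
have ncross i j : i < j -> j < m i -> m j <= m i.
  by move=> ij jm; rewrite leNgt; apply/negP => h; have := mcross i j; rewrite ij jm h.
have inside a y : a < m a -> a < y -> y < m a -> a < m y < m a.
  move=> am ay ym; have h1 := ncross _ _ ay ym.
  have h2 : m y != m a.
    by apply/eqP => /(congr1 m); rewrite !mK => ya; rewrite ya ltxx in ay.
  have h3 : m y != a.
    by apply/eqP => e; have := ym; rewrite -e mK ltxx.
  apply/andP; split; last by rewrite lt_neqAle h2.
  rewrite lt_neqAle eq_sym h3 /= leNgt; apply/negP => h4.
  by have := ncross _ _ h4; rewrite mK ay => /(_ isT); rewrite leNgt ym.
have closed_bal n a : (forall y, a <= y -> y < a + n%:Z -> a <= m y /\ m y < a + n%:Z) ->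
    bal 0 (wd a n).
  elim/ltn_ind: n a => -[//|n] IH a cl.
  have [am1 am2] := cl a (lexx _) ltac:(lia).
  have am : a < m a by rewrite lt_neqAle eq_sym mneq.
  pose n1 := (absz (m a - a - 1)%R); pose n2 := (absz (a + n%:Z - m a)%R).
  have En : n = (n1 + n2.+1)%N by rewrite /n1 /n2; lia.
  rewrite wdS mdir am En wdD wdS.
  have Ema : a + 1 + n1%:Z = m a by rewrite /n1; lia.
  rewrite Ema mdir mK [m a < a]ltNge am1 /=.
  rewrite (bal0_cat 1); last first.
    apply: IH => [|y y1 y2]; first by lia.
    by have /andP := inside a y am ltac:(lia) ltac:(lia); lia.
  apply: IH => [|y y1 y2]; first by lia.
  have [c1 c2] := cl y ltac:(lia) ltac:(lia); split; last by lia.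
  have [//|lt] := leP (m a + 1) (m y).
  have [e|ne] := eqVneq (m y) (m a).
    by move/(congr1 m): e; rewrite !mK; lia.
  have [e|ne'] := eqVneq (m y) a.
    by move/(congr1 m): e; rewrite !mK; lia.
  have h : a < m y /\ m y < m a by lia.
  by have := inside a (m y) am h.1 h.2; rewrite mK; lia.
move=> xm; rewrite /Mtn mdir xm /=.
have -> : x + 1 + (absz (m x - x - 1)%R)%:Z = m x by lia.
rewrite mdir mK -leNgt (ltW xm) andbT; apply: closed_bal => y y1 y2.
have /andP := inside x y xm ltac:(lia) ltac:(lia); lia.
Qed.

Lemma arrow_matching_matched (m : int -> int) x : arrow_matching dir m -> matched x.
Proof.
move=> am; have [[mK mneq _] _] := am; have := mneq x; rewrite neq_lt => /orP[mx|xm].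
  have := @arrow_matching_Mtn m (m x) am; rewrite mK mx => /(_ isT) h.
  exists (absz (x - m x - 1)%R); right; move: h; congr Mtn.
  by lia.
by exists (absz (m x - x - 1)%R); left; exact: arrow_matching_Mtn.
Qed.

Lemma Mtn_arrow_matching (m : int -> int) x n : arrow_matching dir m ->
  Mtn x n -> m x = x + 1 + n%:Z.
Proof.
move=> am h; have [_ mdir] := am; have /and3P[dx _ _] := h.
have xm : x < m x by rewrite -mdir.
by rewrite (Mtn_uniq_r h (arrow_matching_Mtn am xm)); lia.
Qed.

(** The lengths chosen at the two ends of an arc agree by uniqueness, so the local choices form an
    involution, which [Mtn_nocross] shows to be non-crossing. *)
Lemma arrow_matching_exists : (forall x, matched x) ->
  exists m, arrow_matching dir m.
Proof.
move=> /choice[f fP].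
pose m x := if dir x then x + 1 + (f x)%:Z else x - 1 - (f x)%:Z.
have mt x : dir x -> Mtn x (f x).
  by move=> dx; case: (fP x) => // /and3P[_ _]; rewrite (_ : _ + _ = x) ?dx//; lia.
have mf x : ~~ dir x -> Mtn (m x) (f x).
  by move=> dx; rewrite /m (negbTE dx); case: (fP x) => // /and3P[]; rewrite (negbTE dx).
have dm x : dir (m x) = ~~ dir x.
  have [dx|dx] := boolP (dir x).
    by rewrite /m dx; have /and3P[_ _ /negbTE] := mt x dx.
  by have /and3P[] := mf x dx.
have mK : involutive m.
  move=> x; have [dx|dx] := boolP (dir x).
    have h1 := mt x dx; have dmx : ~~ dir (m x) by rewrite dm dx.
    have h2 := mf _ dmx; have := Mtn_uniq_l h1 h2; rewrite {1 2}/m (negbTE dmx) [in X in X -> _]/m dx => e.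
    by rewrite {1}/m (negbTE dmx) /m dx -(e ltac:(lia)); lia.
  have h1 := mf x dx; have dmx : dir (m x) by rewrite dm dx.
  have e := Mtn_uniq_r h1 (mt _ dmx).
  by rewrite {1}/m dmx -e /m (negbTE dx); lia.
have mdir x : dir x = (x < m x).
  by rewrite /m; case: (dir x); [apply/esym|apply/esym/negbTE]; lia.
exists m; split=> //; split=> //.
  by move=> x; rewrite /m; case: (dir x); apply/eqP; lia.
move=> x y; apply/negP => /and3P[xy ym mm].
have xm : dir x by rewrite mdir (lt_trans xy).
have dy : dir y by rewrite mdir (lt_trans ym).
have := Mtn_nocross (mt x xm) (mt y dy) xy.
by move: ym mm; rewrite /m xm dy => h1 h2 /(_ h1 h2).
Qed.

End IntegerMatching.

(** * Conditions on arcs and conditions on faces *)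

Section FaceWords.
Variables (n : nat) (m : 'I_n -> 'I_n) (dir : int -> bool).
Variables (p : nat -> int) (G : nat -> nat).
Hypothesis hm : noncrossing_perfect_matching m.
Hypothesis hp : forall j, p j.+1 = p j + 1 + (G j)%:Z.
Implicit Types (i : 'I_n) (a c h : nat).

Definition gapw a := wd dir (p a + 1) (G a).

(** All arrows strictly between [p a] and [p (a + c + 1)]; [facew] keeps only those in the gaps of
    one face. *)
Fixpoint fullw a c : seq bool :=
  if c is c'.+1 then gapw a ++ dir (p a.+1) :: fullw a.+1 c' else gapw a.

Definition facew i a c : seq bool :=
  flatten [seq gapw j | j <- iota a c.+1 & inface m i j].

Lemma fullwE a c : fullw a c = wd dir (p a + 1) (size (fullw a c)) /\
  p (a + c).+1 = p a + 1 + (size (fullw a c))%:Z.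
Proof.
elim: c a => [|c IH] a /=; first by rewrite /gapw size_wd addn0 hp.
have [e1 e2] := IH a.+1; rewrite size_cat /= size_wd; split.
  rewrite wdD wdS /gapw hp; congr (_ ++ _ :: _).
  by rewrite [LHS]e1 hp; congr wd; lia.
by rewrite addnS -addSn e2 hp; lia.
Qed.

Lemma fullw_cat a c1 c2 : fullw a (c1 + c2.+1) =
  fullw a c1 ++ dir (p (a + c1).+1) :: fullw (a + c1).+1 c2.
Proof.
elim: c1 a => [|c1 IH] a /=; first by rewrite addn0.
by rewrite IH -catA /= addSnnS.
Qed.

Lemma facew_cat i a c1 c2 : facew i a (c1 + c2.+1) = facew i a c1 ++ facew i (a + c1).+1 c2.
Proof.
rewrite /facew -[(c1 + c2.+1).+1]addSn iotaD filter_cat map_cat flatten_cat.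
by rewrite addnS.
Qed.

Definition arc_ok i :=
  [&& dir (p i), bal 0 (fullw i (m i - i).-1) & ~~ dir (p (m i))].

Definition face_ok i :=
  [&& dir (p i), bal 0 (facew i i (m i - i).-1) & ~~ dir (p (m i))].

(** If [x] closed an arc, one opened after [i] would cover the gap more closely, one opened before
    [i] would cross, and the arc of [i] ends later. So [x] opens an arc, and past its end the face
    of [i] continues. *)
Lemma inface_next i a : inface m i a -> forall x : 'I_n, (x : nat) = a.+1 -> (x < m i)%N ->
  (x < m x < m i)%N /\ inface m i (m x).
Proof.
move=> /and3P[ia am /forallP fa] x xa xm.
have ix : (i < x)%N by rewrite xa ltnS.
have nc := match_nocross hm.
have mx_mi : (m x < m i)%N.
  rewrite ltn_neqAle nc// andbT; apply/eqP => /val_inj /(congr1 m).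
  by rewrite !(matchK hm) => xi; rewrite xi ltnn in ix.
have xmx : (x < m x)%N.
  rewrite ltn_neqAle eq_sym (match_neq hm) /= leqNgt; apply/negP => mxx.
  have mxa : (m x <= a)%N by rewrite -ltnS -xa.
  have [lt|] := ltnP i (m x).
    by have := fa (m x); rewrite lt mxa (matchK hm) xa ltnSn.
  rewrite leq_eqVlt => /predU1P[/val_inj e|lt].
    by move: xm; rewrite -e (matchK hm) ltnn.
  by have := nc (m x) i lt; rewrite (matchK hm) ix leqNgt xm => /(_ isT).
split; first by rewrite xmx.
rewrite /inface mx_mi (ltnW (ltn_trans ix xmx)) /=; apply/forallP => k.
apply/negP => /and3P[ik kmx mxk].
have [lt|lt|/val_inj e] := ltngtP k x.
- have ka : (k <= a)%N by rewrite -ltnS -xa.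
  have := fa k; rewrite ik ka /= -leqNgt => mka.
  by move: mxk mka xmx; rewrite xa; lia.
- move: kmx; rewrite leq_eqVlt => /predU1P[/val_inj e|kmx].
    by move: mxk; rewrite e (matchK hm) ltnNge (ltnW xmx).
  by have := nc x k lt kmx; rewrite leqNgt mxk.
- by move: mxk; rewrite e ltnn.
Qed.

(** An inner arc with its contents is a balanced block, whose deletion does not affect balance. The
    starting height is arbitrary because blocks are deleted in the middle of a word. *)
Lemma facew_balance i : (forall i', (i < i')%N -> (i' < m i)%N -> (i' < m i')%N -> arc_ok i') ->
  forall c a h, (i <= a)%N -> (a + c).+1 = m i -> inface m i a ->
  bal h (fullw a c) = bal h (facew i a c).
Proof.
move=> ok; elim/ltn_ind => -[|c] IH a h ia ac fa.
  by rewrite /facew /= fa /= cats0.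
have xn : (a.+1 < n)%N by have := ltn_ord (m i); rewrite -ac; lia.
pose x := Ordinal xn.
have xm : (x < m i)%N by rewrite -ac /=; lia.
have [/andP[xmx mxm] fmx] := inface_next fa (erefl : (x : nat) = a.+1) xm.
have ix : (i < x)%N by rewrite /= ltnS.
have /and3P[dx bx dmx] := ok x ix xm xmx.
pose c1 := (m x - x).-1; pose c2 := (m i - m x).-1.
have xc1 : (x + c1).+1 = m x by rewrite /c1; lia.
have mc2 : (m x + c2).+1 = m i by rewrite /c2; lia.
have cE : c = (c1 + c2.+1)%N by move: xc1 mc2 ac => /=; lia.
have face1 : facew i a c.+1 = gapw a ++ facew i x c by rewrite /facew /= fa.
(* Over the gaps under the arc of [x], the arc of [i] is not innermost. *)
have face2 : facew i x c1 = [::].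
  rewrite /facew (_ : [seq j <- _ | _] = [::])//; apply/eqP; rewrite -[_ == _]negbK -has_filter.
  apply/hasPn => j; rewrite mem_iota => /andP[xj]; rewrite addnS xc1 => jm.
  by apply/negP => /and3P[_ _ /forallP/(_ x)]; rewrite ix xj jm.
rewrite face1 /=; apply: bal_prefix => {}h; rewrite cE facew_cat face2 cat0s.
have -> : fullw a.+1 (c1 + c2.+1) = fullw x c1 ++ dir (p (x + c1).+1) :: fullw (x + c1).+1 c2.
  exact: fullw_cat.
rewrite xc1 (negbTE dmx) -[p a.+1]/(p x) dx bal_block//.
by apply: IH => //; [rewrite cE; lia|rewrite (leq_trans (ltnW ix))// ltnW].
Qed.

(** From faces to arcs the induction is on the length of the arc: nested arcs are shorter, hence
    already known to be balanced blocks. *)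
Lemma arcs_faces : (forall i, (i < m i)%N -> arc_ok i) <-> (forall i, (i < m i)%N -> face_ok i).
Proof.
have fi i : (i < m i)%N -> inface m i i.
  by move=> im; rewrite /inface leqnn im; apply/forallP => k; case: ltnP => //= h; rewrite leqNgt h.
have e i : (i < m i)%N -> (i + (m i - i).-1).+1 = m i by lia.
split=> [ok i im|].
  have /and3P[d1 b d2] := ok i im; rewrite /face_ok d1 d2 andbT /=.
  by rewrite -(facew_balance (i := i) _ 0 (leqnn i) (e i im) (fi i im)) => // *; exact: ok.
move=> ok; suff h N i : (m i - i < N)%N -> (i < m i)%N -> arc_ok i.
  by move=> i; exact: (h _ i (ltnSn _)).
elim: N i => // N IH i; rewrite ltnS => iN im.
have /and3P[d1 b d2] := ok i im; rewrite /arc_ok d1 d2 andbT /=.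
rewrite (facew_balance (i := i) _ 0 (leqnn i) (e i im) (fi i im))//.
move=> i' ii' i'm i'm'; apply: IH => //.
by have := match_nocross hm ii' i'm; lia.
Qed.

Lemma arc_okE i : (i < m i)%N ->
  reflect (exists2 N, Mtn dir (p i) N & p i + 1 + N%:Z = p (m i)) (arc_ok i).
Proof.
move=> im; have [e1 e2] := fullwE i (m i - i).-1.
have e : (i + (m i - i).-1).+1 = m i by lia.
rewrite e in e2; apply: (iffP and3P) => [[h1 h2 h3]|[N /and3P[h1 h2 h3] eN]].
  exists (size (fullw i (m i - i).-1)); last by rewrite e2.
  by apply/and3P; split=> //; [rewrite -e1|rewrite -e2].
have EN : N = size (fullw i (m i - i).-1) by move: eN; rewrite e2; lia.
by split=> //; [rewrite e1 -EN|rewrite -eN].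
Qed.

End FaceWords.

(** * Probabilities in the noodle *)

Section DyckWeight.
Variable R : realType.

(* Probability that a uniformly random word of length [n] satisfies [Q]. *)
Fixpoint wt (n : nat) (Q : seq bool -> bool) : R :=
  if n is n'.+1 then
    2^-1 * (wt n' (fun w => Q (true :: w)) + wt n' (fun w => Q (false :: w)))
  else (Q [::])%:R.

Lemma wt_false n : wt n (fun=> false) = 0.
Proof. by elim: n => //= n ->; rewrite addr0 mulr0. Qed.

Lemma wt_balS0 n : wt n.+1 (bal 0) = 2^-1 * wt n (bal 1).
Proof. by rewrite /= wt_false addr0. Qed.

Lemma wt_balSS n h : wt n.+1 (bal h.+1) = 2^-1 * (wt n (bal h.+2) + wt n (bal h)).
Proof. by []. Qed.

Lemma wt_bal_lt n h : (n < h)%N -> wt n (bal h) = 0.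
Proof.
elim: n h => [|n IH] [|h] //= nh.
by rewrite !IH ?addr0 ?mulr0//; lia.
Qed.

Lemma wt_bal_odd n h : odd (n + h) -> wt n (bal h) = 0.
Proof.
by elim: n h => [|n IH] [|h] //= nh; rewrite ?wt_false ?addr0 !IH ?addr0 ?mulr0//; lia.
Qed.

Definition ballot j n : R := 'C(n, j)%:R - (if j is j'.+1 then 'C(n, j')%:R else 0).

(** A word of length [2 j + h] from height [h] to 0 has [j] up steps, and [ballot] is the count
    given by the reflection principle. All heights are treated together since the first step changes
    the height. *)
Lemma wt_bal j h : wt (j.*2 + h) (bal h) * 2 ^+ (j.*2 + h) = ballot j (j.*2 + h).
Proof.
have [n] := ubnP (j.*2 + h)%N; elim: n j h => // n IH [|j] h.
  rewrite add0n ltnS /ballot bin0 subr0; case: h => [|h] hn /=; first by rewrite mulr1.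
  have := IH 0%N h; rewrite add0n /ballot bin0 subr0 => <-//.
  by rewrite exprS wt_bal_lt// add0r mulrACA mulVf ?mul1r// pnatr_eq0.
case: h => [|h] lt.
  have -> : (j.+1.*2 + 0 = (j.*2 + 1).+1)%N by lia.
  rewrite wt_balS0 exprS mulrACA mulVf ?pnatr_eq0// mul1r IH; last by lia.
  rewrite /ballot !binS; have -> : 'C(j.*2 + 1, j.+1) = 'C(j.*2 + 1, j).
    by rewrite -bin_sub; [congr 'C(_, _)|]; lia.
  by case: j {lt} => [|j]; rewrite ?bin0 ?binS !natrD; ring.
have -> : (j.+1.*2 + h.+1 = (j.*2 + h.+2).+1)%N by lia.
rewrite wt_balSS exprS mulrACA mulVf ?pnatr_eq0// mul1r mulrDl IH; last by lia.
have e1 : (j.*2 + h.+2 = j.+1.*2 + h)%N by lia.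
rewrite e1 IH; last by lia.
rewrite /ballot !binS.
by case: j {lt e1} => [|j]; rewrite ?bin0 ?binS !natrD; ring.
Qed.

Lemma ballot_catalan j : j.+1%:R * ballot j j.*2 = 'C(j.*2, j)%:R.
Proof.
rewrite /ballot; case: j => [|j]; first by rewrite subr0 mul1r.
have := mul_bin_left j.+1.*2 j; rewrite (_ : j.+1.*2 - j = j.+2)%N; last by lia.
by move=> /(congr1 (fun n => n%:R : R)); rewrite !natrM mulrBr => <-; rewrite -mulrBl -natr1; ring.
Qed.

(** The Catalan numbers coming from [ballot] satisfy the recurrence [wcoef1_rec], with the same
    initial value. *)
Lemma wt_bal0 n : wt n (bal 0) = wcoef (fun=> 1) n.
Proof.
have [on|en] := boolP (odd n); first by rewrite wt_bal_odd ?addn0// /wcoef on.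
rewrite -(even_halfK en); elim: (n./2) => {n en}[|j IH]; first by rewrite wcoef1_0.
have h2 : (j.*2 + 4)%:R != 0 :> R by rewrite pnatr_eq0 addnS.
apply: (mulfI h2); rewrite doubleS wcoef1_rec -IH.
have := wt_bal j.+1 0; have := wt_bal j 0; rewrite !addn0 doubleS => w1 w2.
have := ballot_catalan j; have := ballot_catalan j.+1; rewrite doubleS -w1 -w2 => b2 b1.
have : (j.+1%:R : R) * 'C(j.*2.+2, j.+1)%:R = (j.*2.+1).*2%:R * 'C(j.*2, j)%:R.
  have e1 := mul_bin_diag j.*2.+1 j; have e2 := mul_bin_down j.*2.+1 j.
  rewrite (_ : j.*2.+1 - j = j.+1)%N /= in e1 e2; last by lia.
  by rewrite -!natrM; congr (_%:R); rewrite binS mulnDr -e1 -e2 addnn doubleMl.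
rewrite -b1 -b2 !exprS.
have j1 : j.+1%:R != 0 :> R by rewrite pnatr_eq0.
have h : (2 : R) ^+ j.*2 != 0 by rewrite expf_neq0.
move: (wt j.*2.+2 _) (wt j.*2 _) => A B e.
apply: (mulfI (mulf_neq0 j1 h)); apply: (@mulfI _ (2 : R)); first by rewrite pnatr_eq0.
have -> : (j.*2 + 4)%:R = 2 * j.+2%:R :> R by rewrite -natrM; congr (_%:R); lia.
rewrite (_ : (j.*2.+1).*2%:R = 2 * (j.*2 + 1)%:R) in e; last by rewrite -natrM; congr (_%:R); lia.
by transitivity (2 * (j.*2 + 1)%:R * (j.+1%:R * (B * 2 ^+ j.*2))); [rewrite -e|]; ring.
Qed.

End DyckWeight.

(** * Words read at disjoint sets of independent bits *)

Section IndependentBits.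
Context {R : realType} {d : measure_display} {T : measurableType d}.
Variables (P : probability T R) (I : eqType) (X : I -> {RV P >-> bool}).
Hypothesis indX : mutually_independent X.
Hypothesis halfX : forall i b, P (X i @^-1` [set b]) = (2^-1)%:E.

Definition bits_event (pre : seq (I * bool)) (l : seq (seq I * (seq bool -> bool))) : set T :=
  [set t | all (fun ib => X ib.1 t == ib.2) pre &&
           all (fun xQ => xQ.2 [seq X i t | i <- xQ.1]) l].

Lemma measurable_bit i b : measurable [set t | X i t == b].
Proof.
rewrite (_ : [set t | _] = X i @^-1` [set b]); first exact: measurable_funPTI.
by apply/seteqP; split => t /= /eqP.
Qed.

Lemma bits_event_nil pre : uniq (unzip1 pre) ->
  measurable (bits_event pre [::]) /\
  P (bits_event pre [::]) = (2^-1 ^+ size pre)%:E.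
Proof.
move=> up; split.
  elim: pre up => [_|[i b] pre IH /andP[_ /IH mpre]].
    by rewrite (_ : bits_event _ _ = setT)//; apply/seteqP; split.
  rewrite (_ : bits_event _ _ = [set t | X i t == b] `&` bits_event pre [::]).
    by apply: measurableI => //; exact: measurable_bit.
  by apply/seteqP; split => t; rewrite /bits_event /= !andbT => /andP.
(* For an index occurring in [pre] this is the singleton of its prescribed value, as each index
   occurs only once. *)
pose A i : set bool := [set b | (i, b) \in pre].
have A1 ib : ib \in pre -> A ib.1 = [set ib.2].
  move=> ibp; apply/seteqP; split => [b|_ ->]; rewrite /A /=; last by case: ib ibp.
  move=> bp; have := @uniqP _ (ib.1) _ up.
  have e1 := nth_index ib ibp; have e2 := nth_index ib bp.
  move=> /(_ (index ib pre) (index (ib.1, b) pre)).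
  rewrite !inE size_map !index_mem ibp bp => /(_ isT isT).
  by rewrite !(nth_map ib) ?index_mem// e1 e2 => /(_ erefl) e; rewrite -e1 e e2.
have -> : bits_event pre [::] = \bigcap_(i in [set` unzip1 pre]) (X i @^-1` A i).
  apply/seteqP; split => t; rewrite /bits_event /= andbT.
    by move=> /allP h i /= /mapP[ib ibp ->]; rewrite A1//; apply/eqP/h.
  move=> h; apply/allP => ib ibp; apply/eqP.
  by have := h ib.1 (map_f _ ibp); rewrite /= A1.
rewrite indX// big_map (eq_big_seq (fun=> (2^-1)%:E)) /=; last by move=> ib ibp; rewrite A1// halfX.
by elim: (pre) => [|ib s IH]; rewrite ?big_nil// big_cons IH -EFinM exprS.
Qed.

(** Splitting on the first letter of the first word moves it, with either value, to the prescribed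
    bits [pre]. This is the recursion of [wt], and in the end only prescribed bits remain. *)
Lemma bits_eventP pre l : uniq (unzip1 pre ++ flatten (unzip1 l)) ->
  measurable (bits_event pre l) /\
  P (bits_event pre l) =
    (2^-1 ^+ size pre * \prod_(xQ <- l) wt R (size xQ.1) xQ.2)%:E.
Proof.
elim: l pre => [|[x Q] l IHl] pre; first by rewrite cats0 big_nil mulr1 => /bits_event_nil.
rewrite big_cons /=; elim: x Q pre => [|i x IH] Q pre /=.
  move=> u; have [m1 p1] := IHl pre u.
  have [q|q] := boolP (Q [::]).
    rewrite (_ : bits_event _ _ = bits_event pre l) ?mul1r//.
    by apply/seteqP; split => t; rewrite /bits_event /= q.
  rewrite mul0r mulr0 (_ : bits_event _ _ = set0) ?measure0//.
  by apply/seteqP; split => t //; rewrite /bits_event /= (negbTE q) andbF.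
move=> u.
have {}u : uniq ([:: i] ++ unzip1 pre ++ x ++ flatten (unzip1 l)) by rewrite uniq_catCA.
have [m1 p1] := IH (fun w => Q (true :: w)) ((i, true) :: pre) u.
have [m2 p2] := IH (fun w => Q (false :: w)) ((i, false) :: pre) u.
rewrite (_ : bits_event _ _ =
    bits_event ((i, true) :: pre) ((x, fun w => Q (true :: w)) :: l) `|`
    bits_event ((i, false) :: pre) ((x, fun w => Q (false :: w)) :: l)); last first.
  apply/seteqP; split => t; rewrite /bits_event /=.
    by move=> /and3P[-> q ->]; case: (X i t) q => ->; [left|right].
  by case=> /and3P[/andP[/eqP -> ->] -> ->].
split; first exact: measurableU.
rewrite measureU//; last first.
  apply/seteqP; split => t //; rewrite /bits_event /=.
  by move=> [/and3P[/andP[/eqP -> _] _ _] /and3P[/andP[]]].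
apply: (etrans (congr2 adde p1 p2)).
by apply: (congr1 EFin) => /=; rewrite exprS; ring.
Qed.

End IndependentBits.

Definition pos (x : int) (n : nat) : seq int := [seq x + (j : nat)%:Z | j <- iota 0 n].

Lemma wd_pos dir x n : wd dir x n = map dir (pos x n).
Proof. by rewrite /wd /pos -map_comp. Qed.

Lemma size_pos x n : size (pos x n) = n. Proof. by rewrite size_map size_iota. Qed.

Lemma mem_pos x n y : (y \in pos x n) = (x <= y < x + n%:Z).
Proof.
apply/mapP/andP => [[j]|[xy yx]]; first by rewrite mem_iota => jn ->; lia.
by exists (absz (y - x)%R); [rewrite mem_iota|]; lia.
Qed.

Lemma uniq_pos x n : uniq (pos x n).
Proof. by rewrite map_inj_uniq ?iota_uniq// => i j; lia. Qed.

(** * Almost sure existence of the matchings *)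

Section AlmostSureMatching.
Context {R : realType} {d : measure_display} {T : measurableType d}.
Variables (P : probability T R) (I : eqType) (X : I -> {RV P >-> bool}).
Hypothesis indX : mutually_independent X.
Hypothesis halfX : forall i b, P (X i @^-1` [set b]) = (2^-1)%:E.
Variable s : int -> I.
Hypothesis s_inj : injective s.

Local Notation dir t := (fun i : int => X (s i) t).

Lemma Mtn_prob x n : measurable [set t | Mtn (dir t) x n] /\
  P [set t | Mtn (dir t) x n] = (2^-1 ^+ 2 * wcoef (fun=> 1) n)%:E.
Proof.
pose pre := [:: (s x, true); (s (x + 1 + n%:Z), false)].
pose l := [:: ([seq s i | i <- pos (x + 1) n], bal 0)].
have -> : [set t | Mtn (dir t) x n] = bits_event X pre l.
  apply/seteqP; split => t; rewrite /bits_event /Mtn /= !andbT -map_comp wd_pos eqb_id eqbF_neg.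
    by move=> /and3P[-> -> ->].
  by move=> /andP[/andP[-> ->] ->].
have [|m1 p1] := bits_eventP indX halfX (pre := pre) (l := l).
  rewrite /= cats0 !inE !mem_map// !mem_pos (inj_eq s_inj) map_inj_uniq// uniq_pos andbT.
  by lia.
by split=> //; rewrite p1 big_seq1 /= size_map size_pos wt_bal0.
Qed.

(** The two ends of an arc cost [1/4], and the sum of [Cat(m) / 4 ^ m] is 2. Letting the left end
    depend on [n] covers both a fixed left end and a fixed right end. *)
Lemma bigcup_Mtn_prob (x : nat -> int) : 
  trivIset [set: nat] (fun n => [set t | Mtn (dir t) (x n) n]) ->
  measurable (\bigcup_n [set t | Mtn (dir t) (x n) n]) /\
  P (\bigcup_n [set t | Mtn (dir t) (x n) n]) = (2^-1)%:E.
Proof.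
move=> tr; have mM n := (Mtn_prob (x n) n).1; split; first exact: bigcupT_measurable.
rewrite measure_semi_bigcup//; last exact: bigcupT_measurable.
transitivity (\sum_(n <oo) ((2^-1 ^+ 2)%:E * (wcoef (fun=> 1 : R) n)%:E))%E.
  by apply: eq_eseriesr => n _; apply: (etrans (Mtn_prob (x n) n).2); rewrite EFinM.
rewrite nneseriesZl; last by move=> n _; rewrite lee_fin wcoef_ge0//; exact: weight1.
rewrite wcoef_total; last exact: weight1.
by rewrite wtotal1 -EFinM; congr EFin; rewrite expr2 -mulrA mulVf ?mulr1// pnatr_eq0.
Qed.

Lemma matched_prob x : measurable [set t | matched (dir t) x] /\
  P [set t | matched (dir t) x] = 1%E.
Proof.
have [|m1 p1] := @bigcup_Mtn_prob (fun=> x).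
  by apply/trivIsetP => i j _ _ /eqP ij; apply/seteqP; split => // t [/= h1 h2]; case: ij; exact: Mtn_uniq_r h1 h2.
have [|m2 p2] := @bigcup_Mtn_prob (fun n => x - 1 - n%:Z).
  apply/trivIsetP => i j _ _ /eqP ij; apply/seteqP; split => // t [/= h1 h2]; case: ij.
  by apply: Mtn_uniq_l h1 h2 _; lia.
have -> : [set t | matched (dir t) x] = \bigcup_n [set t | Mtn (dir t) x n] `|`
    \bigcup_n [set t | Mtn (dir t) (x - 1 - n%:Z) n].
  apply/seteqP; split => t /=; first by case=> n [h|h]; [left|right]; exists n.
  by case=> -[n _ /= h]; exists n; [left|right].
split; first exact: measurableU.
rewrite measureU//.
  apply: (etrans (congr2 adde p1 p2)).
  by apply: (congr1 EFin); rewrite -mulr2n -[RHS](mulVf (x := 2 : R)) ?pnatr_eq0// mulr_natr.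
apply/seteqP; split => t // -[[n1 _ /and3P[dx _ _]] [n2 _ /and3P[_ _]]].
by rewrite (_ : x - 1 - n2%:Z + 1 + n2%:Z = x) ?dx//; lia.
Qed.

Lemma all_matched_prob : measurable [set t | forall x, matched (dir t) x] /\
  P [set t | forall x, matched (dir t) x] = 1%E.
Proof.
pose B x := ~` [set t | matched (dir t) x].
have mB x : measurable (B x) by apply: measurableC; exact: (matched_prob x).1.
have nB x : P.-negligible (B x).
  apply/(negligibleP _ (mB x)).2/(etrans (probability_setC P (matched_prob x).1)).
  by rewrite (matched_prob x).2 subee.
pose A n := B (Posz n) `|` B (Negz n).
have mA n : measurable (A n) by exact: measurableU.
have mUA : measurable (\bigcup_n A n) by exact: bigcupT_measurable.
have -> : [set t | forall x, matched (dir t) x] = ~` \bigcup_n A n.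
  apply/seteqP; split => t /=; first by move=> h [n _ []]; apply; exact: h.
  by move=> h x; apply: contrapT => nx; apply: h; case: x nx => n nx; exists n => //; [left|right].
split; first exact: measurableC.
have nA : P.-negligible (\bigcup_n A n).
  by apply: negligible_bigcup => n; apply: negligibleU; exact: nB.
rewrite probability_setC//.
by have /negligibleP -> := nA; rewrite ?sube0.
Qed.

End AlmostSureMatching.

(** * The shape of the component of 0 *)

Lemma face_okP n (m : 'I_n -> 'I_n) (dir : int -> bool) (p : nat -> int) (G : nat -> nat)
    (mu : int -> int) : noncrossing_perfect_matching m ->
  (forall j, p j.+1 = p j + 1 + (G j)%:Z) -> arrow_matching dir mu ->
  (forall i : 'I_n, (i < m i)%N -> face_ok m dir p G i) <->
  (forall i : 'I_n, mu (p i) = p (m i)).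
Proof.
move=> hm hp am; have [[muK _ _] mudir] := am.
have p_mono : {homo p : i j / (i < j)%N >-> i < j}.
  by apply: homo_ltn => [? ? ?|j]; [exact: lt_trans|rewrite hp; lia].
rewrite -arcs_faces//; split=> [ok i|pm i im].
  wlog im : i / (i < m i)%N => [wl|].
    have := match_neq hm i; rewrite neq_ltn => /orP[lt|]; last exact: wl.
    by have := wl (m i); rewrite (matchK hm) => /(_ lt) <-; rewrite muK.
  have /(arc_okE dir hp im)[N hN <-] := ok i im.
  exact: (Mtn_arrow_matching am hN).
apply/(arc_okE dir hp im); have lt : p i < mu (p i) by rewrite pm; exact: p_mono.
exists (absz (mu (p i) - p i - 1)%R); first exact: arrow_matching_Mtn.
by rewrite -pm; lia.
Qed.

(** One inclusion transports paths of [M], which is connected; the other holds because the image of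
    [p] is stable under both matchings. *)
Lemma range_component k (M : meander k) (mu ml : int -> int) (p : 'I_k.*2 -> int) z :
  (forall i, mu (p i) = p (upper M i)) -> (forall i, ml (p i) = p (lower M i)) ->
  range p = component mu ml (p z).
Proof.
move=> pu pl; apply/seteqP; split=> [_ [i _ <-]|y [s]].
  have : component (upper M) (lower M) z i by rewrite single_loop.
  move=> [s ps ls]; exists (map p s); last by rewrite last_map ls.
  elim: s {ls} z ps => //= j s IH z /andP[zj /IH ->]; rewrite andbT.
  by rewrite /joined pu pl; case/orP: zj => /eqP ->; rewrite eqxx ?orbT.
elim: s z => [|x s IH] z /=; first by move=> _ <-; exists z.
by case/andP => /orP[] /eqP ->; rewrite ?pu ?pl; exact: IH.
Qed.

Lemma increasing_range_inj n (f h : 'I_n -> int) :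
  (forall i j : 'I_n, (i < j)%N -> f i < f j) -> (forall i j : 'I_n, (i < j)%N -> h i < h j) ->
  range f = range h -> f =1 h.
Proof.
have half (f1 f2 : 'I_n -> int) (i : 'I_n) : (forall i j : 'I_n, (i < j)%N -> f1 i < f1 j) ->
    (forall i j : 'I_n, (i < j)%N -> f2 i < f2 j) -> range f1 = range f2 ->
    (forall j : 'I_n, (j < i)%N -> f1 j = f2 j) -> f2 i <= f1 i.
  move=> h1 h2 r e; have : range f2 (f1 i) by rewrite -r; exists i.
  move=> [j _ ej]; rewrite -ej; have [ji|ij|/val_inj->//] := ltngtP j i; last exact/ltW/h2.
  by have := h1 _ _ ji; rewrite -ej e// ltxx.
move=> hf hh r i; have [N] := ubnP (i : nat); elim: N i => // N IH i iN.
apply/le_anti/andP; split; apply: half => // j ji; rewrite IH//; lia.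
Qed.

Section Shapes.
Variables (k : nat) (M : meander k).
Local Notation n := k.*2.

(* The [i]-th point of a component with gaps [G] whose [z]-th point is 0. *)
Definition npoint (z : 'I_n) (G : nat -> nat) (j : nat) : int :=
  (\sum_(l < j) (G l).+1)%N%:Z - (\sum_(l < z) (G l).+1)%N%:Z.

Lemma npointS z G j : npoint z G j.+1 = npoint z G j + 1 + (G j)%:Z.
Proof. by rewrite /npoint big_ord_recr /=; lia. Qed.

Lemma npoint_mono z G : {homo npoint z G : i j / (i < j)%N >-> i < j}.
Proof. by apply: homo_ltn => [? ? ?|j]; [exact: lt_trans|rewrite npointS; lia]. Qed.

Lemma npoint0 z G : npoint z G z = 0. Proof. exact: subrr. Qed.

Definition gapext (g : 'I_n.-1 -> nat) (j : nat) : nat :=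
  if insub j is Some i then g i else 0%N.

Lemma gapextE g (j : 'I_n.-1) : gapext g j = g j.
Proof. by rewrite /gapext valK. Qed.

Definition shaped (up dn : int -> bool) (z : 'I_n) (g : 'I_n.-1 -> nat) : Prop :=
  (forall i : 'I_n, (i < upper M i)%N ->
     face_ok (upper M) up (npoint z (gapext g)) (gapext g) i) /\
  (forall i : 'I_n, (i < lower M i)%N ->
     face_ok (lower M) dn (npoint z (gapext g)) (gapext g) i).

Lemma S0_isP up dn : (forall x, matched up x) -> (forall x, matched dn x) ->
  S0_is up dn M <-> exists z g, shaped up dn z g.
Proof.
move=> mup mdn; split.
  move=> [mu [ml [amu aml [p [p_incr rp pu pl]]]]].
  have [z _ pz] : range p 0 by rewrite rp; exists [::].
  pose q j := if insub j is Some i then p i else 0.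
  have qE (i : 'I_n) : q i = p i by rewrite /q valK.
  pose g (j : 'I_n.-1) := absz (q j.+1 - q j - 1)%R.
  exists z, g; have pE (i : 'I_n) : npoint z (gapext g) i = p i.
    (* Both enumerations have the same gaps, so their difference is constant, and it vanishes at the
       index [z]. *)
    suff h j : (j < n)%N -> npoint z (gapext g) j - q j = npoint z (gapext g) 0 - q 0%N.
      by have := h i (ltn_ord i); have := h z (ltn_ord z); rewrite !qE pz npoint0; lia.
    elim: j => // j IH jn; rewrite -(IH (ltnW jn)) npointS.
    have jn' : (j < n.-1)%N by rewrite ltn_predRL.
    rewrite -[j in gapext _ j]/(nat_of_ord (Ordinal jn')) gapextE /g /=.
    have := p_incr (Ordinal (ltnW jn)) (Ordinal jn) (ltnSn _).
    by rewrite -!qE /=; lia.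
  split.
    apply/(face_okP (upper_matching M) (npointS z _) amu) => i.
    by rewrite !pE.
  by apply/(face_okP (lower_matching M) (npointS z _) aml) => i; rewrite !pE.
move=> [z [g [h1 h2]]].
have [mu amu] := arrow_matching_exists mup.
have [ml aml] := arrow_matching_exists mdn.
have /(face_okP (upper_matching M) (npointS z _) amu) {}h1 := h1.
have /(face_okP (lower_matching M) (npointS z _) aml) {}h2 := h2.
exists mu, ml; split=> //; exists (fun i => npoint z (gapext g) i); split=> //.
  by move=> i j; exact: npoint_mono.
by rewrite (range_component z h1 h2) npoint0.
Qed.

(** Both sequences enumerate increasingly the component of 0. Hence distinct [(z, g)] give disjoint
    events where all arrows are matched, and probabilities add up. *)
Lemma shaped_inj up dn z g z' g' :
  (forall x, matched up x) -> (forall x, matched dn x) ->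
  shaped up dn z g -> shaped up dn z' g' -> z = z' /\ g = g'.
Proof.
move=> mup mdn [h1 h2] [h1' h2'].
have [mu amu] := arrow_matching_exists mup.
have [ml aml] := arrow_matching_exists mdn.
have /(face_okP (upper_matching M) (npointS z _) amu) {}h1 := h1.
have /(face_okP (lower_matching M) (npointS z _) aml) {}h2 := h2.
have /(face_okP (upper_matching M) (npointS z' _) amu) {}h1' := h1'.
have /(face_okP (lower_matching M) (npointS z' _) aml) {}h2' := h2'.
pose p (i : 'I_n) := npoint z (gapext g) i; pose p' (i : 'I_n) := npoint z' (gapext g') i.
have pp' : p =1 p'.
  apply: increasing_range_inj => [i j|i j|]; [exact: npoint_mono|exact: npoint_mono|].
  by rewrite (range_component z h1 h2) (range_component z' h1' h2') !npoint0.
split.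
  have [lt|lt|/val_inj//] := ltngtP z z'.
    have := npoint_mono z' (gapext g') lt; have := pp' z.
    by rewrite /p /p' !npoint0 => <-; rewrite ltxx.
  have := npoint_mono z (gapext g) lt; have := pp' z'.
  by rewrite /p /p' !npoint0 => ->; rewrite ltxx.
apply/funext => j; have j2 : (j.+1 < n)%N by rewrite -ltn_predRL.
have := pp' (Ordinal j2); have := pp' (Ordinal (ltnW j2)).
by rewrite /p /p' /= !npointS !gapextE; lia.
Qed.

End Shapes.

(** The last hypothesis says that distinct labels agreeing off [s] give disjoint events. Countable
    additivity is applied to one label at a time, in the nesting order of [isum]. *)
Lemma measure_isum (R : realType) (J : finType) (d : measure_display) (T : measurableType d)
    (P : {measure set T -> \bar R}) (s : seq J) (Q : (J -> nat) -> set T) : uniq s ->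
  (forall g, measurable (Q g)) ->
  (forall t g g', (forall e, e \notin s -> g e = g' e) -> Q g t -> Q g' t -> g = g') ->
  measurable [set t | exists2 g, (forall e, e \notin s -> g e = 0%N) & Q g t] /\
  P [set t | exists2 g, (forall e, e \notin s -> g e = 0%N) & Q g t] =
    isum s (fun g => P (Q g)).
Proof.
elim: s Q => [|e s IH] Q /= => [_|/andP[es us]] mQ injQ.
  rewrite (_ : [set t | _] = Q (fun=> 0%N))//; apply/seteqP; split => t /=.
    by move=> [g g0]; rewrite (_ : g = fun=> 0%N)//; apply/funext => e; exact: g0.
  by move=> q; exists (fun=> 0%N).
pose Q' g := \bigcup_n Q (upd g e n).
have mQ' g : measurable (Q' g) by exact: bigcupT_measurable.
have injQ' t g g' n n' : (forall e', e' \notin s -> g e' = g' e') ->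
    Q (upd g e n) t -> Q (upd g' e n') t -> n = n' /\ g = g'.
  move=> gg q q'; have u : upd g e n = upd g' e n'.
    apply: injQ q q' => e'; rewrite inE negb_or => /andP[e'e e's].
    by rewrite /upd (negbTE e'e) gg.
  have ue := congr1 (fun f => f e) u; rewrite /upd eqxx in ue; split=> //.
  apply/funext => e'; have [->|ne] := eqVneq e' e; first exact: gg.
  by have := congr1 (fun f => f e') u; rewrite /upd (negbTE ne).
have [|m1 p1] := IH Q' us mQ'.
  by move=> t g g' gg [n _ q] [n' _ q']; have [] := injQ' t g g' n n' gg q q'.
have E : [set t | exists2 g, (forall e', e' \notin e :: s -> g e' = 0%N) & Q g t] =
    [set t | exists2 g, (forall e', e' \notin s -> g e' = 0%N) & Q' g t].
  apply/seteqP; split => t /= [g g0].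
    move=> q; exists (upd g e 0).
      move=> e' e's; rewrite /upd; case: eqVneq => // ne; apply: g0.
      by rewrite inE negb_or ne.
    exists (g e) => //; rewrite (_ : upd _ _ _ = g)//; apply/funext => e'.
    by rewrite /upd; case: eqVneq => // ->.
  move=> [n _ q]; exists (upd g e n) => // e'; rewrite inE negb_or => /andP[ne e's].
  by rewrite /upd (negbTE ne) g0.
rewrite E; split=> //; apply: (etrans p1); apply: eq_isum => g.
apply: measure_semi_bigcup => //; last exact: mQ'.
apply/trivIsetP => n n' _ _ /eqP nn; apply/seteqP; split => // t [q q']; case: nn.
by have [] := injQ' t g g n n' (fun _ _ => erefl) q q'.
Qed.

(** * Positions of the arrows in the faces *)

Section FacePositions.
Variables (n : nat) (m : 'I_n -> 'I_n) (p : nat -> int) (G : nat -> nat).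
Hypothesis hm : noncrossing_perfect_matching m.
Hypothesis hp : forall j, p j.+1 = p j + 1 + (G j)%:Z.

Definition facepos (i : 'I_n) : seq int :=
  flatten [seq pos (p j + 1) (G j) | j <- [seq j <- iota i (m i - i).-1.+1 | inface m i j]].

Lemma facepos_mem i y : y \in facepos i -> exists2 j, inface m i j & p j < y < p j.+1.
Proof.
move=> /flatten_mapP[j]; rewrite mem_filter => /andP[fj _]; rewrite mem_pos => h.
by exists j => //; rewrite hp; lia.
Qed.

Let p_mono : {homo p : i j / (i < j)%N >-> i < j}.
Proof. by apply: homo_ltn => [? ? ?|j]; [exact: lt_trans|rewrite hp; lia]. Qed.

Let p_le i i' : (i <= i')%N -> p i <= p i'.
Proof. by rewrite leq_eqVlt => /predU1P[->//|/p_mono/ltW]. Qed.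

Lemma gap_uniq j j' y : p j < y < p j.+1 -> p j' < y < p j'.+1 -> j = j'.
Proof.
move=> /andP[h1 h2] /andP[h1' h2'].
by case: (ltngtP j j') => // /p_le; lia.
Qed.

Lemma uniq_flatten (A B : eqType) (f : A -> seq B) (s : seq A) : uniq s ->
  (forall x, uniq (f x)) -> (forall x x' y, y \in f x -> y \in f x' -> x = x') ->
  uniq (flatten (map f s)).
Proof.
move=> + uf disj; elim: s => //= x s IH /andP[xs us].
rewrite cat_uniq uf IH// andbT /=; apply/hasPn => y /flatten_mapP[x' x's yx'].
by apply/negP => yx; move: xs; rewrite (disj _ _ _ yx yx') x's.
Qed.

Lemma uniq_facepos i : uniq (facepos i).
Proof.
apply: uniq_flatten => [|j|j j' y]; first by rewrite filter_uniq ?iota_uniq.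
- exact: uniq_pos.
- by rewrite !mem_pos => h h'; apply: (@gap_uniq _ _ y); rewrite hp; lia.
Qed.

Lemma uniq_positions : uniq ([seq p i | i : 'I_n] ++ flatten [seq facepos i | i : 'I_n]).
Proof.
have pinj : injective (fun i : 'I_n => p i).
  by move=> i j e; case: (ltngtP i j) => [/p_mono|/p_mono|/val_inj//]; rewrite e ltxx.
rewrite cat_uniq map_inj_uniq// enum_uniq /= uniq_flatten ?enum_uniq ?andbT//; last first.
- move=> i i' y /facepos_mem[j fj h] /facepos_mem[j' fj' h'].
  by move: fj'; rewrite -(gap_uniq h h'); exact: inface_uniq.
- exact: uniq_facepos.
apply/hasPn => y /flatten_mapP[i _ /facepos_mem[j _ /andP[h1 h2]]].
apply/negP => /mapP[i' _ e]; rewrite e in h1 h2.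
by case: (leqP i' j) => /p_le; rewrite leNgt ?h1 ?h2.
Qed.

(** All points may be quantified over instead of the opening ones: the face of a closing point is
    empty, so its word is balanced, and the closing arrow of each arc becomes a condition at its own
    index. *)
Lemma faces_okE (dir : int -> bool) :
  (forall i : 'I_n, (i < m i)%N -> face_ok m dir p G i) <->
  [forall i : 'I_n, dir (p i) == (i < m i)%N] &&
  [forall i : 'I_n, bal 0 (map dir (facepos i))].
Proof.
have fE i : map dir (facepos i) = facew m dir p G i i (m i - i).-1.
  rewrite /facepos /facew map_flatten -map_comp; congr flatten.
  by apply: eq_map => j; rewrite /= -wd_pos.
split=> [ok|/andP[/forallP h1 /forallP h2] i im]; last first.
  apply/and3P; split; first by rewrite (eqP (h1 i)).
    by rewrite -fE.
  by rewrite (eqP (h1 (m i))) (matchK hm) -leqNgt ltnW.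
apply/andP; split; apply/forallP => i; have [im|mi] := ltnP i (m i).
- by have /and3P[-> _ _] := ok i im.
- have lt : (m i < m (m i))%N by rewrite (matchK hm) ltn_neqAle (match_neq hm).
  by have /and3P[_ _] := ok _ lt; rewrite (matchK hm) => /negbTE ->.
- by rewrite fE; have /and3P[] := ok i im.
(* Truncated subtraction leaves the single gap [i], which is not in the face of a closing point. *)
- rewrite /facepos (_ : (m i - i).-1 = 0)%N; last by lia.
  by rewrite /= {1}/inface leqnn ltnNge mi.
Qed.

Lemma size_facepos (g : 'I_n.-1 -> nat) (s : seq 'I_n.-1) (i : 'I_n) :
  (forall j : 'I_n.-1, G j = g j) -> uniq s -> (forall j, j \in s) -> size (facepos i) = (\sum_(j <- s | inface m i j) g j)%N.
Proof.
move=> GE us sT; rewrite /facepos; move eL: ((m i - i).-1.+1) => L; rewrite size_flatten /shape -map_comp sumnE big_map.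
rewrite (eq_bigr G) => [|j _]; last by rewrite /= size_pos.
have ps : perm_eq s (index_enum 'I_n.-1).
  by apply: uniq_perm => // [|j]; rewrite ?index_enum_uniq// mem_index_enum sT.
rewrite (perm_big _ ps) /= (eq_bigr (fun j : 'I_n.-1 => G j)) => [|j _]; last by rewrite GE.
rewrite -(big_mkord (inface m i) G) -[RHS]big_filter; apply: perm_big; apply: uniq_perm.
- by rewrite filter_uniq ?iota_uniq.
- by rewrite filter_uniq ?iota_uniq.
move=> j; rewrite !mem_filter; case: (boolP (inface m i j)) => //= /and3P[h1 h2 _].
rewrite mem_iota mem_index_iota h1 -eL /=.
by have := ltn_ord (m i); lia.
Qed.

End FacePositions.

(** * Probability of a shape in the noodle *)

Section NoodleShapes.
Context {R : realType} {d : measure_display} {T : measurableType d}.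
Variables (P : probability T R) (up dn : int -> {RV P >-> bool}).
Hypothesis noodle : infinite_noodle up dn.
Variables (k : nat) (M : meander k).
Local Notation n := k.*2.

Let X (a : int + int) : {RV P >-> bool} :=
  match a with inl i => up i | inr i => dn i end.
Let indX : mutually_independent X := noodle.1.
Let halfX : forall a b, P (X a @^-1` [set b]) = (2^-1)%:E := noodle.2.

Definition all_matched : set T :=
  [set t | (forall x, matched (fun i => up i t) x) /\ (forall x, matched (fun i => dn i t) x)].

Lemma measurable_all_matched : measurable all_matched.
Proof.
have [m1 _] := all_matched_prob indX halfX (@inl_inj int int).
have [m2 _] := all_matched_prob indX halfX (@inr_inj int int).
exact: measurableI m1 m2.
Qed.

Lemma prob_all_matchedI (E : set T) : measurable E -> P (all_matched `&` E) = P E.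
Proof.
move=> mE.
have [m1 p1] := all_matched_prob indX halfX (@inl_inj int int).
have [m2 p2] := all_matched_prob indX halfX (@inr_inj int int).
have mN : measurable (~` all_matched) by apply: measurableC; exact: measurable_all_matched.
have N0 : P (~` all_matched) = 0%E.
  apply/(negligibleP _ mN); rewrite /all_matched.
  rewrite (_ : ~` _ = ~` [set t | forall x, matched (fun i => up i t) x] `|`
    ~` [set t | forall x, matched (fun i => dn i t) x]); last exact: setCI.
  apply: negligibleU; apply/(negligibleP _ (measurableC _)).2 => //.
    by apply: (etrans (probability_setC P m1)); rewrite p1 subee.
  by apply: (etrans (probability_setC P m2)); rewrite p2 subee.
rewrite -[in RHS](setIT E) -(setvU all_matched) setIUr measureU; last 3 first.
- exact: measurableI.
- by apply: measurableI => //; exact: measurable_all_matched.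
- by rewrite setIACA setICl setI0.
rewrite [X in (_ = X + _)%E](_ : _ = 0)%E ?add0e 1?setIC//.
apply/eqP; rewrite eq_le measure_ge0 andbT -N0 le_measure// ?inE//.
exact: measurableI.
Qed.

Definition shape_event (z : 'I_n) (g : 'I_n.-1 -> nat) : set T :=
  [set t | shaped M (fun i => up i t) (fun i => dn i t) z g].

(** The [n + n] prescribed bits are the arrows at the points, above and below the line; the faces
    are words at further positions, all distinct. *)
Lemma shape_event_prob (s : seq 'I_n.-1) z g : uniq s -> (forall j, j \in s) ->
  measurable (shape_event z g) /\ P (shape_event z g) =
  (2^-1 ^+ (n + n) * \prod_v wcoef (fun=> 1) (load (gap_inc M) v g s))%:E.
Proof.
move=> us sT; pose G := gapext g; pose p := npoint z G.
have hu := upper_matching M; have hl := lower_matching M.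
have hp : forall j, p j.+1 = p j + 1 + (G j)%:Z := npointS z G.
pose fu := facepos (upper M) p G; pose fl := facepos (lower M) p G.
pose pre := [seq (inl (p i) : int + int, (i < upper M i)%N) | i : 'I_n] ++
  [seq (inr (p i) : int + int, (i < lower M i)%N) | i : 'I_n].
pose l := [seq ([seq inl y : int + int | y <- fu i], bal 0) | i : 'I_n] ++
  [seq ([seq inr y : int + int | y <- fl i], bal 0) | i : 'I_n].
have -> : shape_event z g = bits_event X pre l.
  apply/seteqP; split => t; rewrite /shape_event /bits_event /= !all_cat.
    move=> [/(faces_okE _ _ hu _)/andP[/forallP u1 /forallP u2]
      /(faces_okE _ _ hl _)/andP[/forallP l1 /forallP l2]].
    rewrite -!andbA; apply/and4P; split; apply/allP => _ /mapP[i _ ->] //=.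
      by rewrite -map_comp; exact: u2.
    by rewrite -map_comp; exact: l2.
  rewrite -!andbA => /and4P[/allP u1 /allP l1 /allP u2 /allP l2]; split.
    apply/(faces_okE _ _ hu _)/andP; split; apply/forallP => i.
      exact: u1 (map_f _ (mem_enum _ i)).
    by have := u2 _ (map_f _ (mem_enum _ i)); rewrite /= -map_comp.
  apply/(faces_okE _ _ hl _)/andP; split; apply/forallP => i.
    exact: l1 (map_f _ (mem_enum _ i)).
  by have := l2 _ (map_f _ (mem_enum _ i)); rewrite /= -map_comp.
have [|m1 p1] := bits_eventP indX halfX (pre := pre) (l := l).
  rewrite /unzip1 !map_cat flatten_cat -!map_comp.
  pose Uu := [seq p i | i : 'I_n] ++ flatten [seq fu i | i : 'I_n].
  pose Ul := [seq p i | i : 'I_n] ++ flatten [seq fl i | i : 'I_n].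
  rewrite (@perm_uniq _ _ ([seq inl y | y <- Uu] ++ [seq inr y | y <- Ul])).
    rewrite cat_uniq !map_inj_uniq; [|exact: inr_inj|exact: inl_inj].
    rewrite !uniq_positions// andbT /=; apply/hasPn => _ /mapP[y _ ->].
    by apply/negP => /mapP[].
  rewrite !map_cat !map_flatten -!map_comp -!catA.
  by rewrite perm_cat2l perm_catCA.
split=> //; rewrite p1; congr (_ * _)%:E; first by rewrite size_cat !size_map -enumT size_enum_ord.
rewrite big_cat !big_map /= big_sumType /= -!big_enum /=.
congr (_ * _); apply: eq_bigr => i _; rewrite size_map wt_bal0; congr wcoef.
  by apply: size_facepos => //; exact: gapextE.
by apply: size_facepos => //; exact: gapextE.
Qed.

Lemma shape_at_prob z : measurable [set t | all_matched t /\ exists g, shape_event z g t] /\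
  exists2 q : R, Qpi q & P [set t | all_matched t /\ exists g, shape_event z g t] = q%:E.
Proof.
have Qr : Qpi ((2^-1 : R) ^+ (n + n)) by apply: Qpi_exp; exact: Qpi_natV.
have r0 : 0 <= (2^-1 : R) ^+ (n + n) by rewrite exprn_ge0.
have [s [us sT [q Qq qE]]] := meander_sum_Qpi M Qr r0.
pose Q g := all_matched `&` shape_event z g.
have mQ g : measurable (Q g).
  apply: measurableI; first exact: measurable_all_matched.
  exact: (shape_event_prob z g us sT).1.
have [|m1 p1] := measure_isum P us mQ.
  by move=> t g g' _ [[mu md] h1] [_ h2]; have [] := shaped_inj mu md h1 h2.
have E : [set t | exists2 g, (forall e, e \notin s -> g e = 0%N) & Q g t] =
    [set t | all_matched t /\ exists g, shape_event z g t].
  apply/seteqP; split => t /=; first by move=> [g _ [h1 h2]]; split=> //; exists g.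
  by move=> [h1 [g h2]]; exists g => // e; rewrite sT.
rewrite E in m1 p1; split=> //; exists q => //; rewrite p1 -qE; apply: eq_isum => g.
have [me pe] := shape_event_prob z g us sT.
exact: (etrans (prob_all_matchedI me) pe).
Qed.

Lemma noodle_shape_Qpi : exists2 q : R, Qpi q &
  P [set t | S0_is (fun i => up i t) (fun i => dn i t) M] = q%:E.
Proof.
pose A z := [set t | all_matched t /\ exists g, shape_event z g t].
have -> : [set t | S0_is (fun i => up i t) (fun i => dn i t) M] =
    [set t | exists2 z, z \in index_enum 'I_n & A z t].
  apply/seteqP; split => t /=.
    move=> S0; have am : all_matched t.
      by move: S0 => [mu [ml [amu aml _]]]; split=> x; [exact: arrow_matching_matched amu|exact: arrow_matching_matched aml].
    have [z [g zg]] := (S0_isP M am.1 am.2).1 S0.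
    by exists z; [rewrite mem_index_enum|split=> //; exists g].
  by move=> [z _ [am [g zg]]]; apply/(S0_isP M am.1 am.2); exists z, g.
suff h (r : seq 'I_n) : uniq r -> measurable [set t | exists2 z, z \in r & A z t] /\
    exists2 q : R, Qpi q & P [set t | exists2 z, z \in r & A z t] = q%:E.
  by have [] := h _ (index_enum_uniq _).
elim: r => [_|z r IH /andP[zr /IH[mr [q Qq qE]]]].
  rewrite (_ : [set t | _] = set0); last by apply/seteqP; split => t // -[].
  by split=> //; exists 0; [exact: (Qpi_nat R 0)|rewrite measure0].
have [mz [q' Qq' qE']] := shape_at_prob z.
have -> : [set t | exists2 y, y \in z :: r & A y t] =
    A z `|` [set t | exists2 y, y \in r & A y t].
  apply/seteqP; split => t /=.
    by move=> [y]; rewrite inE => /predU1P[->|yr] h; [left|right; exists y].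
  by move=> [h|[y yr h]]; [exists z => //; rewrite mem_head|exists y => //; rewrite inE yr orbT].
split; first exact: measurableU.
exists (q' + q); first exact: QpiD.
rewrite measureU//; first exact: (congr2 adde qE' qE).
apply/seteqP; split => t // -[[am [g h]] [y yr [_ [g' h']]]].
by move: zr; rewrite (shaped_inj am.1 am.2 h h').1 yr.
Qed.

End NoodleShapes.

Theorem corollary4 (R : realType) (d : measure_display) (T : measurableType d)
    (P : probability T R) (up dn : int -> {RV P >-> bool})
    (noodle : infinite_noodle up dn)
    (k : nat) (k_ge1 : (1 <= k)%N) (M : meander k) :
  exists q : {poly rat},
    P [set t | S0_is (fun i => up i t) (fun i => dn i t) M] =
    ((map_poly ratr q).[(pi : R)^-1])%:E.
Proof.
by have [_ [q ->] ->] := noodle_shape_Qpi noodle M; exists q.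
Qed.
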